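(* Let $p\in C^{1}([0,\frac{\pi}{2}])$ be such that $p(\varphi)\neq 0$ for all $\varphi\in[0,\frac{\pi}{2}]$, and let $g\in C^{1}([0,1))$ be defined by $g(x)=p(\sin^{-1}x)$. Let $0<\epsilon_1<\epsilon_2<\epsilon_3$ with $\epsilon_1<p(0)<\epsilon_2$, and let $A=\{\rho\in[0,1): g(\rho)\in[0,\epsilon_1]\cup[\epsilon_2,\epsilon_3]\}$. Let $w:[0,1]\times[0,\pi]\to\mathbb{R}$ be a weighting such that $W(r,\rho)=w\left(r,\sin^{-1}(\rho/r)\right)$ and its first order partial derivative with respect to $r$ are continuous on $\{(r,\rho): r\in A,\ \min(A)\le\rho\le r\}$ and $W(\rho,\rho)\neq0$ for $\rho\in A$. Let $f\in C_0^{\infty}(B_{0,\epsilon_1}\cup B_{\epsilon_2,\epsilon_3})$. Then $\mathcal{S}_{w,p}f$ determines the harmonic coefficients $F_{lm}(\rho)$ uniquely for $\rho\in g([0,1))$, for all even $l\in\{2k:k\in\mathbb{N}\}$ and $|m|\le l$. That is, if $f_1,f_2\in C_0^{\infty}(B_{0,\epsilon_1}\cup B_{\epsilon_2,\epsilon_3})$ satisfy $\mathcal{S}_{w,p}f_1=\mathcal{S}_{w,p}f_2$ on $[0,1]\times S^2$, then their harmonic coefficients satisfy $(F_1)_{lm}(\rho)=(F_2)_{lm}(\rho)$ for all $\rho\in g([0,1))$, all even $l\geq 0$ and all $|m|\le l$.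
   Context: Hollow balls: $B_{a,b}=\{x\in\mathbb{R}^3: a<|x|<b\}$. $\mathbb{N}$ includes $0$. $C_0^\infty(\Omega)$ denotes smooth real-valued functions with compact support in $\Omega$ (extended by zero to $\mathbb{R}^3$). Polar form: for $f:\mathbb{R}^3\to\mathbb{R}$ write $F(\rho,\theta,\varphi)=f(\rho\sin\varphi\cos\theta,\rho\sin\varphi\sin\theta,\rho\cos\varphi)$, where $\theta\in[0,2\pi]$ is the azimuth and $\varphi\in[0,\pi]$ the colatitude. Rotations: $h=U(\alpha)V(\beta)\in \mathrm{SO}(3)$, where $U(\alpha)$ and $V(\beta)$ are the rotations about the $x_3$- and $x_2$-axis by angles $\alpha\in[0,2\pi]$, $\beta\in[0,\pi]$ respectively, so that $h(0,0,1)^T=(\sin\beta\cos\alpha,\sin\beta\sin\alpha,\cos\beta)^T$. The pair $(\alpha,\beta)$ is identified with this point of $S^2$. The action is $(h\cdot f)(x)=f(hx)$, and $h\cdot F$ is the polar form of $h\cdot f$. Spherical harmonics: for integers $l\ge0$, $|m|\le l$, $$Y_l^m(\theta,\varphi)=(-1)^m\sqrt{\tfrac{(2l+1)(l-m)!}{4\pi(l+m)!}}\,P_l^m(\cos\varphi)e^{\mathrm{i}m\theta},\quad P_l^m(x)=(-1)^m(1-x^2)^{m/2}\tfrac{\mathrm{d}^m}{\mathrm{d}x^m}P_l(x),$$ with $P_l$ the Legendre polynomial of degree $l$ (and the usual convention $P_l^{-m}=(-1)^m\frac{(l-m)!}{(l+m)!}P_l^m$ for negative orders). They form an orthonormal basis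 of $L^2(S^2)$ with surface measure $\mathrm{d}\tau=\sin\varphi\,\mathrm{d}\theta\,\mathrm{d}\varphi$. The harmonic coefficients of $f$ are $F_{lm}(\rho)=\int_{S^2}F(\rho,\cdot)\bar Y_l^m\,\mathrm{d}\tau$. Symmetric curves: given $p\in C^1([0,\frac\pi2])$, viewed as a curve with polar radius $p(\varphi)$ at colatitude $\varphi$, set $\rho(r,\varphi)=p(\sin^{-1}(r\sin\varphi))$ for $(r,\varphi)\in[0,1]\times[0,\pi]$. Generalized spindle transform: for a weighting $w:[0,1]\times[0,\pi]\to\mathbb{R}$ (with $w(r,\cdot)$ integrable on $[0,\pi]$ for each $r$, so that the integrals make sense), $$\mathcal{S}_{w,p}f(r,\alpha,\beta)=\int_{0}^{2\pi}\int_{0}^{\pi}w(r,\varphi)\rho\sin\varphi\sqrt{\rho^2+\left(\tfrac{\mathrm{d}\rho}{\mathrm{d}\varphi}\right)^2}\,(h\cdot F)(\rho,\theta,\varphi)\Big|_{\rho=\rho(r,\varphi)}\mathrm{d}\varphi\,\mathrm{d}\theta,\qquad h=U(\alpha)V(\beta),$$ for $r\in[0,1]$ and $(\alpha,\beta)\in S^2$.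
   Formalization: W(r,ρ)=w(r,sin⁻¹(ρ/r)) is required on both branches of sin⁻¹, i.e. w(r,φ)=w(r,π−φ) where W is constrained; without this the claim fails, e.g. for p(φ)=1+φ and w=1 on φ≤π/2, w=−1 on φ>π/2, where the transform of every radial f is zero. *)

(* Defs.v *)
From HB Require Import structures.
From mathcomp Require Export all_boot all_order all_algebra.
From mathcomp Require Export all_classical all_reals all_analysis.
From mathcomp Require Export complex.

Set Implicit Arguments.
Unset Strict Implicit.
Unset Printing Implicit Defensive.

Import Order.TTheory GRing.Theory Num.Theory.
Import numFieldNormedType.Exports.

Local Open Scope classical_set_scope.
Local Open Scope ring_scope.

(* Derivative of f at x relative to D: the limit of the difference quotients
   over points of D \ {x}. It is one-sided at the endpoints of an interval, and
   any l qualifies when x is an isolated point of D. *)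
Definition is_derive_within (R : realType) (D : set R) (f : R -> R) (x l : R) :=
  (fun y => (f y - f x) / (y - x)) @ within (D `\ x) (nbhs x) --> l.

Definition C1_on (R : realType) (D : set R) (f : R -> R) :=
  exists2 df : R -> R, {within D, continuous df} &
    forall x, D x -> is_derive_within D f x (df x).

Fixpoint Ck (R : realType) (n : nat) (f : 'cV[R]_3 -> R) : Prop :=
  match n with
  | 0 => continuous f
  | n'.+1 => continuous f /\
      forall i : 'I_3,
        (forall x, derivable f x (delta_mx i 0 : 'cV[R]_3)) /\
        Ck n' (fun x => 'D_(delta_mx i 0 : 'cV[R]_3) f x)
  end.

Definition smooth (R : realType) (f : 'cV[R]_3 -> R) := forall n, Ck n f.

(* C_0^oo(Omega), each function being extended by zero to the whole space. *)
Definition test_function (R : realType) (Omega : set 'cV[R]_3)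
    (f : 'cV[R]_3 -> R) :=
  [/\ smooth f, compact (closure [set x | f x != 0])
    & closure [set x | f x != 0] `<=` Omega].

(* The library norm on matrices is the sup norm. *)
Definition enorm (R : realType) (x : 'cV[R]_3) : R :=
  Num.sqrt (\sum_(i < 3) x i 0 ^+ 2).

Definition hollow_ball (R : realType) (a b : R) : set 'cV[R]_3 :=
  [set x | a < enorm x < b].

Definition col3 (R : realType) (a b c : R) : 'cV[R]_3 :=
  \col_(i < 3) [:: a; b; c]`_i.

(* theta is the azimuth and phi the colatitude. *)
Definition polar_form (R : realType) (f : 'cV[R]_3 -> R) (rho theta phi : R) :=
  f (col3 (rho * sin phi * cos theta) (rho * sin phi * sin theta)
          (rho * cos phi)).

Definition rotU (R : realType) (a : R) : 'M[R]_3 :=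
  \matrix_(i < 3, j < 3)
    (nth [::] [:: [:: cos a; - sin a; 0];
                  [:: sin a;   cos a; 0];
                  [::     0;       0; 1]] i)`_j.

Definition rotV (R : realType) (b : R) : 'M[R]_3 :=
  \matrix_(i < 3, j < 3)
    (nth [::] [:: [::   cos b; 0; sin b];
                  [::       0; 1;     0];
                  [:: - sin b; 0; cos b]] i)`_j.

Definition rotUV (R : realType) (a b : R) : 'M[R]_3 := rotU a *m rotV b.

Definition rot_act (R : realType) (h : 'M[R]_3) (f : 'cV[R]_3 -> R) :
    'cV[R]_3 -> R :=
  fun x => f (h *m x).

Definition legendre (R : realType) (l : nat) : {poly R} :=
  (2 ^+ l * l`!%:R)^-1 *: (('X^2 - 1) ^+ l)^`(l).

Definition assoc_legendre_nat (R : realType) (l m : nat) (x : R) : R :=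
  (-1) ^+ m * Num.sqrt (1 - x ^+ 2) ^+ m * ((legendre R l)^`(m)).[x].

(* Negz k stands for the order - k.+1. *)
Definition assoc_legendre (R : realType) (l : nat) (m : int) (x : R) : R :=
  match m with
  | Posz k => assoc_legendre_nat l k x
  | Negz k => (-1) ^+ k.+1 * ((l - k.+1)`!%:R / (l + k.+1)`!%:R) *
              assoc_legendre_nat l k.+1 x
  end.

Definition cis (R : realType) (t : R) : R[i] := Complex (cos t) (sin t).

(* Meaningful for |m| <= l, where |l - m| and |l + m| are l - m and l + m.
   The sign (-1)^m occurs here and again in P_l^m, so the two cancel. *)
Definition sph_harmonic (R : realType) (l : nat) (m : int) (theta phi : R) :
    R[i] :=
  real_complex R
    ((-1) ^+ `|m|%N *
     Num.sqrt ((2 * l%:R + 1) * (absz (l%:Z - m))`!%:R /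
               (4 * pi * (absz (l%:Z + m))`!%:R)) *
     assoc_legendre l m (cos phi)) * cis (m%:~R * theta).

Definition cRintegral (R : realType) (D : set R) (h : R -> R[i]) : R[i] :=
  Complex (\int[lebesgue_measure]_(x in D) complex.Re (h x))%R
          (\int[lebesgue_measure]_(x in D) complex.Im (h x))%R.

Definition harmonic_coef (R : realType) (f : 'cV[R]_3 -> R) (l : nat) (m : int)
    (rho : R) : R[i] :=
  cRintegral `[0, 2 * pi] (fun theta => cRintegral `[0, pi] (fun phi =>
    real_complex R (polar_form f rho theta phi) *
    conjc (sph_harmonic l m theta phi) * real_complex R (sin phi))).

Definition sym_curve (R : realType) (p : R -> R) (r phi : R) : R :=
  p (asin (r * sin phi)).

Definition spindle (R : realType) (w : R -> R -> R) (p : R -> R)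
    (f : 'cV[R]_3 -> R) (r alpha beta : R) : R :=
  (\int[lebesgue_measure]_(theta in `[0%R, (2 * pi)%R])
    \int[lebesgue_measure]_(phi in `[0%R, pi])
      (w r phi * sym_curve p r phi * sin phi *
       Num.sqrt (sym_curve p r phi ^+ 2 + derive1 (sym_curve p r) phi ^+ 2) *
       polar_form (rot_act (rotUV alpha beta) f) (sym_curve p r phi)
         theta phi))%R.

Definition admissible_radii (R : realType) (g : R -> R) (e1 e2 e3 : R) :
    set R :=
  [set x | 0 <= x < 1 /\ (0 <= g x <= e1 \/ e2 <= g x <= e3)].

Definition is_min (R : realType) (A : set R) (m : R) := A m /\ lbound A m.

(* {(r, rho) : r in A, min A <= rho <= r}; min A exists when A is nonempty. *)
Definition weight_domain (R : realType) (A : set R) : set (R * R) :=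
  [set z | A z.1 /\ exists2 m, is_min A m & m <= z.2 <= z.1].

(* W is given by the principal branch of the arcsine, so it only sees the
   colatitudes phi <= pi / 2. *)
Definition weight_radial (R : realType) (w : R -> R -> R) (r rho : R) : R :=
  w r (asin (rho / r)).

(* The colatitude ranges over [0, pi], where phi |-> r sin phi = rho has the two
   solutions asin (rho / r) and pi - asin (rho / r). W (r, rho) =
   w (r, sin^-1 (rho / r)) is read on both branches. Principal branch alone
   would leave w unconstrained on ]pi / 2, pi]; a weight odd under
   phi |-> pi - phi would then make the transform of every radial f vanish. *)
Definition weight_both_branches (R : realType) (D : set (R * R))
    (w : R -> R -> R) :=
  forall r phi, 0 <= phi <= pi -> D (r, r * sin phi) ->
    w r phi = weight_radial w r (r * sin phi).

Definition weight_C1 (R : realType) (D : set (R * R)) (W : R -> R -> R) :=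
  {within D, continuous (fun z : R * R => W z.1 z.2)} /\
  exists2 dW : R -> R -> R,
    {within D, continuous (fun z : R * R => dW z.1 z.2)} &
    forall r rho, D (r, rho) ->
      is_derive_within [set s | D (s, rho)] (fun s => W s rho) r (dW r rho).

(* Main.v *)
Require Import Defs.
From mathcomp Require Import ring lra measurable_realfun.

Set Implicit Arguments.
Unset Strict Implicit.
Unset Printing Implicit Defensive.

Import Order.TTheory GRing.Theory Num.Theory.
Import numFieldNormedType.Exports.

Local Open Scope classical_set_scope.
Local Open Scope ring_scope.

(** The harmonic coefficients of degree l of f at radius rho are determined by
    the moments of the function f (rho .) on the unit sphere against the powers
    (z . x)^l of the isotropic linear forms, those whose complex vector z
    satisfies z . z = 0. Indeed, for the vectors z = gen_vector x, x > 0, the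
    power (z . omega)^l is, up to the factor (2 x)^-l, a polynomial in x whose
    coefficient of x^(l + m) is proportional to the conjugate of Y_l^m
    ([gen_vector_zform], [gen_coefE]), so that equal moments for all x > 0 give
    equal coefficients ([harmonic_coef_eq]).

    Tested against such a power, the transform becomes one-dimensional. On the
    sphere, the mean of (z . x)^l over the circle of angular radius phi about
    omega is P_l (cos phi) (z . omega)^l: this is Laplace's integral for P_l
    ([circle_mean_isotropic]). The measure sin b da db dt on the Euler angles is
    invariant under rotation ([rot_integral_const]), hence the circle mean can
    be moved from f onto the power ([circle_mean_adjoint]); together these give
    the Funk-Hecke formula [funk_hecke]. The transform of f at r, integrated
    against the power, is therefore an integral over phi of a weight times
    P_l (cos phi) times the moment of f at radius g (r sin phi)
    ([spindle_transform]).

    When l is even the two halves of [0, pi] contribute equally. With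
    s = r sin phi, the difference u (s) of the moments of f1 and f2 at radius
    g (s) then solves the Abel-type equation

      int_0^(pi/2) K (r, r sin phi) u (r sin phi) dphi = 0,

    where K (s, s) does not vanish because p, W (s, s) and P_l (0) do not.
    Integrating it along r = sqrt (t^2 - z^2), 0 <= z <= t, removes the
    singularity of dphi = ds / sqrt (r^2 - s^2) at s = r ([abel_swap]) and
    leaves a Volterra equation of the first kind, int_0^t L (t, s) u (s) ds = 0,
    with L Lipschitz in t and L (s, s) = (pi / 2) K (s, s). Comparing it at
    nearby values of t shows that a solution that vanishes up to s0 vanishes a
    little beyond s0 ([abel_uniqueness]).

    The weight is controlled on A only, so that the last step has to be made at
    points of A. Were the moments to differ somewhere, let s0 be the infimum of
    the s at which they do. Then g (s0) is the radius of a point of the support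
    of f1 or f2; as the supports are compact and lie in the open hollow balls,
    A contains an interval [s0, b] with b > s0, and u vanishes beyond s0, which
    contradicts the choice of s0 ([moment_unique]). Finally min A > 0, because
    e1 < p 0 < e2, which keeps the argument away from the degenerate r = 0. *)

Notation Re := complex.Re.
Notation Im := complex.Im.

(** * Continuous functions and their integrals over segments *)

(** Nearly all integrands below are continuous, which makes integrability over a
    segment automatic. *)
Notation "'\cint_' ( a , b ) f" := (Rintegral (@lebesgue_measure _) [set` `[a, b]] f)
  (at level 36, f at level 36, a, b at level 50, format "'\cint_' ( a ,  b )  f").

Section continuity.
Context {T : topologicalType}.

Lemma cts_cst (U : topologicalType) (u : U) : continuous (fun _ : T => u).
Proof. by move=> x; exact: cvg_cst. Qed.

Lemma cts_pair (U V : topologicalType) (f : T -> U) (g : T -> V) :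
  continuous f -> continuous g -> continuous (fun x => (f x, g x)).
Proof. by move=> cf cg x; apply: (cvg_pair (cf x) (cg x)). Qed.

Lemma cts_comp (U V : topologicalType) (g : U -> V) (f : T -> U) :
  continuous g -> continuous f -> continuous (fun x => g (f x)).
Proof. by move=> cg cf x; apply: continuous_comp; [exact: cf|exact: cg]. Qed.

Lemma cts_fst (U V : topologicalType) (f : T -> U * V) :
  continuous f -> continuous (fun x => (f x).1).
Proof. by apply: cts_comp => x; exact: cvg_fst. Qed.

Lemma cts_snd (U V : topologicalType) (f : T -> U * V) :
  continuous f -> continuous (fun x => (f x).2).
Proof. by apply: cts_comp => x; exact: cvg_snd. Qed.

Context {R : realType}.
Implicit Types f g : T -> R.

Lemma ctsD f g : continuous f -> continuous g -> continuous (fun x => f x + g x).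
Proof. by move=> cf cg x; apply: continuousD; [exact: cf|exact: cg]. Qed.

Lemma ctsN f : continuous f -> continuous (fun x => - f x).
Proof. by move=> cf x; apply: continuousN; exact: cf. Qed.

Lemma ctsM f g : continuous f -> continuous g -> continuous (fun x => f x * g x).
Proof. by move=> cf cg x; apply: continuousM; [exact: cf|exact: cg]. Qed.

Lemma ctsX f n : continuous f -> continuous (fun x => f x ^+ n).
Proof.
move=> cf; elim: n => [|n IHn]; first exact: cts_cst.
rewrite (_ : (fun _ => _) = (fun x => f x * f x ^+ n)); first exact: ctsM.
by apply/funext => x; rewrite exprS.
Qed.

Lemma cts_norm f : continuous f -> continuous (fun x => `|f x|).
Proof. by apply: cts_comp; exact: norm_continuous. Qed.

Lemma cts_sqrt f : continuous f -> continuous (fun x => Num.sqrt (f x)).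
Proof. by apply: cts_comp; exact: sqrt_continuous. Qed.

Lemma cts_sin f : continuous f -> continuous (fun x => sin (f x)).
Proof. by apply: cts_comp; exact: continuous_sin. Qed.

Lemma cts_cos f : continuous f -> continuous (fun x => cos (f x)).
Proof. by apply: cts_comp; exact: continuous_cos. Qed.

Lemma cts_max f g : continuous f -> continuous g ->
  continuous (fun x => Num.max (f x) (g x)).
Proof. by move=> cf cg x; apply: continuous_max; [exact: cf|exact: cg]. Qed.

Lemma cts_min f g : continuous f -> continuous g ->
  continuous (fun x => Num.min (f x) (g x)).
Proof. by move=> cf cg x; apply: continuous_min; [exact: cf|exact: cg]. Qed.

Lemma cts_id : continuous (fun x : T => x).
Proof. by move=> x; exact: cvg_id. Qed.

End continuity.

(** Structural search for continuity. The operations are recognized by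
    syntactic matching: unification would unfold those of R. Subterms of no known
    shape are looked up among the hypotheses or left as goals. *)
Ltac cts := cbn beta; repeat lazymatch goal with
  | |- forall z, @continuous_at _ _ z (fun x => x) => exact: cts_id
  | |- forall z, @continuous_at _ _ z (fun x => @GRing.add _ (@?f x) (@?g x)) => apply: (@ctsD _ _ f g)
  | |- forall z, @continuous_at _ _ z (fun x => @GRing.opp _ (@?f x)) => apply: (@ctsN _ _ f)
  | |- forall z, @continuous_at _ _ z (fun x => @GRing.mul _ (@?f x) (@?g x)) => apply: (@ctsM _ _ f g)
  | |- forall z, @continuous_at _ _ z (fun x => @GRing.exp _ (@?f x) ?n) => apply: (@ctsX _ _ f n)
  | |- forall z, @continuous_at _ _ z (fun x => @Num.norm _ _ (@?f x)) => apply: (@cts_norm _ _ f)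
  | |- forall z, @continuous_at _ _ z (fun x => Num.sqrt (@?f x)) => apply: (@cts_sqrt _ _ f)
  | |- forall z, @continuous_at _ _ z (fun x => sin (@?f x)) => apply: (@cts_sin _ _ f)
  | |- forall z, @continuous_at _ _ z (fun x => cos (@?f x)) => apply: (@cts_cos _ _ f)
  | |- forall z, @continuous_at _ _ z (fun x => Num.max (@?f x) (@?g x)) => apply: (@cts_max _ _ f g)
  | |- forall z, @continuous_at _ _ z (fun x => Num.min (@?f x) (@?g x)) => apply: (@cts_min _ _ f g)
  | |- forall z, @continuous_at _ _ z (fun x => (@?f x, @?g x)) => apply: (@cts_pair _ _ _ f g)
  | |- forall z, @continuous_at _ _ z (fun x => fst (@?f x)) => apply: (@cts_fst _ _ _ f)
  | |- forall z, @continuous_at _ _ z (fun x => snd (@?f x)) => apply: (@cts_snd _ _ _ f)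
  | |- forall z, @continuous_at _ _ z (@GRing.mul _ ?c) => apply: (@ctsM _ _ (fun=> c) (fun x => x))
  | |- forall z, @continuous_at _ _ z (@GRing.add _ ?c) => apply: (@ctsD _ _ (fun=> c) (fun x => x))
  | |- forall z, @continuous_at _ _ z (@sin _) => apply: (@cts_sin _ _ (fun x => x))
  | |- forall z, @continuous_at _ _ z (@cos _) => apply: (@cts_cos _ _ (fun x => x))
  | |- forall z, @continuous_at _ _ z _ => first [assumption | solve [apply: cts_cst]
      | exact: cts_id | exact: (cts_fst (@cts_id _)) | exact: (cts_snd (@cts_id _))]
  end; try done.

Section continuous_integrals.
Context {R : realType}.
Implicit Types (a b c d x y : R) (f : R -> R).
Notation mu := (@lebesgue_measure R).

Lemma cont_integrable f a b : continuous f -> mu.-integrable `[a, b] (EFin \o f).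
Proof.
move=> cf; apply: continuous_compact_integrable; first exact: segment_compact.
exact: continuous_subspaceT.
Qed.

Lemma EFin_cint f a b : continuous f ->
  (\cint_(a, b) f)%:E = (\int[mu]_(x in `[a, b]) (f x)%:E)%E.
Proof.
move=> cf; rewrite /Rintegral fineK//.
by apply: integrable_fin_num => //; exact: cont_integrable.
Qed.

Lemma cintZl f a b r : continuous f -> \cint_(a, b) (fun x => r * f x) = r * \cint_(a, b) f.
Proof. by move=> cf; rewrite RintegralZl//; exact: cont_integrable. Qed.

Lemma cintD f g a b : continuous f -> continuous g ->
  \cint_(a, b) (fun x => f x + g x) = \cint_(a, b) f + \cint_(a, b) g.
Proof. by move=> cf cg; rewrite RintegralD//; exact: cont_integrable. Qed.

Lemma cintB f g a b : continuous f -> continuous g ->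
  \cint_(a, b) (fun x => f x - g x) = \cint_(a, b) f - \cint_(a, b) g.
Proof. by move=> cf cg; rewrite RintegralB//; exact: cont_integrable. Qed.

Lemma eq_cint f g a b : (forall x, a <= x <= b -> f x = g x) ->
  \cint_(a, b) f = \cint_(a, b) g.
Proof. by move=> fg; apply: eq_Rintegral => x; rewrite inE/= in_itv/=; exact: fg. Qed.

Lemma cint_cst a b r : a <= b -> \cint_(a, b) (fun=> r) = r * (b - a).
Proof.
move=> ab; rewrite Rintegral_cst//= lebesgue_measure_itv/= lte_fin.
case: ltP => //= ba; have -> : b = a by apply/le_anti/andP.
by rewrite subrr.
Qed.

Lemma le_cint f g a b : continuous f -> continuous g ->
  (forall x, a <= x <= b -> f x <= g x) -> \cint_(a, b) f <= \cint_(a, b) g.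
Proof.
by move=> cf cg fg; apply: le_Rintegral => //; exact: cont_integrable.
Qed.

Lemma norm_cint f a b : continuous f ->
  `|\cint_(a, b) f| <= \cint_(a, b) (fun x => `|f x|).
Proof. by move=> cf; apply: le_normr_Rintegral => //; exact: cont_integrable. Qed.

Lemma norm_cint_le f a b M : a <= b -> continuous f ->
  (forall x, a <= x <= b -> `|f x| <= M) -> `|\cint_(a, b) f| <= M * (b - a).
Proof.
move=> ab cf fM; apply: (le_trans (norm_cint a b cf)).
rewrite -(cint_cst M ab); apply: le_cint => //.
  by move=> x; apply: continuous_comp; [exact: cf|exact: norm_continuous].
by move=> x; exact: cst_continuous.
Qed.

Lemma cint_chasles f a b c : continuous f -> a <= b -> b <= c ->
  \cint_(a, c) f = \cint_(a, b) f + \cint_(b, c) f.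
Proof.
move=> cf ab bc.
have <- : \cint_(a, c) f - \cint_(a, b) f = \cint_(b, c) f.
  rewrite Rintegral_itvB//; last exact: cont_integrable.
  by rewrite Rintegral_itv_obnd_cbnd//; apply: (integrableS _ _ _ (cont_integrable b c cf)) => //; exact: subset_itv_oc_cc.
by rewrite addrC subrK.
Qed.

Lemma cint_FTC F f a b : a <= b -> (forall x, is_derive x 1 F (f x)) ->
  continuous f -> \cint_(a, b) f = F b - F a.
Proof.
rewrite le_eqVlt => /predU1P[->|ab] dF cf.
  by rewrite set_itv1 Rintegral_set1 subrr.
rewrite /Rintegral (@continuous_FTC2 _ f F)//.
- exact: continuous_subspaceT.
- have cF : continuous F.
    by move=> x; apply: differentiable_continuous; apply/derivable1_diffP; case: (dF x).
  split => //.
  + by apply: cvg_at_right_filter; exact: cF.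
  + by apply: cvg_at_left_filter; exact: cF.
- by move=> x _; rewrite derive1E; apply: derive_val.
Qed.

(** On a compact segment, continuity in the parameter is uniform in the variable
    of integration. *)
Lemma continuous_cint (T : topologicalType) (F : T -> R -> R) a b :
  continuous (fun z : T * R => F z.1 z.2) ->
  continuous (fun t => \cint_(a, b) (F t)).
Proof.
move=> cF.
have cF1 t : continuous (F t).
  by apply: (cts_comp (f := fun y => (t, y)) cF); cts.
have [ab|ba] := leP a b; last first.
  rewrite (_ : (fun _ => _) = fun=> 0); first by move=> ?; exact: cst_continuous.
  by apply/funext => t; rewrite set_itv_ge ?Rintegral_set0// bnd_simp -ltNge.
move=> t; apply/cvgrPdist_le => /= e e0.
set d := e / (b - a + 1).
have d0 : 0 < d by apply: divr_gt0 => //; lra.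
have : \forall t' \near t, `[a, b]%classic `<=` (fun y => `|F t y - F t' y| <= d).
  have /compact_near_coveringP/(_ _ (nbhs t)) := @segment_compact R a b.
  apply => y _.
  have d2 : 0 < d / 2 by apply: divr_gt0.
  have /cvgrPdist_lt /(_ _ d2) := cF1 t y.
  have /cvgrPdist_lt /(_ _ d2) := cF (t, y).
  case=> -[U V] /= [nU nV] UV nW.
  exists (V `&` [set x | `|F t y - F t x| < d / 2], U); first by split => //; exact: filterI.
  move=> [x i] /= [[Vx Wx] Ui].
  have /= := UV (i, x) (conj Ui Vx).
  rewrite distrC => Uix; rewrite distrC (splitr d).
  rewrite (_ : F i x - F t x = (F i x - F t y) + (F t y - F t x)); last by ring.
  by apply: (le_trans (ler_normD _ _)); apply: lerD; exact: ltW.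
apply: filterS => i /= Fi.
have cFB : continuous (fun y => F t y - F i y) by cts.
rewrite -cintB//.
apply: (le_trans (norm_cint_le (M := d) ab cFB _)).
  by move=> y yab; apply: Fi; rewrite /= in_itv.
by rewrite /d mulrAC ler_pdivrMr; nra.
Qed.

(** The product sigma-algebra contains the open sets of the plane because these
    are countable unions of squares with rational centres and radii. *)
Lemma open_measurable2 (U : set (R * R)) : open U -> measurable U.
Proof.
move=> oU.
pose B (q : rat * rat * rat) : set (R * R) :=
  ball (ratr q.1.1 : R) (ratr q.2) `*` ball (ratr q.1.2 : R) (ratr q.2).
rewrite (_ : U = \bigcup_q (if `[< B q `<=` U >] then B q else set0)).
  apply: countable_bigcupT_measurable; first exact: countableP.
  by move=> q; case: asboolP => // _; apply: measurableX; exact: measurable_ball.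
apply/seteqP; split => [[x y] Uxy|z [q _]]; last by case: asboolP => // qU /qU.
have /nbhs_ballP[e /= e0 eU] : nbhs (x, y) U by exact: open_nbhs_nbhs.
have [d] : exists d : rat, (ratr d : R) \in `]0, (e / 2)[.
  by apply: rat_in_itvoo; exact: divr_gt0.
rewrite in_itv/= => /andP[d0 de].
have near_rat z : exists q : rat, `|(ratr q : R) - z| < ratr d.
  have [q] : exists q : rat, (ratr q : R) \in `](z - ratr d), (z + ratr d)[.
    by apply: rat_in_itvoo; lra.
  by rewrite in_itv/= => zq; exists q; rewrite ltr_distl.
have [a ax] := near_rat x; have [b bY] := near_rat y.
exists (a, b, d) => //; case: asboolP => [_|]; first by split.
case=> -[x' y'] [/= ax' bY']; apply: eU.
split; rewrite /ball/= in ax' bY' *.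
- apply: le_lt_trans (_ : `|x - ratr a| + `|ratr a - x'| < e).
    by rewrite -[leLHS]/(`|x - x'|) (_ : x - x' = (x - ratr a) + (ratr a - x')) ?ler_normD//; ring.
  by rewrite (distrC x); lra.
- apply: le_lt_trans (_ : `|y - ratr b| + `|ratr b - y'| < e).
    by rewrite (_ : y - y' = (y - ratr b) + (ratr b - y')) ?ler_normD//; ring.
  by rewrite (distrC y); lra.
Qed.

Lemma cts_measurable2 (F : R * R -> R) : continuous F -> measurable_fun setT F.
Proof.
move=> /continuousP cF; apply: (measurability _ (RGenOpens.measurableE R)).
move=> _ [_ [a [b ->] <-]]; rewrite setTI; apply: open_measurable2.
by apply: cF; exact: interval_open.
Qed.

Lemma cint_fubini (F : R -> R -> R) a b c d :
  continuous (fun z : R * R => F z.1 z.2) ->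
  \cint_(a, b) (fun x => \cint_(c, d) (F x)) =
  \cint_(c, d) (fun y => \cint_(a, b) (F^~ y)).
Proof.
move=> cF.
have cFx x : continuous (F x).
  by apply: (cts_comp (f := fun y => (x, y)) cF); cts.
have cFy y : continuous (F^~ y).
  by apply: (cts_comp (f := fun x => (x, y)) cF); cts.
(* Fubini's theorem is applied on the whole plane to F cut off by indicators. *)
pose f (z : R * R) : R := F z.1 z.2 * (\1_(`[a, b]%classic) z.1 * \1_(`[c, d]%classic) z.2).
have mf : measurable_fun setT f.
  apply: measurable_funM; first exact: cts_measurable2.
  by apply: measurable_funM; apply: measurableT_comp.
have int1 (G : R -> R -> R) x : (forall x, continuous (G x)) ->
   (\int[mu]_y (G x y * (\1_(`[a, b]%classic) x * \1_(`[c, d]%classic) y))%:E)%E =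
   ((fun x => (\cint_(c, d) (G x))%:E) \_ `[a, b]) x.
  move=> cG; rewrite patchE EFin_cint//; case: ifPn => xab.
    rewrite [RHS]integral_mkcond; apply: eq_integral => y _.
    by rewrite patchE indicE xab mul1r indicE; case: ifP => _; rewrite ?mulr1 ?mulr0.
  rewrite integral0_eq// => y _.
  by rewrite indicE (negbTE xab) mul0r mulr0.
have int2 (G : R -> R -> R) y : (forall y, continuous (G^~ y)) ->
   (\int[mu]_x (G x y * (\1_(`[a, b]%classic) x * \1_(`[c, d]%classic) y))%:E)%E =
   ((fun y => (\cint_(a, b) (G^~ y))%:E) \_ `[c, d]) y.
  move=> cG; rewrite patchE EFin_cint//; case: ifPn => xab.
    rewrite [RHS]integral_mkcond; apply: eq_integral => x _.
    by rewrite patchE [\1_`[c, d] _]indicE xab mulr1 indicE; case: ifP => _; rewrite ?mulr1 ?mulr0.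
  rewrite integral0_eq// => x _.
  by rewrite [\1_`[c, d] _]indicE (negbTE xab) !mulr0.
have intf : (mu \x mu)%E.-integrable setT (EFin \o f).
  apply/integrable12ltyP; first exact/measurable_EFinP.
  under eq_integral => x _.
    under eq_integral => y _.
      rewrite /= normrM (ger0_norm (mulr_ge0 _ _))//; over.
    rewrite (int1 (fun x y => `|F x y|)); last by move=> ?; cts.
    over.
  rewrite -integral_mkcond.
  rewrite -EFin_cint ?ltry//.
  by apply: continuous_cint; cts.
have := Fubini intf; rewrite /f/=.
under eq_integral do rewrite int1//.
under [in X in _ = X -> _]eq_integral do rewrite int2//.
rewrite -!integral_mkcond.
by rewrite /Rintegral => ->.
Qed.

End continuous_integrals.

(** * The chain rule in three variables *)
Section chain_rule.
Context {R : realType}.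
Implicit Types (f : R -> R) (t l : R).

Lemma is_derive_cvgP f t l : is_derive t 1 f l <->
  h^-1 * (f (h + t) - f t) @[h --> 0^'] --> l.
Proof.
split => [[df <-]|cf].
  have : derivable f t 1 by [].
  rewrite /derivable => dft; rewrite /derive.
  under eq_fun do rewrite -[X in f (X + t)]mulr1.
  exact: dft.
have cf' : h^-1 *: (f (h *: 1 + t) - f t) @[h --> 0^'] --> l.
  by under eq_fun do rewrite [_ *: 1]mulr1.
apply: DeriveDef; first by apply/cvg_ex; exists l.
exact/cvg_lim.
Qed.

Definition cont3 (F : R -> R -> R -> R) :=
  continuous (fun v : R * R * R => F v.1.1 v.1.2 v.2).

(** The chain rule is taken as the definition of differentiability: derivatives
    of functions on R^3 enter only along curves of rotated points. *)
Definition chain3 (F F1 F2 F3 : R -> R -> R -> R) :=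
  forall (x y z : R -> R) t x' y' z',
    is_derive t 1 x x' -> is_derive t 1 y y' -> is_derive t 1 z z' ->
    is_derive t 1 (fun t => F (x t) (y t) (z t))
      (F1 (x t) (y t) (z t) * x' + F2 (x t) (y t) (z t) * y' +
       F3 (x t) (y t) (z t) * z').

Definition C1_3 F := exists F1 F2 F3,
  [/\ cont3 F, cont3 F1, cont3 F2, cont3 F3 & chain3 F F1 F2 F3].

(** Hadamard's lemma: the difference quotient is the mean of the derivative over
    the segment from a to b, hence continuous up to the diagonal a = b. *)
Lemma hadamard (P : topologicalType) (F F1 : R -> P -> R) :
  (forall (a : R) q, is_derive a (1 : R) (F^~ q : R -> R) (F1 a q)) ->
  continuous (fun v : R * P => F1 v.1 v.2) ->
  exists Q : R -> R -> P -> R,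
  [/\ continuous (fun v : R * R * P => Q v.1.1 v.1.2 v.2),
      forall a q, Q a a q = F1 a q &
      forall a b q, F b q - F a q = Q a b q * (b - a)].
Proof.
move=> dF cF1.
exists (fun a b q => \cint_(0, 1) (fun s : R => F1 (a + s * (b - a)) q)); split.
- apply: (@continuous_cint R _ (fun v s => F1 (v.1.1 + s * (v.1.2 - v.1.1)) v.2)).
  have cf : continuous (fun v : R * R * P * R => (v.1.1.1 + v.2 * (v.1.1.2 - v.1.1.1), v.1.2)).
    cts.
  exact: (cts_comp cF1 cf).
- move=> a q; rewrite (eq_cint (g := fun=> F1 a q)); last by move=> s _; rewrite subrr mulr0 addr0.
  by rewrite cint_cst ?subr0 ?mulr1.
- move=> a b q.
  have cF : continuous (fun s : R => F1 (a + s * (b - a)) q).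
    by apply: (cts_comp (f := fun s : R => (a + s * (b - a), q)) cF1); cts.
  rewrite mulrC -cintZl//.
  suff dFs (s : R) : is_derive s 1 (fun s : R => F (a + s * (b - a)) q) ((b - a) * F1 (a + s * (b - a)) q).
    rewrite (cint_FTC ler01 dFs); last by cts.
    by rewrite mul1r mul0r addr0 (addrC a) subrK.
  have d1 : is_derive s 1 (fun s : R => a + s * (b - a)) (b - a).
    by apply: is_derive_eq; rewrite /GRing.scale/=; ring.
  by rewrite mulrC; exact: (@is_derive1_comp _ (F^~ q) (fun s => a + s * (b - a)) _ _ _ (dF _ _) d1).
Qed.

Lemma is_derive_continuous f t l : is_derive t 1 f l -> {for t, continuous f}.
Proof.
by case=> df _; apply: differentiable_continuous; apply/derivable1_diffP.
Qed.

(** The increment of F is split into increments in one variable at a time. By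
    [hadamard] each of them is a continuous quotient times the increment of one
    coordinate, and the limit may be taken factor by factor. *)
Lemma chain3_of_partials (F F1 F2 F3 : R -> R -> R -> R) :
  cont3 F1 -> cont3 F2 -> cont3 F3 ->
  (forall a b c : R, is_derive a 1 (fun a => F a b c) (F1 a b c)) ->
  (forall a b c : R, is_derive b 1 (fun b => F a b c) (F2 a b c)) ->
  (forall a b c : R, is_derive c 1 (fun c => F a b c) (F3 a b c)) ->
  chain3 F F1 F2 F3.
Proof.
move=> c1 c2 c3 d1 d2 d3 x y z t x' y' z' dx dy dz.
have [|Q1 [cQ1 Q1E F1Q]] := hadamard (F := fun a q => F a q.1 q.2) (F1 := fun a (q : R * R) => F1 a q.1 q.2) (fun a q => d1 a q.1 q.2).
  by apply: (cts_comp (f := fun v : R * (R * R) => ((v.1, v.2.1), v.2.2)) c1); cts.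
have [|Q2 [cQ2 Q2E F2Q]] := hadamard (F := fun b q => F q.1 b q.2) (F1 := fun b (q : R * R) => F2 q.1 b q.2) (fun b q => d2 q.1 b q.2).
  by apply: (cts_comp (f := fun v : R * (R * R) => ((v.2.1, v.1), v.2.2)) c2); cts.
have [|Q3 [cQ3 Q3E F3Q]] := hadamard (F := fun c q => F q.1 q.2 c) (F1 := fun c (q : R * R) => F3 q.1 q.2 c) (fun c q => d3 q.1 q.2 c).
  by apply: (cts_comp (f := fun v : R * (R * R) => ((v.2.1, v.2.2), v.1)) c3); cts.
have [[cx cy] cz] := (is_derive_continuous dx, is_derive_continuous dy, is_derive_continuous dz).
apply/is_derive_cvgP.
rewrite (_ : (fun _ => _) = fun h =>
   Q1 (x t) (x (h + t)) (y (h + t), z (h + t)) * (h^-1 * (x (h + t) - x t)) +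
   Q2 (y t) (y (h + t)) (x t, z (h + t)) * (h^-1 * (y (h + t) - y t)) +
   Q3 (z t) (z (h + t)) (x t, y t) * (h^-1 * (z (h + t) - z t))); last first.
  apply/funext => h.
  have := F1Q (x t) (x (h + t)) (y (h + t), z (h + t)).
  have := F2Q (y t) (y (h + t)) (x t, z (h + t)).
  have := F3Q (z t) (z (h + t)) (x t, y t).
  move=> /= E3 E2 E1.
  rewrite !(mulrCA _ h^-1) -E1 -E2 -E3 -!mulrDr; congr (_ * _); ring.
have sh : (h + t) @[h --> (0 : R)^'] --> t.
  rewrite -[X in _ --> X]add0r; apply: cvgD; last exact: cvg_cst.
  exact: nbhs_dnbhs.
have lim (u : R -> R) : {for t, continuous u} -> u (h + t) @[h --> (0 : R)^'] --> u t.
  by move=> cu; exact: (cvg_comp _ _ sh cu).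
have cst (T : topologicalType) (u : T) : (fun _ : R => u) @ (0 : R)^' --> u by exact: cvg_cst.
apply: cvgD; first apply: cvgD; apply: cvgM; try exact/is_derive_cvgP.
- rewrite -[F1 _ _ _]/(F1 (x t) (y t, z t).1 (y t, z t).2) -Q1E.
  apply: (@cvg_comp _ _ _ (fun h => ((x t, x (h + t)), (y (h + t), z (h + t)))) (fun v : R * R * (R * R) => Q1 v.1.1 v.1.2 v.2) _ _ _ _ (cQ1 ((x t, x t), (y t, z t)))).
  exact: (cvg_pair (cvg_pair (cst _ (x t)) (lim _ cx)) (cvg_pair (lim _ cy) (lim _ cz))).
- rewrite -[F2 _ _ _]/(F2 (x t, z t).1 (y t) (x t, z t).2) -Q2E.
  apply: (@cvg_comp _ _ _ (fun h => ((y t, y (h + t)), (x t, z (h + t)))) (fun v : R * R * (R * R) => Q2 v.1.1 v.1.2 v.2) _ _ _ _ (cQ2 ((y t, y t), (x t, z t)))).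
  exact: (cvg_pair (cvg_pair (cst _ (y t)) (lim _ cy)) (cvg_pair (cst _ (x t)) (lim _ cz))).
- rewrite -[F3 _ _ _]/(F3 (x t, y t).1 (x t, y t).2 (z t)) -Q3E.
  apply: (@cvg_comp _ _ _ (fun h => ((z t, z (h + t)), (x t, y t))) (fun v : R * R * (R * R) => Q3 v.1.1 v.1.2 v.2) _ _ _ _ (cQ3 ((z t, z t), (x t, y t)))).
  exact: (cvg_pair (cvg_pair (cst _ (z t)) (lim _ cz)) (cvg_pair (cst _ (x t)) (cst _ (y t)))).
Qed.

Lemma col3E (a b c : R) :
  col3 a b c = a *: delta_mx 0 0 + b *: delta_mx 1 0 + c *: delta_mx (inord 2) 0.
Proof.
apply/colP => i; rewrite !mxE.
have e2 : (inord 2 : 'I_3) = Ordinal (isT : 2 < 3)%N by apply/val_inj; rewrite /= inordK.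
rewrite e2; case: i => -[|[|[|]]] // i3; by rewrite /= ?mulr1 ?mulr0 ?addr0 ?add0r.
Qed.

Lemma cont3_col3 (f : 'cV[R]_3 -> R) :
  continuous f -> cont3 (fun a b c => f (col3 a b c)).
Proof.
move=> cf; apply: (cts_comp cf).
rewrite (_ : (fun _ => _) = fun v : R * R * R => v.1.1 *: delta_mx 0 0 +
    v.1.2 *: delta_mx 1 0 + v.2 *: (delta_mx (inord 2) 0 : 'cV[R]_3)); last first.
  by apply/funext => v; rewrite col3E.
move=> v.
have c1 : continuous (fun v : R * R * R => v.1.1) by cts.
have c2 : continuous (fun v : R * R * R => v.1.2) by cts.
have c3 : continuous (fun v : R * R * R => v.2) by cts.
by apply: cvgD; first apply: cvgD; apply: cvgZr_tmp; [exact: c1|exact: c2|exact: c3].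
Qed.

Lemma Ck1_C1_3 (f : 'cV[R]_3 -> R) : Ck 1 f -> C1_3 (fun a b c => f (col3 a b c)).
Proof.
move=> [cf df].
have part (i : 'I_3) (u : R -> 'cV[R]_3) (a : R) : (forall h, u (h + a) = h *: delta_mx i 0 + u a) ->
    is_derive a 1 (fun a => f (u a)) ('D_(delta_mx i 0) f (u a)).
  move=> ua; apply/is_derive_cvgP.
  under eq_fun do rewrite ua.
  by have [+ _] := df i; exact.
exists (fun a b c => 'D_(delta_mx 0 0) f (col3 a b c)),
  (fun a b c => 'D_(delta_mx 1 0) f (col3 a b c)),
  (fun a b c => 'D_(delta_mx (inord 2) 0) f (col3 a b c)).
have cd i : cont3 (fun a b c => 'D_(delta_mx i 0) f (col3 a b c)).
  by apply: (@cont3_col3 ('D_(delta_mx i 0) f)); have [_] := df i.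
split => //; first exact: cont3_col3.
apply: chain3_of_partials => // a b c.
- by apply: (part _ (fun a => col3 a b c)) => h; rewrite !col3E scalerDl !addrA.
- by apply: (part _ (fun b => col3 a b c)) => h; rewrite !col3E scalerDl !addrA; congr (_ + _); rewrite -!addrA addrCA.
- by apply: (part _ (fun c => col3 a b c)) => h; rewrite !col3E scalerDl addrCA.
Qed.

Lemma C1_3_cont F : C1_3 F -> cont3 F.
Proof. by case=> ? [? [? []]]. Qed.

Lemma C1_3_lin (a b c : R) : C1_3 (fun x y z => a * x + b * y + c * z).
Proof.
exists (fun _ _ _ => a), (fun _ _ _ => b), (fun _ _ _ => c).
split; rewrite /cont3; try by cts.
move=> x y z t x' y' z' dx dy dz.
by apply: is_derive_eq; rewrite /GRing.scale/=; ring.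
Qed.

Lemma C1_3_cst (a : R) : C1_3 (fun x y z => a).
Proof.
exists (fun _ _ _ => 0), (fun _ _ _ => 0), (fun _ _ _ => 0).
split; rewrite /cont3; try by cts.
move=> x y z t x' y' z' dx dy dz.
by apply: is_derive_eq; rewrite !mul0r !addr0.
Qed.

Lemma C1_3_mulD F G H K : C1_3 F -> C1_3 G -> C1_3 H -> C1_3 K ->
  C1_3 (fun x y z => F x y z * G x y z + H x y z * K x y z).
Proof.
move=> [F1 [F2 [F3 [cF cF1 cF2 cF3 dF]]]] [G1 [G2 [G3 [cG cG1 cG2 cG3 dG]]]].
move=> [H1 [H2 [H3 [cH cH1 cH2 cH3 dH]]]] [K1 [K2 [K3 [cK cK1 cK2 cK3 dK]]]].
exists (fun x y z => F1 x y z * G x y z + F x y z * G1 x y z + (H1 x y z * K x y z + H x y z * K1 x y z)).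
exists (fun x y z => F2 x y z * G x y z + F x y z * G2 x y z + (H2 x y z * K x y z + H x y z * K2 x y z)).
exists (fun x y z => F3 x y z * G x y z + F x y z * G3 x y z + (H3 x y z * K x y z + H x y z * K3 x y z)).
rewrite /cont3 in cF cF1 cF2 cF3 cG cG1 cG2 cG3 cH cH1 cH2 cH3 cK cK1 cK2 cK3.
split; rewrite /cont3; try by cts.
move=> x y z t x' y' z' dx dy dz.
have dFt := dF _ _ _ _ _ _ _ dx dy dz.
have dGt := dG _ _ _ _ _ _ _ dx dy dz.
have dHt := dH _ _ _ _ _ _ _ dx dy dz.
have dKt := dK _ _ _ _ _ _ _ dx dy dz.
by apply: is_derive_eq; rewrite /GRing.scale/=; ring.
Qed.

End chain_rule.

(** * Multiple integrals and rotations in Euler angles *)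
Section multiple_integrals.
Context {R : realType}.

Definition cont2 (F : R -> R -> R) := continuous (fun v : R * R => F v.1 v.2).

Definition cont4 (F : R -> R -> R -> R -> R) :=
  continuous (fun v : R * R * R * R => F v.1.1.1 v.1.1.2 v.1.2 v.2).

Lemma cts2 (F : R -> R -> R) (T : topologicalType) (f1 f2 : T -> R) : cont2 F ->
  continuous f1 -> continuous f2 -> continuous (fun v => F (f1 v) (f2 v)).
Proof.
move=> cF c1 c2; have c : continuous (fun v => (f1 v, f2 v)) by cts.
exact: (cts_comp cF c).
Qed.

Lemma cts3 (F : R -> R -> R -> R) (T : topologicalType) (f1 f2 f3 : T -> R) :
  cont3 F -> continuous f1 -> continuous f2 -> continuous f3 ->
  continuous (fun v => F (f1 v) (f2 v) (f3 v)).
Proof.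
move=> cF c1 c2 c3; have c : continuous (fun v => (f1 v, f2 v, f3 v)) by cts.
exact: (cts_comp cF c).
Qed.

Lemma cts4 (F : R -> R -> R -> R -> R) (T : topologicalType) (f1 f2 f3 f4 : T -> R) :
  cont4 F -> continuous f1 -> continuous f2 -> continuous f3 -> continuous f4 ->
  continuous (fun v => F (f1 v) (f2 v) (f3 v) (f4 v)).
Proof.
move=> cF c1 c2 c3 c4.
have c : continuous (fun v => (f1 v, f2 v, f3 v, f4 v)) by cts.
exact: (cts_comp cF c).
Qed.

Lemma cint_rot3 (F : R -> R -> R -> R) (a1 b1 a2 b2 a3 b3 : R) : cont3 F ->
  \cint_(a1, b1) (fun x => \cint_(a2, b2) (fun y => \cint_(a3, b3) (F x y))) =
  \cint_(a2, b2) (fun y => \cint_(a3, b3) (fun z => \cint_(a1, b1) (fun x => F x y z))).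
Proof.
move=> cF; rewrite cint_fubini.
  apply: eq_cint => y _; rewrite cint_fubini//.
  by apply: (cts3 cF); cts.
apply: (@continuous_cint R _ (fun v z => F v.1 v.2 z)).
by apply: (cts3 cF); cts.
Qed.

Lemma cint0 (a b : R) : \cint_(a, b) (fun=> 0 : R) = 0.
Proof. by rewrite /Rintegral integral0. Qed.

Definition cint4 (a1 b1 a2 b2 a3 b3 a4 b4 : R) (F : R -> R -> R -> R -> R) :=
  \cint_(a1, b1) (fun x => \cint_(a2, b2) (fun y => \cint_(a3, b3) (fun z =>
    \cint_(a4, b4) (F x y z)))).

Lemma cint4D a1 b1 a2 b2 a3 b3 a4 b4 F G : cont4 F -> cont4 G ->
  cint4 a1 b1 a2 b2 a3 b3 a4 b4 (fun x y z t => F x y z t + G x y z t) =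
  cint4 a1 b1 a2 b2 a3 b3 a4 b4 F + cint4 a1 b1 a2 b2 a3 b3 a4 b4 G.
Proof.
move=> cF cG.
have c1 H (T : topologicalType) (f1 f2 f3 : T -> R) : cont4 H -> continuous f1 -> continuous f2 ->
    continuous f3 -> continuous (fun v => \cint_(a4, b4) (H (f1 v) (f2 v) (f3 v))).
  move=> cH ? ? ?; apply: (@continuous_cint _ _ (fun v t => H (f1 v) (f2 v) (f3 v) t)).
  by apply: (cts4 cH); cts; apply: cts_comp => //; cts.
have c2 H (T : topologicalType) (f1 f2 : T -> R) : cont4 H -> continuous f1 -> continuous f2 ->
    continuous (fun v => \cint_(a3, b3) (fun z => \cint_(a4, b4) (H (f1 v) (f2 v) z))).
  move=> cH ? ?; apply: (@continuous_cint _ _ (fun v z => \cint_(a4, b4) (H (f1 v) (f2 v) z))).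
  by apply: c1 => //; cts; apply: cts_comp => //; cts.
have c3 H : cont4 H ->
    continuous (fun x => \cint_(a2, b2) (fun y => \cint_(a3, b3) (fun z => \cint_(a4, b4) (H x y z)))).
  move=> cH; apply: (@continuous_cint _ _ (fun x y => \cint_(a3, b3) (fun z => \cint_(a4, b4) (H x y z)))).
  by apply: c2 => //; cts.
rewrite /cint4 -cintD; [|exact: c3..].
apply: eq_cint => x _; rewrite -cintD; [|by apply: c2 => //; cts..].
apply: eq_cint => y _; rewrite -cintD; [|by apply: c1 => //; cts..].
by apply: eq_cint => z _; rewrite -cintD//; [apply: (cts4 cF)|apply: (cts4 cG)]; cts.
Qed.

End multiple_integrals.

Section rotation_invariance.
Context {R : realType}.

(** (rotx, roty, rotz) is the image under U(a) V(b) of the point with azimuth t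
    and colatitude s: the point at angular distance s from
    (sin b cos a, sin b sin a, cos b), in direction t. *)
Definition rotx (a b t s : R) :=
  cos s * (sin b * cos a) + sin s * (cos t * (cos b * cos a) - sin t * sin a).
Definition roty (a b t s : R) :=
  cos s * (sin b * sin a) + sin s * (cos t * (cos b * sin a) + sin t * cos a).
Definition rotz (a b t s : R) := cos s * cos b - sin s * (cos t * sin b).

(** Moving along the great circle of direction t from U(a) V(b) is an
    infinitesimal rotation, that is a vector field in the angles (a, b, t), whose
    coefficients are singular at sin b = 0. H is transported if its
    derivative in s is this field applied to it, as for any function of the
    rotated point; multiplication by sin b clears the singularity. *)
Definition transported (H : R -> R -> R -> R -> R) := exists Ha Hb Ht Hs,
  [/\ cont4 H, [/\ cont4 Ha, cont4 Hb, cont4 Ht & cont4 Hs],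
   [/\ (forall a b t s : R, is_derive a 1 (fun a => H a b t s) (Ha a b t s)),
       (forall a b t s : R, is_derive b 1 (fun b => H a b t s) (Hb a b t s)),
       (forall a b t s : R, is_derive t 1 (fun t => H a b t s) (Ht a b t s)) &
       (forall a b t s : R, is_derive s 1 (fun s => H a b t s) (Hs a b t s))] &
   forall a b t s, sin b * Hs a b t s =
     sin b * cos t * Hb a b t s + sin t * Ha a b t s - cos b * sin t * Ht a b t s].

Lemma transportedM H K : transported H -> transported K ->
  transported (fun a b t s => H a b t s * K a b t s).
Proof.
move=> [Ha [Hb [Ht [Hs [cH [cHa cHb cHt cHs] [dHa dHb dHt dHs] eH]]]]].
move=> [Ka [Kb [Kt [Ks [cK [cKa cKb cKt cKs] [dKa dKb dKt dKs] eK]]]]].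
exists (fun a b t s => Ha a b t s * K a b t s + H a b t s * Ka a b t s).
exists (fun a b t s => Hb a b t s * K a b t s + H a b t s * Kb a b t s).
exists (fun a b t s => Ht a b t s * K a b t s + H a b t s * Kt a b t s).
exists (fun a b t s => Hs a b t s * K a b t s + H a b t s * Ks a b t s).
rewrite /cont4 in cH cHa cHb cHt cHs cK cKa cKb cKt cKs *.
split; [by cts|by split; cts| |].
- split => a b t s.
  + by have h := dHa a b t s; have k := dKa a b t s; apply: is_derive_eq; rewrite /GRing.scale/=; ring.
  + by have h := dHb a b t s; have k := dKb a b t s; apply: is_derive_eq; rewrite /GRing.scale/=; ring.
  + by have h := dHt a b t s; have k := dKt a b t s; apply: is_derive_eq; rewrite /GRing.scale/=; ring.
  + by have h := dHs a b t s; have k := dKs a b t s; apply: is_derive_eq; rewrite /GRing.scale/=; ring.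
- move=> a b t s; rewrite mulrDr mulrA eH mulrCA eK; ring.
Qed.

Lemma transported_rot F c : C1_3 F ->
  transported (fun a b t s => F (rotx a b t (s + c)) (roty a b t (s + c)) (rotz a b t (s + c))).
Proof.
move=> [F1 [F2 [F3 [cF cF1 cF2 cF3 dF]]]].
pose D (X Y Z : R -> R -> R -> R -> R) a b t s :=
  F1 (rotx a b t (s + c)) (roty a b t (s + c)) (rotz a b t (s + c)) * X a b t (s + c) +
  F2 (rotx a b t (s + c)) (roty a b t (s + c)) (rotz a b t (s + c)) * Y a b t (s + c) +
  F3 (rotx a b t (s + c)) (roty a b t (s + c)) (rotz a b t (s + c)) * Z a b t (s + c).
have cc G : cont3 G -> cont4 (fun a b t s => G (rotx a b t (s + c)) (roty a b t (s + c)) (rotz a b t (s + c))).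
  by move=> cG; apply: (cts3 cG); rewrite /rotx /roty /rotz; cts.
have cD X Y Z : continuous (fun v : R * R * R * R => X v.1.1.1 v.1.1.2 v.1.2 (v.2 + c)) ->
    continuous (fun v : R * R * R * R => Y v.1.1.1 v.1.1.2 v.1.2 (v.2 + c)) ->
    continuous (fun v : R * R * R * R => Z v.1.1.1 v.1.1.2 v.1.2 (v.2 + c)) -> cont4 (D X Y Z).
  move=> cX cY cZ; have := cc _ cF1; have := cc _ cF2; have := cc _ cF3.
  by rewrite /cont4 /D => cG1 cG2 cG3; cts.
pose rax (a b t s : R) := cos s * (sin b * - sin a) + sin s * (cos t * (cos b * - sin a) - sin t * cos a).
pose ray (a b t s : R) := cos s * (sin b * cos a) + sin s * (cos t * (cos b * cos a) - sin t * sin a).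
pose raz (a b t s : R) := 0 : R.
pose rbx (a b t s : R) := cos s * (cos b * cos a) - sin s * (cos t * (sin b * cos a)).
pose rby (a b t s : R) := cos s * (cos b * sin a) - sin s * (cos t * (sin b * sin a)).
pose rbz (a b t s : R) := - (cos s * sin b) - sin s * (cos t * cos b).
pose rtx (a b t s : R) := sin s * (- sin t * (cos b * cos a) - cos t * sin a).
pose rty (a b t s : R) := sin s * (- sin t * (cos b * sin a) + cos t * cos a).
pose rtz (a b t s : R) := sin s * (sin t * sin b).
pose rsx (a b t s : R) := - sin s * (sin b * cos a) + cos s * (cos t * (cos b * cos a) - sin t * sin a).
pose rsy (a b t s : R) := - sin s * (sin b * sin a) + cos s * (cos t * (cos b * sin a) + sin t * cos a).
pose rsz (a b t s : R) := - sin s * cos b - cos s * (cos t * sin b).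
exists (D rax ray raz), (D rbx rby rbz), (D rtx rty rtz), (D rsx rsy rsz).
split.
- exact: cc.
- by split; apply: cD; rewrite /rax /ray /raz /rbx /rby /rbz /rtx /rty /rtz /rsx /rsy /rsz; cts.
- split => a b t s; apply: dF; rewrite /rotx /roty /rotz; apply: is_derive_eq;
  rewrite /rax /ray /raz /rbx /rby /rbz /rtx /rty /rtz /rsx /rsy /rsz /GRing.scale/=; ring.
- move=> a b t s; rewrite /D.
  set f1 := F1 _ _ _; set f2 := F2 _ _ _; set f3 := F3 _ _ _; move: (s + c) => r.
  have C (x : R) : sin x ^+ 2 = 1 - cos x ^+ 2 by exact: sin2cos2.
  have e1 : sin b * rsx a b t r = sin b * cos t * rbx a b t r + sin t * rax a b t r - cos b * sin t * rtx a b t r.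
    rewrite /rsx /rbx /rax /rtx; ring: (C b) (C t).
  have e2 : sin b * rsy a b t r = sin b * cos t * rby a b t r + sin t * ray a b t r - cos b * sin t * rty a b t r.
    rewrite /rsy /rby /ray /rty; ring: (C b) (C t).
  have e3 : sin b * rsz a b t r = sin b * cos t * rbz a b t r + sin t * raz a b t r - cos b * sin t * rtz a b t r.
    rewrite /rsz /rbz /raz /rtz; ring: (C b) (C t).
  transitivity (f1 * (sin b * rsx a b t r) + f2 * (sin b * rsy a b t r) +
      f3 * (sin b * rsz a b t r)); first by ring.
  by rewrite e1 e2 e3; ring.
Qed.

Lemma cos_2pi : cos (2 * pi) = 1 :> R.
Proof. by rewrite mulrC mulr_natr cos2pi. Qed.

Lemma sin_2pi : sin (2 * pi) = 0 :> R.
Proof. by rewrite mulrC mulr_natr sin2pi. Qed.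

(** After multiplication by the density sin b of the invariant measure, the
    derivative in s is a divergence,
      sin b H_s = (sin b cos t H)_b + (sin t H)_a - (cos b sin t H)_t,
    whose integral over the angles vanishes: sin b is zero at b = 0 and b = pi,
    and H is periodic in a and t. *)
Lemma rot_integral_const H (phi : R) : transported H -> 0 <= phi ->
  (forall b t s, H (2 * pi) b t s = H 0 b t s) ->
  (forall a b s, H a b (2 * pi) s = H a b 0 s) ->
  \cint_(0, 2 * pi) (fun a => \cint_(0, pi) (fun b => \cint_(0, 2 * pi) (fun t => sin b * H a b t phi))) =
  \cint_(0, 2 * pi) (fun a => \cint_(0, pi) (fun b => \cint_(0, 2 * pi) (fun t => sin b * H a b t 0))).
Proof.
move=> [Ha [Hb [Ht [Hs [cH [cHa cHb cHt cHs] [dHa dHb dHt dHs] eH]]]]] phi0 pera pert.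
have pi_ge0 : 0 <= pi :> R by exact: pi_ge0.
have pi2_ge0 : 0 <= 2 * pi :> R by rewrite mulr_ge0.
apply/eqP; rewrite -subr_eq0; apply/eqP.
have c1 s (T : topologicalType) (f1 f2 f3 : T -> R) : continuous f1 -> continuous f2 ->
    continuous f3 -> continuous (fun v => sin (f2 v) * H (f1 v) (f2 v) (f3 v) s).
  by move=> ? ? ?; cts; apply: (cts4 cH); cts.
have c2 s (T : topologicalType) (f1 f2 : T -> R) : continuous f1 -> continuous f2 ->
    continuous (fun v => \cint_(0, 2 * pi) (fun t => sin (f2 v) * H (f1 v) (f2 v) t s)).
  move=> k1 k2; apply: (@continuous_cint _ _ (fun v t => sin (f2 v) * H (f1 v) (f2 v) t s)).
  by apply: c1; cts; apply: cts_comp => //; cts.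
have c3 s : continuous (fun a => \cint_(0, pi) (fun b => \cint_(0, 2 * pi) (fun t => sin b * H a b t s))).
  apply: (@continuous_cint _ _ (fun a b => \cint_(0, 2 * pi) (fun t => sin b * H a b t s))).
  by apply: c2; cts.
rewrite -cintB//.
pose Db a b t s := cos b * (cos t * H a b t s) + sin b * (cos t * Hb a b t s).
pose Da a (b : R) t s := sin t * Ha a b t s.
pose Dt a b t s := - (cos b * cos t * H a b t s) - cos b * sin t * Ht a b t s.
have cDb : cont4 Db by rewrite /cont4 /Db; rewrite /cont4 in cH cHb; cts.
have cDa : cont4 Da by rewrite /cont4 /Da; rewrite /cont4 in cHa; cts.
have cDt : cont4 Dt by rewrite /cont4 /Dt; rewrite /cont4 in cHt cH; cts.
transitivity (cint4 0 (2 * pi) 0 pi 0 (2 * pi) 0 phi (fun a b t s => Db a b t s + Da a b t s + Dt a b t s)).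
  apply: eq_cint => a _; rewrite -cintB; [|by apply: c2; cts..].
  apply: eq_cint => b _; rewrite -cintB; [|by apply: c1; cts..].
  apply: eq_cint => t _; rewrite -mulrBr.
  have cHsF : continuous (Hs a b t) by apply: (cts4 cHs); cts.
  rewrite -(cint_FTC phi0 (dHs a b t) cHsF) -cintZl//.
  by apply: eq_cint => s _; rewrite eH /Db /Da /Dt; ring.
rewrite (@cint4D _ _ _ _ _ _ _ _ _ (fun a b t s => Db a b t s + Da a b t s) Dt)//; last first.
  by rewrite /cont4 in cDa cDb *; cts.
rewrite (@cint4D _ _ _ _ _ _ _ _ _ Db Da)//.
have -> : cint4 0 (2 * pi) 0 pi 0 (2 * pi) 0 phi Db = 0.
  rewrite /cint4 -[RHS](cint0 0 (2 * pi)); apply: eq_cint => a _.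
  rewrite cint_rot3; last by apply: (cts4 cDb); cts.
  rewrite -[RHS](cint0 0 (2 * pi)); apply: eq_cint => t _.
  rewrite -[RHS](cint0 0 phi); apply: eq_cint => s _.
  have dF (b : R) : is_derive b 1 (fun b => sin b * (cos t * H a b t s)) (Db a b t s).
    by have h := dHb a b t s; apply: is_derive_eq; rewrite /GRing.scale/= /Db; ring.
  rewrite (cint_FTC pi_ge0 dF); last by apply: (cts4 cDb); cts.
  by rewrite sinpi sin0 !mul0r subrr.
have -> : cint4 0 (2 * pi) 0 pi 0 (2 * pi) 0 phi Da = 0.
  rewrite /cint4 cint_fubini; last first.
    have cDa3 (T : topologicalType) (f1 f2 f3 : T -> R) : continuous f1 -> continuous f2 ->
        continuous f3 -> continuous (fun v => \cint_(0, phi) (Da (f1 v) (f2 v) (f3 v))).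
      move=> ? ? ?; apply: (@continuous_cint _ _ (fun v s => Da (f1 v) (f2 v) (f3 v) s)).
      by apply: (cts4 cDa); cts; apply: cts_comp => //; cts.
    apply: (@continuous_cint _ _ (fun v t => \cint_(0, phi) (Da v.1 v.2 t))).
    by apply: cDa3; cts.
  rewrite -[RHS](cint0 0 pi); apply: eq_cint => b _.
  rewrite cint_rot3; last by apply: (cts4 cDa); cts.
  rewrite -[RHS](cint0 0 (2 * pi)); apply: eq_cint => t _.
  rewrite -[RHS](cint0 0 phi); apply: eq_cint => s _.
  have dF (a : R) : is_derive a 1 (fun a => sin t * H a b t s) (Da a b t s).
    by have h := dHa a b t s; apply: is_derive_eq; rewrite /GRing.scale/= /Da; ring.
  rewrite (cint_FTC pi2_ge0 dF); last by apply: (cts4 cDa); cts.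
  by rewrite pera subrr.
have -> : cint4 0 (2 * pi) 0 pi 0 (2 * pi) 0 phi Dt = 0.
  rewrite /cint4 -[RHS](cint0 0 (2 * pi)); apply: eq_cint => a _.
  rewrite -[RHS](cint0 0 pi); apply: eq_cint => b _.
  rewrite cint_fubini; last by apply: (cts4 cDt); cts.
  rewrite -[RHS](cint0 0 phi); apply: eq_cint => s _.
  have dF (t : R) : is_derive t 1 (fun t => - (cos b * sin t * H a b t s)) (Dt a b t s).
    by have h := dHt a b t s; apply: is_derive_eq; rewrite /GRing.scale/= /Dt; ring.
  rewrite (cint_FTC pi2_ge0 dF); last by apply: (cts4 cDt); cts.
  by rewrite sin_2pi sin0 !(mulr0, mul0r) subrr.
by rewrite !addr0.
Qed.

(** The integral of E (angle s - phi) F (angle s) over the rotations does not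
    depend on s by [rot_integral_const]; compare s = phi with s = 0. *)
Lemma circle_mean_adjoint (F E : R -> R -> R -> R) (phi : R) : C1_3 F -> C1_3 E -> 0 <= phi ->
  \cint_(0, 2 * pi) (fun a => \cint_(0, pi) (fun b => \cint_(0, 2 * pi) (fun t => sin b *
     (E (sin b * cos a) (sin b * sin a) (cos b) *
      F (rotx a b t phi) (roty a b t phi) (rotz a b t phi))))) =
  \cint_(0, 2 * pi) (fun a => \cint_(0, pi) (fun b => \cint_(0, 2 * pi) (fun t => sin b *
     (E (rotx a b t (- phi)) (roty a b t (- phi)) (rotz a b t (- phi)) *
      F (sin b * cos a) (sin b * sin a) (cos b))))).
Proof.
move=> cF cE phi0.
have tr := transportedM (transported_rot (- phi) cE) (transported_rot 0 cF).
have r0 a b t : (rotx a b t 0 = sin b * cos a) * (roty a b t 0 = sin b * sin a) * (rotz a b t 0 = cos b).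
  by rewrite /rotx /roty /rotz cos0 sin0 !mul0r !mul1r !addr0 subr0.
have := rot_integral_const tr phi0.
move=> /(_ _ _)/wrap[||h].
- by move=> b t s; rewrite /rotx /roty /rotz !cos_2pi !sin_2pi !cos0 !sin0.
- by move=> b t s; rewrite /rotx /roty /rotz !cos_2pi !sin_2pi !cos0 !sin0.
etransitivity; last (etransitivity; first exact: h);
  apply: eq_cint => a _; apply: eq_cint => b _; apply: eq_cint => t _.
- by rewrite subrr addr0 !r0.
- by rewrite add0r addr0 !r0.
Qed.

End rotation_invariance.

(** * Complex-valued integrals *)
Notation cRint a b h := (cRintegral [set` `[a, b]] h).

Section complex_integrals.
Context {R : realType}.
Local Open Scope complex_scope.
Implicit Types (a b : R).

Lemma cReD (x y : R[i]) : Re (x + y) = Re x + Re y. Proof. by case: x; case: y. Qed.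
Lemma cImD (x y : R[i]) : Im (x + y) = Im x + Im y. Proof. by case: x; case: y. Qed.
Lemma cReM (x y : R[i]) : Re (x * y) = Re x * Re y - Im x * Im y.
Proof. by case: x; case: y. Qed.
Lemma cImM (x y : R[i]) : Im (x * y) = Re x * Im y + Im x * Re y.
Proof. by case: x => ? ?; case: y => ? ?. Qed.

Lemma complex_ext (x y : R[i]) : Re x = Re y -> Im x = Im y -> x = y.
Proof. by case: x => ? ?; case: y => ? ? /= -> ->. Qed.

Definition contC (T : topologicalType) (h : T -> R[i]) :=
  continuous (fun x => Re (h x)) /\ continuous (fun x => Im (h x)).

Section contC.
Context {T : topologicalType}.
Implicit Types h k : T -> R[i].

Lemma contC_cst (c : R[i]) : contC (fun _ : T => c).
Proof. by split; cts. Qed.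

Lemma contCD h k : contC h -> contC k -> contC (fun x => h x + k x).
Proof.
move=> [h1 h2] [k1 k2]; split.
- by rewrite (_ : (fun _ => _) = fun x => Re (h x) + Re (k x)); [cts|apply/funext => x; rewrite cReD].
- by rewrite (_ : (fun _ => _) = fun x => Im (h x) + Im (k x)); [cts|apply/funext => x; rewrite cImD].
Qed.

Lemma contCM h k : contC h -> contC k -> contC (fun x => h x * k x).
Proof.
move=> [h1 h2] [k1 k2]; split.
- rewrite (_ : (fun _ => _) = fun x => Re (h x) * Re (k x) - Im (h x) * Im (k x)); first by cts.
  by apply/funext => x; rewrite cReM.
- rewrite (_ : (fun _ => _) = fun x => Re (h x) * Im (k x) + Im (h x) * Re (k x)); first by cts.
  by apply/funext => x; rewrite cImM.
Qed.

Lemma contCX h n : contC h -> contC (fun x => h x ^+ n).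
Proof.
move=> ch; elim: n => [|n IHn]; first exact: contC_cst.
rewrite (_ : (fun _ => _) = (fun x => h x * h x ^+ n)); first exact: contCM.
by apply/funext => x; rewrite exprS.
Qed.

Lemma contC_real (f : T -> R) : continuous f -> contC (fun x => (f x)%:C).
Proof. by split => //=; cts. Qed.

Lemma contC_cis (f : T -> R) : continuous f -> contC (fun x => cis (f x)).
Proof. by split => /=; cts. Qed.

Lemma contC_sum (n : nat) (h : nat -> T -> R[i]) : (forall i, contC (h i)) ->
  contC (fun x => \sum_(i < n) h i x).
Proof.
move=> ch; elim: n => [|n IHn].
  rewrite (_ : (fun _ => _) = fun=> 0); first exact: contC_cst.
  by apply/funext => x; rewrite big_ord0.
rewrite (_ : (fun _ => _) = fun x => \sum_(i < n) h i x + h n x); first exact: contCD.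
by apply/funext => x; rewrite big_ord_recr.
Qed.

End contC.

Lemma eq_cRint a b (h k : R -> R[i]) : (forall x, a <= x <= b -> h x = k x) ->
  cRint a b h = cRint a b k.
Proof. by move=> hk; congr Complex; apply: eq_cint => x xab; rewrite hk. Qed.

Lemma cRintD a b (h k : R -> R[i]) : contC h -> contC k ->
  cRint a b (fun x => h x + k x) = cRint a b h + cRint a b k.
Proof.
move=> [h1 h2] [k1 k2]; apply: complex_ext; rewrite ?cReD ?cImD /= -cintD//;
  by apply: eq_cint => x _; rewrite ?cReD ?cImD.
Qed.

Lemma cRintZ a b (c : R[i]) (h : R -> R[i]) : contC h ->
  cRint a b (fun x => c * h x) = c * cRint a b h.
Proof.
move=> [h1 h2]; apply: complex_ext; rewrite ?cReM ?cImM /= -!cintZl// -?cintD -?cintB; try by cts.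
- by apply: eq_cint => x _; rewrite cReM.
- by apply: eq_cint => x _; rewrite cImM.
Qed.

Lemma cRint_sum a b n (h : nat -> R -> R[i]) : (forall i, contC (h i)) ->
  cRint a b (fun x => \sum_(i < n) h i x) = \sum_(i < n) cRint a b (h i).
Proof.
move=> ch; elim: n => [|n IHn].
  rewrite big_ord0 (eq_cRint (k := fun=> 0)); last by move=> x _; rewrite big_ord0.
  by apply: complex_ext; rewrite /= cint0.
rewrite big_ord_recr/= -IHn -cRintD//; last exact: contC_sum.
by apply: eq_cRint => x _; rewrite big_ord_recr.
Qed.

Lemma contC_cRint (T : topologicalType) a b (F : T -> R -> R[i]) :
  contC (fun v : T * R => F v.1 v.2) -> contC (fun t => cRint a b (F t)).
Proof.
move=> [c1 c2]; split => /=.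
- exact: (continuous_cint (F := fun t x => Re (F t x))).
- exact: (continuous_cint (F := fun t x => Im (F t x))).
Qed.

Lemma cisD a b : cis (a + b) = cis a * cis b.
Proof. by apply: complex_ext; rewrite ?cReM ?cImM/= ?cosD// sinD addrC mulrC [in X in _ + X]mulrC addrC. Qed.

Lemma cis0 : cis 0 = 1 :> R[i].
Proof. by apply: complex_ext; rewrite /= ?cos0 ?sin0. Qed.

Lemma cis2pi : cis (2 * pi) = 1 :> R[i].
Proof. by apply: complex_ext; rewrite /= ?cos_2pi ?sin_2pi. Qed.

Lemma cisMn a n : cis (n%:R * a) = cis a ^+ n.
Proof.
elim: n => [|n IHn]; first by rewrite mul0r cis0.
by rewrite -natr1 mulrDl mul1r cisD IHn exprSr.
Qed.

Lemma cisK a : cis a * cis (- a) = 1.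
Proof. by rewrite -cisD subrr cis0. Qed.

Lemma cisN_2pi : cis (- (2 * pi)) = 1 :> R[i].
Proof. by rewrite -[LHS]mul1r -{1}cis2pi cisK. Qed.

Lemma cis_orthogonal (j l : nat) :
  cRint 0 (2 * pi) (fun t => cis ((j%:R - l%:R) * t)) = if j == l then (2 * pi)%:C else 0 :> R[i].
Proof.
have pi2_ge0 : 0 <= 2 * pi :> R by rewrite mulr_ge0 ?pi_ge0.
have [->|jl] := eqVneq j l.
  rewrite (eq_cRint (k := fun=> 1)); last by move=> x _; rewrite subrr mul0r cis0.
  by apply: complex_ext => /=; rewrite cint_cst// subr0 ?mul1r ?mul0r.
set n := j%:R - l%:R : R.
have n0 : n != 0 by rewrite subr_eq0 eqr_nat.
have n2 : cis (n * (2 * pi)) = 1.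
  by rewrite mulrBl cisD -mulrN (cisMn (2 * pi)) (cisMn (- (2 * pi))) cis2pi cisN_2pi !expr1n mulr1.
apply: complex_ext => /=.
- have dF (t : R) : is_derive t 1 (fun t => n^-1 * sin (n * t)) (cos (n * t)).
    by apply: is_derive_eq; rewrite /GRing.scale/=; field.
  rewrite (cint_FTC pi2_ge0 dF); last by cts.
  by rewrite mulr0 sin0 mulr0 subr0; move: n2 => [_ ->]; rewrite mulr0.
- have dF (t : R) : is_derive t 1 (fun t => - (n^-1 * cos (n * t))) (sin (n * t)).
    by apply: is_derive_eq; rewrite /GRing.scale/=; field.
  rewrite (cint_FTC pi2_ge0 dF); last by cts.
  by rewrite mulr0 cos0; move: n2 => [-> _]; rewrite subrr.
Qed.

Lemma fourier_coefficient (q : {poly R[i]}) (l n : nat) : (size q <= n)%N -> (l < n)%N ->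
  cRint 0 (2 * pi) (fun t => cis (- (l%:R * t)) * q.[cis t]) = (2 * pi)%:C * q`_l.
Proof.
move=> qn ln.
rewrite (eq_cRint (k := fun t => \sum_(j < n) q`_j * cis ((j%:R - l%:R) * t))); last first.
  move=> t _; rewrite (horner_coef_wide _ qn) mulr_sumr; apply: eq_bigr => j _.
  by rewrite mulrCA -cisMn -cisD; congr (_ * cis _); ring.
have c0 (j : nat) : contC (fun t : R => cis ((j%:R - l%:R) * t)) by apply: contC_cis; cts.
rewrite (cRint_sum 0 (2 * pi) n (h := fun j t => q`_j * cis ((j%:R - l%:R) * t))); last first.
  by move=> i; apply: contCM; [exact: contC_cst|exact: c0].
under eq_bigr => j _ do rewrite cRintZ// cis_orthogonal.
rewrite (bigD1 (Ordinal ln))//= eqxx mulrC big1 ?addr0// => j jl.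
by rewrite (negbTE (_ : nat_of_ord j != l)) ?mulr0//; apply: contraNneq jl => jl; apply/eqP/val_inj.
Qed.

End complex_integrals.

(** * Circle means of powers of isotropic forms *)
Section mean_value.
Context {R : realType}.
Local Open Scope complex_scope.

(** zonal l (cos phi) (sin phi ^+ 2) is the Legendre polynomial P_l at cos phi,
    written as Laplace's integral produces it: the mean over t of
    (cos phi + i sin phi cos t)^l, expanded by the binomial theorem. *)
Definition zonal (K : fieldType) (l : nat) (x y : K) : K :=
  \sum_(k < l.+1 | ~~ odd k)
    ('C(l, k) * 'C(k, k./2))%:R * x ^+ (l - k) * (- y / 4) ^+ k./2.

Lemma zonal_rmorph (K L : fieldType) (f : {rmorphism K -> L}) l (x y : K) :
  f (zonal l x y) = zonal l (f x) (f y).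
Proof.
rewrite /zonal rmorph_sum; apply: eq_bigr => k _.
by rewrite !(rmorphM f) !(rmorph_nat f) !(rmorphXn f) (rmorphM f) fmorphV rmorphN (rmorph_nat f).
Qed.

Lemma coef_even_binomial (K : fieldType) (a b : K) k :
  ((b%:P + a *: 'X^2) ^+ k)`_k = if odd k then 0 else ('C(k, k./2))%:R * (a * b) ^+ k./2.
Proof.
rewrite exprDn coef_sum.
have kE : k = (odd k + (k./2).*2)%N by rewrite odd_double_half.
have coefi (i : 'I_k.+1) : (b%:P ^+ (k - i) * (a *: 'X^2) ^+ i *+ 'C(k, i))`_k =
    if i.*2 == k then b ^+ (k - i) * a ^+ i *+ 'C(k, i) else 0.
  rewrite coefMn exprZn -rmorphXn /= mul_polyC !coefZ -exprM coefXn mul2n eq_sym.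
  by case: eqP => _; rewrite ?mulr1// !mulr0 mul0rn.
under eq_bigr => i _ do rewrite coefi.
have [ok|ek] := ifP.
  by rewrite big1// => i _; case: eqP => // ik; rewrite -ik odd_double in ok.
have k2 : (k./2 < k.+1)%N by rewrite ltnS [leqRHS]kE -addnn addnA leq_addl.
have k2E : (k./2).*2 = k by rewrite [RHS]kE ek.
rewrite (bigD1 (Ordinal k2))//= k2E eqxx big1 ?addr0; last first.
  move=> i ik; case: eqP => // ikE; move/negP: ik; case; apply/eqP/val_inj => /=.
  by rewrite -[LHS]doubleK ikE.
have -> : (k - k./2 = k./2)%N by rewrite -{1}k2E -addnn addnK.
by rewrite -exprMn [b * a]mulrC mulr_natl.
Qed.

Lemma coef_trinomial (K : fieldType) (c a b : K) (l : nat) (x y : K) :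
  4 * (a * b) = - y * c ^+ 2 -> (4 : K) != 0 ->
  (((x * c) *: 'X + (b%:P + a *: 'X^2)) ^+ l)`_l = zonal l x y * c ^+ l.
Proof.
move=> ab n4; rewrite exprDn coef_sum /zonal mulr_suml [RHS]big_mkcond/=.
apply: eq_bigr => k _.
have kl : (k <= l)%N by rewrite -ltnS.
rewrite coefMn exprZn -scalerAl coefZ coefXnM ltnNge leq_subr/= subKn// coef_even_binomial.
case: ifP => [ok|/negbT ek]; first by rewrite mulr0 mul0rn.
have -> : a * b = - y / 4 * c ^+ 2.
  by apply: (mulfI n4); rewrite ab; field.
have kE : (k./2).*2 = k by rewrite -[RHS]odd_double_half (negbTE ek).
have -> : c ^+ l = c ^+ (l - k) * (c ^+ k./2 * c ^+ k./2).
  by rewrite -!exprD addnn kE subnK.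
rewrite natrM -[LHS]mulr_natl expr2 !exprMn; ring.
Qed.

Definition zform (z : R[i] * R[i] * R[i]) (x y t : R) : R[i] :=
  z.1.1 * x%:C + z.1.2 * y%:C + z.2 * t%:C.

Definition isotropic (z : R[i] * R[i] * R[i]) := z.1.1 ^+ 2 + z.1.2 ^+ 2 + z.2 ^+ 2 = 0.

Lemma size_trinomial (K : fieldType) (c a b : K) l :
  (size ((c *: 'X + (b%:P + a *: 'X^2)) ^+ l)%R <= l.*2.+1)%N.
Proof.
apply: (leq_trans (size_exp_leq _ _)); rewrite ltnS -muln2 mulnC leq_mul2l; apply/orP; right.
have s : (size (c *: 'X + (b%:P + a *: 'X^2))%R <= 3)%N.
  apply: (leq_trans (size_polyD _ _)); rewrite geq_max (leq_trans (size_scale_leq _ _)) ?size_polyX//=.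
  apply: (leq_trans (size_polyD _ _)); rewrite geq_max (leq_trans (size_polyC_leq1 _))//=.
  by rewrite (leq_trans (size_scale_leq _ _))// size_polyXn.
by case: (size _) s.
Qed.

(** Let A, B, C be the values of the form on the rotated frame, C being the one
    at the centre of the circle. They inherit A^2 + B^2 + C^2 = 0, and the form
    on the circle is cos s C + sin s (cos t A + sin t B). Times cis t this is a
    quadratic trinomial in cis t, and the mean of its l-th power over t extracts
    the middle coefficient. The product of the outer coefficients is
    sin^2 s (A^2 + B^2) / 4 = - sin^2 s C^2 / 4, so that this coefficient is C^l
    times a function of s. *)
Lemma circle_mean_isotropic z l (a b s : R) : isotropic z ->
  cRint 0 (2 * pi) (fun t => zform z (rotx a b t s) (roty a b t s) (rotz a b t s) ^+ l) =
  (2 * pi * zonal l (cos s) (sin s ^+ 2))%:C * zform z (sin b * cos a) (sin b * sin a) (cos b) ^+ l.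
Proof.
move=> iz.
pose A := zform z (cos b * cos a) (cos b * sin a) (- sin b).
pose B := zform z (- sin a) (cos a) 0.
pose C := zform z (sin b * cos a) (sin b * sin a) (cos b).
have ABC : A ^+ 2 + B ^+ 2 + C ^+ 2 = 0.
  have cs (x : R) : (sin x)%:C ^+ 2 = 1 - (cos x)%:C ^+ 2 :> R[i] by rewrite -rmorphXn /= sin2cos2 rmorphB rmorph1 rmorphXn.
  rewrite /A /B /C /zform !rmorphM !rmorphN rmorph0 -[RHS]iz; ring: (cs a) (cs b).
have i2 : 'i ^+ 2 = -1 :> R[i] by exact: sqr_i.
have i4 : (4 : R[i]) != 0 by rewrite pnatr_eq0.
have n2 : (2 : R[i]) != 0 by rewrite pnatr_eq0.
pose al : R[i] := (A - 'i * B) / 2; pose be : R[i] := (A + 'i * B) / 2.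
pose sC : R[i] := (sin s)%:C; pose cC : R[i] := (cos s)%:C.
pose q := ((cC * C) *: 'X + ((sC * be)%:P + (sC * al) *: 'X^2)) ^+ l.
rewrite (eq_cRint (k := fun t => cis (- (l%:R * t)) * q.[cis t])); last first.
  move=> t _; rewrite -mulrN cisMn /q horner_exp -exprMn; congr (_ ^+ _).
  rewrite hornerD hornerZ hornerX hornerD hornerC hornerZ hornerXn.
  have -> : zform z (rotx a b t s) (roty a b t s) (rotz a b t s) =
      cC * C + sC * ((cos t)%:C * A + (sin t)%:C * B).
    rewrite /zform /rotx /roty /rotz /cC /sC /A /B /C /zform.
    rewrite !(rmorphD, rmorphB, rmorphM, rmorphN) rmorph0; ring.
  have cK := cisK t.
  have ccos : (cos t)%:C = (cis t + cis (- t)) / 2 :> R[i].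
    apply: (mulIf n2); rewrite mulfVK//.
    by apply: complex_ext; rewrite /= ?cosN ?sinN; ring.
  have csin : (sin t)%:C = - 'i * (cis t - cis (- t)) / 2 :> R[i].
    apply: (mulIf n2); rewrite mulfVK//.
    by apply: complex_ext; rewrite /= ?cosN ?sinN; ring.
  rewrite ccos csin /al /be; set u := cis t in cK *; set v := cis (- t) in cK *.
  transitivity (cC * C * (u * v) + sC * ((v + u * (u * v)) / 2 * A + (- 'i * (u * (u * v) - v) / 2 * B))).
    by rewrite cK; ring.
  by field.
rewrite (@fourier_coefficient _ q l l.*2.+1); last 2 first.
- exact: size_trinomial.
- by rewrite ltnS -addnn leq_addr.
rewrite (@coef_trinomial _ C _ _ l cC (sC ^+ 2)) //; last first.
  rewrite /al /be.
  have C2 : C ^+ 2 = - (A ^+ 2 + B ^+ 2) by apply/eqP; rewrite -addr_eq0 addrC ABC.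
  rewrite C2; transitivity (sC ^+ 2 * (A ^+ 2 - 'i ^+ 2 * B ^+ 2)); first by field.
  by rewrite i2; ring.
rewrite mulrA; congr (_ * _); rewrite [RHS]rmorphM; congr (_ * _).
by rewrite /cC /sC -rmorphXn -zonal_rmorph.
Qed.

End mean_value.

(** * The Funk-Hecke formula for isotropic powers *)
Section funk_hecke.
Context {R : realType}.
Local Open Scope complex_scope.

Lemma C1_3_zform (z : R[i] * R[i] * R[i]) l :
  C1_3 (fun x y t => Re (zform z x y t ^+ l)) /\ C1_3 (fun x y t => Im (zform z x y t ^+ l)).
Proof.
have [cr ci] : C1_3 (fun x y t => Re (zform z x y t)) /\ C1_3 (fun x y t => Im (zform z x y t)).
  split.
  - rewrite (_ : (fun _ _ _ => _) = (fun x y t => Re z.1.1 * x + Re z.1.2 * y + Re z.2 * t)).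
      exact: C1_3_lin.
    by apply/funext => x; apply/funext => y; apply/funext => t; rewrite /zform !cReD !cReM/=; ring.
  - rewrite (_ : (fun _ _ _ => _) = (fun x y t => Im z.1.1 * x + Im z.1.2 * y + Im z.2 * t)).
      exact: C1_3_lin.
    by apply/funext => x; apply/funext => y; apply/funext => t; rewrite /zform !cImD !cImM/=; ring.
elim: l => [|l [IHr IHi]]; first by split; exact: C1_3_cst.
split.
- rewrite (_ : (fun _ _ _ => _) = (fun x y t => Re (zform z x y t) * Re (zform z x y t ^+ l) +
      Im (zform z x y t) * (0 * 0 + (-1) * Im (zform z x y t ^+ l)))).
    apply: C1_3_mulD => //; apply: (C1_3_mulD (F := fun _ _ _ => 0) (G := fun _ _ _ => 0) (H := fun _ _ _ => -1)) => //; exact: C1_3_cst.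
  by apply/funext => x; apply/funext => y; apply/funext => t; rewrite exprS cReM; ring.
- rewrite (_ : (fun _ _ _ => _) = (fun x y t => Re (zform z x y t) * Im (zform z x y t ^+ l) +
      Im (zform z x y t) * Re (zform z x y t ^+ l))); first exact: C1_3_mulD.
  by apply/funext => x; apply/funext => y; apply/funext => t; rewrite exprS cImM.
Qed.

Definition sphere_int (G : R -> R -> R -> R) :=
  \cint_(0, 2 * pi) (fun a => \cint_(0, pi) (fun b =>
    sin b * G (sin b * cos a) (sin b * sin a) (cos b))).

(** The derivatives and integrals at hand are those of real functions, so that
    the real and imaginary parts of the power are treated separately, as the two
    values of [part]. *)
Definition isotropic_part (part : R[i] -> R) (z : R[i] * R[i] * R[i]) l x y t :=
  part (zform z x y t ^+ l).

(** By [circle_mean_adjoint] the mean over circles acts on the power instead of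
    F, where [circle_mean_isotropic] evaluates it. *)
Lemma funk_hecke (F : R -> R -> R -> R) z l (phi : R) (part : R[i] -> R) :
  part = @complex.Re R \/ part = @complex.Im R ->
  isotropic z -> C1_3 F -> 0 <= phi ->
  \cint_(0, 2 * pi) (fun a => \cint_(0, pi) (fun b => \cint_(0, 2 * pi) (fun t => sin b *
     (isotropic_part part z l (sin b * cos a) (sin b * sin a) (cos b) *
      F (rotx a b t phi) (roty a b t phi) (rotz a b t phi))))) =
  2 * pi * zonal l (cos phi) (sin phi ^+ 2) *
  sphere_int (fun x y t => isotropic_part part z l x y t * F x y t).
Proof.
move=> partE iz cF phi0.
set E := isotropic_part part z l.
have cE : C1_3 E by rewrite /E /isotropic_part; case: partE => ->; have [] := C1_3_zform z l.
have partZ (x : R) (w : R[i]) : part (x%:C * w) = x * part w.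
  by case: partE => ->; rewrite ?cReM ?cImM/= mul0r ?subr0 ?addr0.
have c3 := C1_3_cont cE; have cF3 := C1_3_cont cF.
have partI (h : R -> R[i]) : part (cRint 0 (2 * pi) h) = \cint_(0, 2 * pi) (fun t => part (h t)).
  by case: partE => ->.
rewrite (circle_mean_adjoint cF cE phi0) /sphere_int -cintZl; last first.
  apply: (@continuous_cint R _ (fun a b => sin b *
    (E (sin b * cos a) (sin b * sin a) (cos b) * F (sin b * cos a) (sin b * sin a) (cos b)))).
  by cts; [apply: (cts3 c3)|apply: (cts3 cF3)]; cts.
apply: eq_cint => a _; rewrite -cintZl; last first.
  by cts; [apply: (cts3 c3)|apply: (cts3 cF3)]; cts.
apply: eq_cint => b _.
have cEt : continuous (fun t => E (rotx a b t (- phi)) (roty a b t (- phi)) (rotz a b t (- phi))).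
  by apply: (cts3 c3); rewrite /rotx /roty /rotz; cts.
transitivity (sin b * F (sin b * cos a) (sin b * sin a) (cos b) *
   \cint_(0, 2 * pi) (fun t => E (rotx a b t (- phi)) (roty a b t (- phi)) (rotz a b t (- phi)))).
  rewrite -cintZl//; apply: eq_cint => t _; ring.
have := congr1 part (circle_mean_isotropic l a b (- phi) iz).
rewrite partI partZ cosN sinN sqrrN /E /isotropic_part => ->; ring.
Qed.

End funk_hecke.

(** * Spherical harmonics as coefficients of isotropic powers *)
Section harmonics.
Context {R : realType}.
Local Open Scope complex_scope.

Lemma coef_mul_trinomial (K : fieldType) (a b c : K) (p : {poly K}) j :
  ((a%:P + b *: 'X + c *: 'X^2) * p)`_j =
  a * p`_j + (if (j < 1)%N then 0 else b * p`_(j - 1)) + (if (j < 2)%N then 0 else c * p`_(j - 2)).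
Proof.
rewrite !mulrDl !coefD coefCM -!scalerAl !coefZ coefXnM -[X in (X * p)`_j]expr1 coefXnM.
by congr (_ + _ + _); case: ifP; rewrite ?mulr0.
Qed.

Lemma contC_coef (T : topologicalType) (a b c : T -> R[i]) l j : contC a -> contC b -> contC c ->
  contC (fun t => (((a t)%:P + (b t) *: 'X + (c t) *: 'X^2) ^+ l)`_j).
Proof.
move=> ca cb cc; elim: l j => [|l IHl] j.
  by rewrite (_ : (fun _ => _) = fun=> (1 : {poly R[i]})`_j); [exact: contC_cst|apply/funext => t; rewrite expr0].
rewrite (_ : (fun _ => _) = fun t =>
  a t * (((a t)%:P + (b t) *: 'X + (c t) *: 'X^2) ^+ l)`_j +
  (if (j < 1)%N then 0 else b t * (((a t)%:P + (b t) *: 'X + (c t) *: 'X^2) ^+ l)`_(j - 1)) +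
  (if (j < 2)%N then 0 else c t * (((a t)%:P + (b t) *: 'X + (c t) *: 'X^2) ^+ l)`_(j - 2))); last first.
  by apply/funext => t; rewrite exprS coef_mul_trinomial.
apply: contCD; first apply: contCD; first exact: contCM.
- by case: (j < 1)%N; [exact: contC_cst|exact: contCM].
- by case: (j < 2)%N; [exact: contC_cst|exact: contCM].
Qed.

(** The sum is a polynomial with more roots, 1 to n, than its size allows. *)
Lemma poly_vanishing (n : nat) (c : nat -> R[i]) :
  (forall x : R, 0 < x -> \sum_(j < n) c j * x%:C ^+ j = 0) -> forall j, (j < n)%N -> c j = 0.
Proof.
move=> h j jn.
pose q : {poly R[i]} := \poly_(j < n) c j.
suff q0 : q = 0 by have := coef_poly n c j; rewrite jn -/q q0 coef0.
apply/eqP; apply: contraT => qn0.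
have := max_poly_roots (rs := [seq (k.+1%:R : R[i]) | k <- iota 0 n]) qn0.
have -> : all (root q) [seq k.+1%:R | k <- iota 0 n].
  apply/allP => _ /mapP[k _ ->]; apply/rootP; rewrite horner_poly.
  by have := h k.+1%:R (ltr0Sn _ _); rewrite rmorph_nat.
have -> : uniq [seq (k.+1%:R : R[i]) | k <- iota 0 n].
  rewrite map_inj_in_uniq ?iota_uniq// => x y _ _ /eqP.
  by rewrite eqr_nat eqSS => /eqP.
move=> /(_ isT isT); rewrite size_map size_iota ltnNge size_poly//.
Qed.

(** gen_coef l j b is, up to a constant, the associated Legendre function of
    degree l and order j - l at cos b; see [gen_coefE]. *)
Definition gen_coef l j (b : R) : R[i] :=
  ((('i * (sin b)%:C)%:P + (2 * (cos b)%:C) *: 'X + ('i * (sin b)%:C) *: 'X^2) ^+ l)`_j.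

Lemma contC_gen_coef l j (T : topologicalType) (f : T -> R) : continuous f ->
  contC (fun t => gen_coef l j (f t)).
Proof.
move=> cf; apply: contC_coef; (apply: contCM; first exact: contC_cst);
  by apply: contC_real; cts.
Qed.

Definition gen_vector (x : R) : R[i] * R[i] * R[i] :=
  ('i * (x%:C + x%:C^-1) / 2, (x%:C - x%:C^-1) / 2, 1).

Lemma gen_vector_isotropic (x : R) : 0 < x -> isotropic (gen_vector x).
Proof.
move=> x0; rewrite /isotropic /gen_vector /=.
have i2 : 'i ^+ 2 = -1 :> R[i] by exact: sqr_i.
have n2 : (2 : R[i]) != 0 by rewrite pnatr_eq0.
have xn : x%:C != 0 :> R[i] by rewrite (fmorph_eq0 (real_complex R)) gt_eqF.
transitivity ('i ^+ 2 * ((x%:C + x%:C^-1) / 2) ^+ 2 + ((x%:C - x%:C^-1) / 2) ^+ 2 + 1 : R[i]); first by field.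
by rewrite i2; field; rewrite xn.
Qed.

(** Generating function of the spherical harmonics of degree l:
    2 x cis a (z . omega) = i sin b (cis (2 a) + x^2) + 2 x cis a cos b is a
    quadratic trinomial in x cis (- a) once cis (2 a) is factored out. *)
Lemma gen_vector_zform (x a b : R) l : 0 < x ->
  (2 * x%:C) ^+ l * zform (gen_vector x) (sin b * cos a) (sin b * sin a) (cos b) ^+ l =
  \sum_(j < l.*2.+1) gen_coef l j b * cis ((l%:R - j%:R) * a) * x%:C ^+ j.
Proof.
move=> x0.
have xn : x%:C != 0 :> R[i] by rewrite (fmorph_eq0 (real_complex R)) gt_eqF.
have n2 : (2 : R[i]) != 0 by rewrite pnatr_eq0.
set q : {poly R[i]} := (('i * (sin b)%:C)%:P + (2 * (cos b)%:C) *: 'X + ('i * (sin b)%:C) *: 'X^2) ^+ l.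
have sq : (size q <= l.*2.+1)%N.
  by rewrite /q [(_%:P + _)%R]addrC -addrA; exact: size_trinomial.
transitivity (cis (l%:R * a) * q.[x%:C * cis (- a)]); last first.
  rewrite (horner_coef_wide _ sq) mulr_sumr; apply: eq_bigr => j _.
  rewrite exprMn -cisMn /gen_coef -/q mulrBl cisD mulrN; ring.
rewrite cisMn -exprMn /q horner_exp -exprMn; congr (_ ^+ _).
rewrite !hornerD hornerC !hornerZ hornerX hornerXn.
rewrite /zform /gen_vector /= !rmorphM /= mul1r.
have cK := cisK a.
have ccos : (cos a)%:C = (cis a + cis (- a)) / 2 :> R[i].
  apply: (mulIf n2); rewrite mulfVK//.
  by apply: complex_ext; rewrite /= ?cosN ?sinN; ring.
have csin : 'i * (sin a)%:C = (cis a - cis (- a)) / 2 :> R[i].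
  apply: (mulIf n2); rewrite mulfVK//.
  by apply: complex_ext; rewrite /= ?cosN ?sinN; ring.
have i2 : 'i * 'i = -1 :> R[i] by rewrite -expr2; exact: sqr_i.
set u := cis a in cK ccos csin *; set v := cis (- a) in cK ccos csin *.
have csin' : (sin a)%:C = - 'i * ((u - v) / 2) :> R[i].
  by rewrite -csin mulNr mulrA i2 mulN1r opprK.
rewrite ccos csin'.
transitivity (u * v * (2 * (x%:C * (cos b)%:C)) + 'i * (sin b)%:C * (u + x%:C ^+ 2 * v)).
  by rewrite cK; field; rewrite xn.
transitivity (u * v * (2 * (x%:C * (cos b)%:C)) + 'i * (sin b)%:C * (u + x%:C ^+ 2 * ((u * v) * v))).
  by rewrite cK !mul1r.
ring.
Qed.

Lemma coef_comp_affine (K : fieldType) (p : {poly K}) (z c : K) j :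
  (p \Po (z%:P + c *: 'X))`_j = c ^+ j * p^`N(j).[z].
Proof.
have := nderiv_taylor p^:P (mulrC z%:P (c *: 'X)).
rewrite -/(comp_poly _ _) => ->.
rewrite size_map_polyC.
rewrite (eq_bigr (fun i : 'I_(size p) => (p^`N(i).[z] * c ^+ i) *: 'X^i)); last first.
  by move=> i _; rewrite nderivn_map horner_map/= exprZn mul_polyC scalerA.
rewrite -(poly_def (size p) (fun i => p^`N(i).[z] * c ^+ i)) coef_poly mulrC.
case: ltnP => // pj; rewrite nderivn_poly0// horner0 mulr0//.
Qed.

(** With c = i sin b one has c^2 = cos^2 b - 1, whence
    c (c + 2 cos b X + c X^2) = (cos b + c X)^2 - 1. The trinomial to the power
    l is thus a rescaled Taylor expansion at cos b of (X^2 - 1)^l, whose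
    derivatives give the Legendre functions by Rodrigues' formula. *)
Lemma gen_coefE l m (b : R) : sin b != 0 ->
  gen_coef l (l + m) b = ('i * (sin b)%:C) ^+ m *
    ((('X^2 - 1) ^+ l)^`(l + m)).[cos b]%:C / ((l + m)`!)%:R.
Proof.
move=> sb.
set c := 'i * (sin b)%:C : R[i].
have cn : c != 0.
  rewrite mulf_neq0//; last by rewrite (fmorph_eq0 (real_complex R)).
  by apply/eqP => /(congr1 (fun x => x ^+ 2)); rewrite (sqr_i R) expr0n/= => /eqP; rewrite oppr_eq0 oner_eq0.
pose p : {poly R[i]} := ('X^2 - 1) ^+ l.
have pT : p \Po ((cos b)%:C%:P + c *: 'X) = c ^+ l *:
   ((c%:P + (2 * (cos b)%:C) *: 'X + c *: 'X^2) ^+ l).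
  rewrite /p rmorphXn/= rmorphB rmorph1 rmorphXn/= comp_polyX -exprZn; congr (_ ^+ _).
  have c2 : c ^+ 2 = (cos b)%:C ^+ 2 - 1.
    rewrite /c exprMn (sqr_i R) -rmorphXn /= sin2cos2 rmorphB rmorph1 rmorphXn; ring.
  have c2P : c%:P ^+ 2 = (cos b)%:C%:P ^+ 2 - 1 :> {poly R[i]}.
    by rewrite -rmorphXn c2 rmorphB rmorph1 rmorphXn.
  have -> : (2 * (cos b)%:C) *: 'X = 2 * (cos b)%:C%:P * 'X :> {poly R[i]}.
    by rewrite -mul_polyC (rmorphM polyC) (rmorph_nat polyC).
  rewrite -!mul_polyC; set cP := c%:P in c2P *; set d := (cos b)%:C%:P in c2P *.
  ring: c2P.
have := congr1 (fun p : {poly _} => p`_(l + m)) pT.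
rewrite coefZ coef_comp_affine exprD -mulrA => /(mulfI (expf_neq0 l cn)).
rewrite -/(gen_coef l (l + m) b) => <-.
rewrite -mulrA; congr (_ * _).
have pE : p = map_poly (real_complex R) (('X^2 - 1) ^+ l).
  by rewrite rmorphXn/= rmorphB/= map_polyXn rmorph1.
have f0 : ((l + m)`!)%:R != 0 :> R[i] by rewrite pnatr_eq0 -lt0n fact_gt0.
apply: (mulIf f0); rewrite mulfVK// mulr_natr -hornerMn -nderivn_def pE derivn_map horner_map//.
Qed.

End harmonics.

(** * Harmonic coefficients from moments of isotropic powers *)
Section harmonic_coefficients.
Context {R : realType}.
Local Open Scope complex_scope.

Definition gen_integral (G : R -> R -> R) l j : R[i] :=
  cRint 0 (2 * pi) (fun a => cRint 0 pi (fun b =>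
    (G a b)%:C * (gen_coef l j b * cis ((l%:R - j%:R) * a)))).

Lemma contC_gen (G : R -> R -> R) l j : cont2 G ->
  contC (fun v : R * R => (G v.1 v.2)%:C * (gen_coef l j v.2 * cis ((l%:R - j%:R) * v.1))).
Proof.
move=> cG; apply: contCM; first exact: contC_real.
apply: contCM; first by apply: contC_gen_coef; cts.
by apply: contC_cis; cts.
Qed.

Lemma contC_section1 (h : R -> R -> R[i]) a : contC (fun v : R * R => h v.1 v.2) -> contC (h a).
Proof.
move=> [c1 c2]; have cp : continuous (fun b : R => (a, b)) by cts.
by split; [exact: (cts_comp c1 cp)|exact: (cts_comp c2 cp)].
Qed.

Lemma gen_integral_sum (G : R -> R -> R) l (x : R) : 0 < x -> cont2 G ->
  (2 * x%:C) ^+ l * cRint 0 (2 * pi) (fun a => cRint 0 pi (fun b =>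
    (G a b)%:C * zform (gen_vector x) (sin b * cos a) (sin b * sin a) (cos b) ^+ l)) =
  \sum_(j < l.*2.+1) gen_integral G l j * x%:C ^+ j.
Proof.
move=> x0 cG.
have cz : contC (fun v : R * R => (G v.1 v.2)%:C * zform (gen_vector x) (sin v.2 * cos v.1) (sin v.2 * sin v.1) (cos v.2) ^+ l).
  apply: contCM; first exact: contC_real.
  apply: contCX; apply: contCD; first apply: contCD; (apply: contCM; first exact: contC_cst); by apply: contC_real; cts.
rewrite -cRintZ; last exact: (@contC_cRint _ _ _ _ (fun a b => (G a b)%:C * zform _ (sin b * cos a) (sin b * sin a) (cos b) ^+ l) cz).
have ct j : contC (fun v : R * R => x%:C ^+ j * ((G v.1 v.2)%:C * (gen_coef l j v.2 * cis ((l%:R - j%:R) * v.1)))).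
  by apply: contCM; [exact: contC_cst|exact: contC_gen].
transitivity (cRint 0 (2 * pi) (fun a => \sum_(j < l.*2.+1) cRint 0 pi (fun b =>
    x%:C ^+ j * ((G a b)%:C * (gen_coef l j b * cis ((l%:R - j%:R) * a)))))).
  apply: eq_cRint => a _; rewrite -cRintZ; last exact: (contC_section1 (h := fun a b => (G a b)%:C * zform _ (sin b * cos a) (sin b * sin a) (cos b) ^+ l) a cz).
  rewrite -(cRint_sum 0 pi _ (h := fun j b => x%:C ^+ j * ((G a b)%:C * (gen_coef l j b * cis ((l%:R - j%:R) * a))))); last first.
    by move=> j; exact: (contC_section1 (h := fun a b => x%:C ^+ j * ((G a b)%:C * (gen_coef l j b * cis ((l%:R - j%:R) * a)))) a (ct j)).
  apply: eq_cRint => b _; rewrite mulrCA gen_vector_zform// mulr_sumr.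
  by apply: eq_bigr => j _; ring.
rewrite (cRint_sum 0 (2 * pi) _ (h := fun j a => cRint 0 pi (fun b => x%:C ^+ j * ((G a b)%:C * (gen_coef l j b * cis ((l%:R - j%:R) * a)))))); last first.
  by move=> j; exact: (@contC_cRint _ _ _ _ (fun a b => x%:C ^+ j * ((G a b)%:C * (gen_coef l j b * cis ((l%:R - j%:R) * a)))) (ct j)).
apply: eq_bigr => j _; rewrite [RHS]mulrC /gen_integral -cRintZ; last exact: (@contC_cRint _ _ _ _ (fun a b => (G a b)%:C * (gen_coef l j b * cis ((l%:R - j%:R) * a))) (contC_gen l j cG)).
apply: eq_cRint => a _; rewrite cRintZ//.
exact: (contC_section1 (h := fun a b => (G a b)%:C * (gen_coef l j b * cis ((l%:R - j%:R) * a))) a (contC_gen l j cG)).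
Qed.

(** Both sides are polynomials in x by [gen_integral_sum]; they agree for all
    x > 0, hence coefficientwise. *)
Lemma gen_integral_eq (G1 G2 : R -> R -> R) l : cont2 G1 -> cont2 G2 ->
  (forall x : R, 0 < x ->
    cRint 0 (2 * pi) (fun a => cRint 0 pi (fun b =>
      (G1 a b)%:C * zform (gen_vector x) (sin b * cos a) (sin b * sin a) (cos b) ^+ l)) =
    cRint 0 (2 * pi) (fun a => cRint 0 pi (fun b =>
      (G2 a b)%:C * zform (gen_vector x) (sin b * cos a) (sin b * sin a) (cos b) ^+ l))) ->
  forall j, (j < l.*2.+1)%N -> gen_integral G1 l j = gen_integral G2 l j.
Proof.
move=> c1 c2 G12 j jl; apply/eqP; rewrite -subr_eq0; apply/eqP.
apply: (poly_vanishing (n := l.*2.+1) (c := fun j => gen_integral G1 l j - gen_integral G2 l j)) => // x x0.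
have e1 := gen_integral_sum l x0 c1; have e2 := gen_integral_sum l x0 c2.
have e := etrans (esym e1) (etrans (congr1 _ (G12 x x0)) e2).
transitivity (\sum_(j < l.*2.+1) gen_integral G1 l j * x%:C ^+ j -
              \sum_(j < l.*2.+1) gen_integral G2 l j * x%:C ^+ j).
  by rewrite -sumrB; apply: eq_bigr => i _; rewrite mulrBl.
by apply/eqP; rewrite subr_eq0; apply/eqP; exact: e.
Qed.

Lemma conjc_cRint a b (h : R -> R[i]) : contC h ->
  conjc (cRint a b h) = cRint a b (fun x => conjc (h x)).
Proof.
move=> [c1 c2]; apply: complex_ext => /=.
  by apply: eq_cint => x _; case: (h x).
rewrite -mulN1r -cintZl//; apply: eq_cint => x _; rewrite mulN1r.
by case: (h x).
Qed.

(** The factor of the order m that the associated Legendre function and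
    [gen_coef] have in common. *)
Definition assoc_profile l m (b : R) : R :=
  sin b ^+ m * (((('X^2 - 1) ^+ l)^`(l + m)).[cos b] / ((l + m)`!)%:R).

Lemma gen_coef_profile l m b : sin b != 0 ->
  gen_coef l (l + m) b = 'i ^+ m * (assoc_profile l m b)%:C.
Proof.
move=> sb; rewrite gen_coefE// /assoc_profile exprMn !(rmorphM (real_complex R)) fmorphV /=.
by rewrite (rmorphXn (real_complex R)) (rmorph_nat (real_complex R)) !mulrA.
Qed.

Lemma assoc_legendre_profile l m (b : R) : 0 <= b <= pi ->
  assoc_legendre_nat l m (cos b) =
  (-1) ^+ m * ((2 ^+ l * l`!%:R)^-1 * ((l + m)`!)%:R) * assoc_profile l m b.
Proof.
move=> b0pi; rewrite /assoc_legendre_nat /assoc_profile /legendre.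
have -> : Num.sqrt (1 - cos b ^+ 2) = sin b.
  by rewrite -sin2cos2 sqrtr_sqr ger0_norm// sin_ge0_pi.
rewrite derivnZ hornerZ /derivn -iterD.
have f0 : ((l + m)`!)%:R != 0 :> R by rewrite pnatr_eq0 -lt0n fact_gt0.
have g0 : (l`!)%:R != 0 :> R by rewrite pnatr_eq0 -lt0n fact_gt0.
have t0 : (2 : R) ^+ l != 0 by rewrite expf_neq0// pnatr_eq0.
rewrite addnC; set D := _.[_]; rewrite addnC in f0 *.
field; rewrite ?f0 ?g0 ?t0//.
Qed.

Lemma fact_inC n : (n`!)%:R != 0 :> R[i].
Proof. by rewrite pnatr_eq0 -lt0n fact_gt0. Qed.

Lemma cis_conj (t : R) : conjc (cis t) = cis (- t).
Proof. by apply: complex_ext; rewrite /= ?cosN ?sinN. Qed.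

Lemma conjcM (x y : R[i]) : conjc (x * y) = conjc x * conjc y.
Proof. exact: rmorphM. Qed.

(** The conjugate of Y_l^m carries the phase cis (- m a), which is that of the
    index j = l + m. Negative orders follow by conjugation, as
    Y_l^(-m) is the conjugate of Y_l^m up to a sign. The constant K serves all
    f and rho, so that it need not be computed. *)
Lemma harmonic_coef_gen l (m : int) : exists K : R[i], forall (f : 'cV[R]_3 -> R) (rho : R),
  let G a b := sin b * polar_form f rho a b in
  cont2 G ->
  harmonic_coef f l m rho =
    match m with
    | Posz m' => K * gen_integral G l (l + m')
    | Negz k => K * conjc (gen_integral G l (l + k.+1))
    end.
Proof.
have i_n (n : nat) : 'i ^+ n != 0 :> R[i].
  apply: expf_neq0; apply/eqP => /(congr1 (fun x => x ^+ 2)).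
  by rewrite (sqr_i R) expr0n/= => /eqP; rewrite oppr_eq0 oner_eq0.
(* [gen_coefE] needs sin b <> 0; at the poles both sides carry a factor sin b. *)
have nonpole G (m' : nat) (b t : R) : (G b)%:C * (gen_coef l (l + m') b * cis t) * (sin b)%:C =
    ('i ^+ m' * ((sin b * G b * assoc_profile l m' b)%:C * cis t)) :> R[i].
  have [sb|sb] := eqVneq (sin b) 0; first by rewrite sb !mul0r rmorph0 !(mulr0, mul0r).
  rewrite gen_coef_profile// !(rmorphM (real_complex R)) /=; ring.
pose N := (2 ^+ l * l`!%:R)^-1 : R.
case: m => [m|k].
- pose c : R := (-1) ^+ m * Num.sqrt ((2 * l%:R + 1) * (absz (l%:Z - m%:Z))`!%:R /
               (4 * pi * (absz (l%:Z + m%:Z))`!%:R)) * ((-1) ^+ m * (N * ((l + m)`!)%:R)).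
  exists (c%:C / 'i ^+ m) => f rho G cG.
  have cg := contC_gen l (l + m) cG.
  rewrite /gen_integral -cRintZ; last exact: (@contC_cRint _ _ _ _ (fun a b => (G a b)%:C * (gen_coef l (l + m) b * cis ((l%:R - (l + m)%:R) * a))) cg).
  apply: eq_cRint => a _; rewrite -cRintZ; last first.
    exact: (contC_section1 (h := fun a b => (G a b)%:C * (gen_coef l (l + m) b * cis ((l%:R - (l + m)%:R) * a))) a cg).
  apply: eq_cRint => b bpi.
  have tE : (l%:R - (l + m)%:R) * a = - (m%:R * a) by rewrite natrD; ring.
  have np := nonpole (polar_form f rho a) m b (- (m%:R * a)).
  rewrite tE /G (rmorphM (real_complex R) (sin b)).
  transitivity (c%:C / 'i ^+ m * ((polar_form f rho a b)%:C * (gen_coef l (l + m) b * cis (- (m%:R * a))) * (sin b)%:C)); last by ring.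
  rewrite np /sph_harmonic conjcM cis_conj conjc_real /assoc_legendre assoc_legendre_profile// -/N.
  rewrite -pmulrn /c !(rmorphM (real_complex R)) /=; field.
  by rewrite i_n fact_inC.
- pose m := k.+1.
  pose c : R := (-1) ^+ m * Num.sqrt ((2 * l%:R + 1) * (absz (l%:Z - Negz k))`!%:R /
               (4 * pi * (absz (l%:Z + Negz k))`!%:R)) *
     ((-1) ^+ m * ((l - m)`!%:R / (l + m)`!%:R) * ((-1) ^+ m * (N * ((l + m)`!)%:R))).
  exists (c%:C / conjc ('i ^+ m)) => f rho G cG.
  have cg := contC_gen l (l + m) cG.
  have conj_contC (T : topologicalType) (h : T -> R[i]) : contC h -> contC (fun x => conjc (h x)).
    move=> [c1 c2]; split.
    - by rewrite (_ : (fun _ => _) = fun x => Re (h x))//; apply/funext => x; case: (h x).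
    - rewrite (_ : (fun _ => _) = fun x => - Im (h x)); first by cts.
      by apply/funext => x; case: (h x).
  rewrite /gen_integral conjc_cRint; last exact: (@contC_cRint _ _ _ _ (fun a b => (G a b)%:C * (gen_coef l (l + m) b * cis ((l%:R - (l + m)%:R) * a))) cg).
  rewrite -cRintZ; last first.
    apply: conj_contC.
    exact: (@contC_cRint _ _ _ _ (fun a b => (G a b)%:C * (gen_coef l (l + m) b * cis ((l%:R - (l + m)%:R) * a))) cg).
  have cs a := contC_section1 (h := fun a b => (G a b)%:C * (gen_coef l (l + m) b * cis ((l%:R - (l + m)%:R) * a))) a cg.
  apply: eq_cRint => a _; rewrite conjc_cRint; last exact: cs.
  rewrite -cRintZ; last by apply: conj_contC; exact: cs.
  apply: eq_cRint => b bpi.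
  have tE : (l%:R - (l + m)%:R) * a = - (m%:R * a) by rewrite natrD; ring.
  have np := nonpole (polar_form f rho a) m b (- (m%:R * a)).
  rewrite tE /G (rmorphM (real_complex R) (sin b)).
  transitivity (c%:C / conjc ('i ^+ m) * conjc ((polar_form f rho a b)%:C * (gen_coef l (l + m) b * cis (- (m%:R * a))) * (sin b)%:C)); last first.
    by congr (_ * conjc _); ring.
  rewrite np /sph_harmonic !conjcM !cis_conj !conjc_real /assoc_legendre assoc_legendre_profile// -/N.
  rewrite NegzE mulrNz -pmulrn mulNr opprK /c !(rmorphM (real_complex R)) /=; field.
  by rewrite /m ?conjc_eq0 ?i_n ?fact_inC.
Qed.

Lemma harmonic_coef_eq (f1 f2 : 'cV[R]_3 -> R) (rho : R) l :
  continuous f1 -> continuous f2 ->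
  (forall z part, isotropic z -> part = @complex.Re R \/ part = @complex.Im R ->
    sphere_int (fun x y t => isotropic_part part z l x y t * f1 (col3 (rho * x) (rho * y) (rho * t))) =
    sphere_int (fun x y t => isotropic_part part z l x y t * f2 (col3 (rho * x) (rho * y) (rho * t)))) ->
  forall m : int, (`|m| <= l)%N -> harmonic_coef f1 l m rho = harmonic_coef f2 l m rho.
Proof.
move=> c1 c2 H m ml.
pose G (f : 'cV[R]_3 -> R) a b := sin b * polar_form f rho a b.
have cG f : continuous f -> cont2 (G f).
  move=> /cont3_col3 cf; rewrite /cont2 /G /polar_form; cts.
  by apply: (cts3 cf); cts.
have Heq := gen_integral_eq (cG _ c1) (cG _ c2) (l := l).
have {}Heq j : (j < l.*2.+1)%N -> gen_integral (G f1) l j = gen_integral (G f2) l j.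
  apply: Heq => x x0; have iz := gen_vector_isotropic x0.
  have partG part f : part = @complex.Re R \/ part = @complex.Im R ->
      part (cRint 0 (2 * pi) (fun a => cRint 0 pi (fun b => (G f a b)%:C *
        zform (gen_vector x) (sin b * cos a) (sin b * sin a) (cos b) ^+ l))) =
      sphere_int (fun x' y t => isotropic_part part (gen_vector x) l x' y t *
        f (col3 (rho * x') (rho * y) (rho * t))).
    move=> partE; rewrite /sphere_int.
    transitivity (\cint_(0, 2 * pi) (fun a => \cint_(0, pi) (fun b => part ((G f a b)%:C *
        zform (gen_vector x) (sin b * cos a) (sin b * sin a) (cos b) ^+ l)))).
      by case: partE => ->.
    apply: eq_cint => a _; apply: eq_cint => b _.
    rewrite /isotropic_part /G /polar_form !mulrA.
    by case: partE => ->; rewrite ?cReM ?cImM /= mul0r ?subr0 ?addr0; ring.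
  have h part (pE : part = @complex.Re R \/ part = @complex.Im R) :=
    etrans (partG part f1 pE) (etrans (H _ _ iz pE) (esym (partG part f2 pE))).
  by apply: complex_ext; [exact: (h _ (or_introl erefl))|exact: (h _ (or_intror erefl))].
have [K KE] := harmonic_coef_gen l m.
rewrite (KE _ _ (cG _ c1)) (KE _ _ (cG _ c2)).
by case: m ml {KE} => [m|k] ml; rewrite Heq// ltnS -addnn leq_add2l.
Qed.

End harmonic_coefficients.

(** * Abel's double integral *)
Section abel.
Context {R : realType}.
Notation mu := (@lebesgue_measure R).

(** Angles that increase to pi / 2: the substitution is made on [0, xn n], where
    1 / sqrt (c^2 - x^2) is bounded, before passing to the limit. *)
Let xn (n : nat) : R := pi / 2 - (pi / 2) / n.+1%:R.

Let xnE n : 0 <= xn n < pi / 2.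
Proof.
have p2 : 0 < pi / 2 :> R by rewrite divr_gt0 ?pi_gt0.
rewrite /xn subr_ge0 ler_pdivrMr// -[leLHS]mulr1 ler_pM2l// ler1n/=.
by rewrite ltrBlDr ltrDl divr_gt0.
Qed.

Let xn_homo m n : (m <= n)%N -> xn m <= xn n.
Proof.
move=> mn; rewrite lerD2l lerN2 ler_pM2l ?divr_gt0 ?pi_gt0//.
by rewrite lef_pV2 ?posrE ?ltr0n// ler_nat.
Qed.

Let xn_lim x : x < pi / 2 -> exists n, x < xn n.
Proof.
move=> xpi; have p2 : 0 < pi / 2 :> R by rewrite divr_gt0 ?pi_gt0.
have d0 : 0 < pi / 2 - x by rewrite subr_gt0.
have [n nE] : exists n : nat, pi / 2 / (pi / 2 - x) < n.+1%:R.
  exists (Num.bound (pi / 2 / (pi / 2 - x))).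
  apply: (lt_le_trans (archi_boundP _)); first by apply: ltW; rewrite divr_gt0.
  by rewrite ler_nat.
exists n; rewrite /xn ltrBrDr -ltrBrDl ltr_pdivrMr ?ltr0n//.
by move: nE; rewrite ltr_pdivrMr// [_ * (_ - x)]mulrC.
Qed.

(** Since the integrand is nonnegative, the improper integral on the left is the
    monotone limit of integrals over [0, c sin (xn n)]. *)
Lemma substitution_sin (c : R) (h : R -> R) : 0 < c -> continuous h ->
  (forall x, 0 <= h x) ->
  (\int[mu]_(x in `[0%R, c[) (h x / Num.sqrt (c ^+ 2 - x ^+ 2))%:E)%E =
  (\cint_(0, pi / 2) (fun phi : R => h (c * sin phi)))%:E.
Proof.
move=> c0 ch h0.
have p2 : 0 < pi / 2 :> R by rewrite divr_gt0 ?pi_gt0.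
set G := fun x => h x / Num.sqrt (c ^+ 2 - x ^+ 2).
have sin_lt (x y : R) : 0 <= x -> x < y -> y <= pi / 2 -> sin x < sin y.
  move=> x0 xy yp; rewrite ltr_sin ?in_itv//=; apply/andP; split; lra.
have cG n : {within `[0, c * sin (xn n)], continuous G}.
  apply: continuous_in_subspaceT => x; rewrite inE/= in_itv/= => /andP[x0 xs].
  have [n0 np] := andP (xnE n).
  have s1 : sin (xn n) < 1 by rewrite -sin_pihalf; exact: sin_lt.
  have xc : x < c by apply: (le_lt_trans xs); rewrite gtr_pMr.
  have d0 : 0 < c ^+ 2 - x ^+ 2 by rewrite subr_gt0 ltr_pXn2r// nnegrE// ltW.
  apply: (@continuousM _ _ h (fun x => (Num.sqrt (c ^+ 2 - x ^+ 2))^-1)); first exact: ch.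
  apply: continuousV; first by rewrite gt_eqF// sqrtr_gt0.
  have cs : continuous (fun x : R => Num.sqrt (c ^+ 2 - x ^+ 2)) by cts.
  exact: cs.
have chs : continuous (fun x => h (c * sin x)) by apply: (cts_comp ch); cts.
have step n : (\int[mu]_(x in `[0%R, (c * sin (xn n))%R]) (G x)%:E)%E =
    (\int[mu]_(x in `[0%R, xn n]) (h (c * sin x))%:E)%E.
  have [n0 np] := andP (xnE n).
  pose F (x : R) := c * sin x.
  have dF (x : R) : is_derive x 1 F (c * cos x).
    by apply: is_derive_eq; rewrite /GRing.scale/=; ring.
  have F'E : (derive1 F) = fun x => c * cos x.
    by apply/funext => x; rewrite derive1E; apply: derive_val.
  have cF' : continuous (derive1 F) by rewrite F'E; cts.
  have cF : continuous F by rewrite /F; cts.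
  have := @integration_by_substitution_increasing _ F G 0 (xn n) n0.
  rewrite /F sin0 mulr0 => ->//.
  - apply: eq_integral => x; rewrite inE/= in_itv/= => /andP[x0 xn'].
    rewrite -/F F'E; congr EFin.
    rewrite -[LHS]/(h (c * sin x) / Num.sqrt (c ^+ 2 - (c * sin x) ^+ 2) * (c * cos x)).
    have cx : 0 < cos x by apply: cos_gt0_pihalf; apply/andP; split; lra.
    have -> : c ^+ 2 - (c * sin x) ^+ 2 = (c * cos x) ^+ 2.
      by rewrite !exprMn cos2sin2; ring.
    rewrite sqrtr_sqr ger0_norm; last by rewrite mulr_ge0 ?ltW.
    by rewrite mulfVK// mulf_neq0 ?gt_eqF.
  - move=> x y; rewrite !in_itv/= => /andP[x0 xp] /andP[y0 yp] xy.
    by rewrite ltr_pM2l// sin_lt// (le_trans yp (ltW np)).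
  - by apply/cvg_ex; exists ((derive1 F) 0); apply: cvg_at_right_filter; exact: cF'.
  - by apply/cvg_ex; exists ((derive1 F) (xn n)); apply: cvg_at_left_filter; exact: cF'.
  - split => //.
    + by apply: cvg_at_right_filter; exact: cF.
    + by apply: cvg_at_left_filter; exact: cF.
have nn m n : (m <= n)%N -> sin (xn m) <= sin (xn n).
  move=> mn; have [m0 mp] := andP (xnE m); have [n0 np] := andP (xnE n).
  have := xn_homo mn; rewrite le_eqVlt => /predU1P[->//|mn'].
  by apply: ltW; apply: sin_lt => //; exact: ltW.
have lim1 : (\int[mu]_(x in `[0%R, (c * sin (xn n))%R]) (G x)%:E)%E @[n --> \oo] -->
    (\int[mu]_(x in `[0%R, c[) (G x)%:E)%E.
  rewrite (_ : `[0%R, c[%classic = \bigcup_n `[0%R, (c * sin (xn n))%R]%classic); last first.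
    apply/seteqP; split => x /=.
      rewrite in_itv/= => /andP[x0 xc].
      have xc1 : 0 <= x / c < 1 by rewrite ltr_pdivrMr// mul1r xc divr_ge0// ltW.
      have [n nE] : exists n, asin (x / c) < xn n by apply: xn_lim; rewrite asin_ltpi2//; lra.
      exists n => //=; rewrite in_itv/= x0/= -ler_pdivrMl// mulrC.
      have [n0 np] := andP (xnE n).
      have xcI : -1 <= x / c <= 1 by lra.
      rewrite -[leLHS]asinK ?in_itv//= ltW// ltr_sin ?in_itv//=; last by lra.
      by rewrite asin_geNpi2 ?asin_lepi2.
    case=> n _ /=; rewrite !in_itv/= => /andP[x0 xs]; rewrite x0/=.
    have [n0 np] := andP (xnE n).
    by apply: (le_lt_trans xs); rewrite gtr_pMr// -sin_pihalf; exact: sin_lt.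
  apply: ge0_nondecreasing_set_cvg_integral => //.
  - apply/nondecreasing_seqP => n; rewrite subsetEset => x /=; rewrite !in_itv/= => /andP[-> xs].
    by apply: (le_trans xs); rewrite ler_pM2l// nn.
  - by move=> n; apply/measurable_EFinP; apply: subspace_continuous_measurable_fun.
  - by move=> n x _; rewrite lee_fin /G mulr_ge0// invr_ge0 sqrtr_ge0.
have lim2 : (\int[mu]_(x in `[0%R, xn n]) (h (c * sin x))%:E)%E @[n --> \oo] -->
    (\int[mu]_(x in `[0%R, (pi / 2)%R[) (h (c * sin x))%:E)%E.
  rewrite (_ : `[0%R, (pi / 2)%R[%classic = \bigcup_n `[0%R, xn n]%classic); last first.
    apply/seteqP; split => x /=.
      rewrite in_itv/= => /andP[x0 xc]; have [n xn'] := xn_lim xc.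
      by exists n => //=; rewrite in_itv/= x0 ltW.
    case=> n _ /=; rewrite !in_itv/= => /andP[-> xs]/=.
    by have [n0 np] := andP (xnE n); exact: le_lt_trans np.
  apply: ge0_nondecreasing_set_cvg_integral => //.
  - apply/nondecreasing_seqP => n; rewrite subsetEset => x /=; rewrite !in_itv/= => /andP[-> xs].
    by apply: (le_trans xs); exact: xn_homo.
  - move=> n; apply/measurable_EFinP; apply: measurable_funTS.
    exact: continuous_measurable_fun.
  - by move=> n x _; rewrite lee_fin h0.
have {}lim2 : (\int[mu]_(x in `[0%R, (c * sin (xn n))%R]) (G x)%:E)%E @[n --> \oo] -->
    (\int[mu]_(x in `[0%R, (pi / 2)%R[) (h (c * sin x))%:E)%E.
  by under eq_fun do rewrite step.
have -> := cvg_unique (@ereal_hausdorff R) lim1 lim2.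
rewrite EFin_cint// integral_itv_bndo_bndc//.
by apply/measurable_EFinP; apply: measurable_funTS; exact: continuous_measurable_fun.
Qed.

(** Both sides are the integral of
    Phi (sqrt (t^2 - z^2), s) / sqrt (t^2 - z^2 - s^2) over the quarter of disc
    z, s >= 0, z^2 + s^2 < t^2, computed by Tonelli's theorem in the two orders
    with s = sqrt (t^2 - z^2) sin phi in one case and
    z = sqrt (t^2 - s^2) sin phi in the other. *)
Lemma abel_swap_ge0 (Phi : R -> R -> R) (t : R) : cont2 Phi -> (forall x y, 0 <= Phi x y) -> 0 < t ->
  \cint_(0, t) (fun z : R => \cint_(0, pi / 2) (fun phi : R =>
    Phi (Num.sqrt (t ^+ 2 - z ^+ 2)) (Num.sqrt (t ^+ 2 - z ^+ 2) * sin phi))) =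
  \cint_(0, t) (fun s : R => \cint_(0, pi / 2) (fun phi : R =>
    Phi (Num.sqrt (t ^+ 2 - (t ^+ 2 - s ^+ 2) * sin phi ^+ 2)) s)).
Proof.
move=> cPhi Phi0 t0.
pose D : set (R * R) := (`[0%R, +oo[%classic `*` `[0%R, +oo[%classic) `&` [set v | v.1 ^+ 2 + v.2 ^+ 2 < t ^+ 2].
pose k (v : R * R) : R := Phi (Num.sqrt (t ^+ 2 - v.1 ^+ 2)) v.2 *
  ((t ^+ 2 - v.1 ^+ 2 - v.2 ^+ 2) `^ (- 2^-1) * \1_D v).
have mD : measurable D.
  apply: measurableI; first by apply: measurableX; exact: measurable_itv.
  apply: open_measurable2.
  have cf : continuous (fun v : R * R => v.1 ^+ 2 + v.2 ^+ 2) by cts.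
  by have /continuousP/(_ `]-oo, (t ^+ 2)[%classic (@interval_open _ _ _ _ _)) := cf; rewrite set_itvE; apply.
have mk : measurable_fun setT k.
  apply: measurable_funM.
    by apply: cts_measurable2; apply: (cts2 cPhi); cts.
  apply: measurable_funM; last by apply: measurable_indic.
  apply: (measurableT_comp (measurable_powR (- 2^-1)) (_ : measurable_fun setT (fun v : R * R => t ^+ 2 - v.1 ^+ 2 - v.2 ^+ 2))).
  by apply: cts_measurable2; cts.
have k0 v : 0 <= k v.
  by rewrite /k mulr_ge0// mulr_ge0 ?powR_ge0//.
have DE (x y : R) : (x, y) \in D = [&& 0 <= x, 0 <= y & x ^+ 2 + y ^+ 2 < t ^+ 2].
  apply/idP/idP; rewrite in_setE /D/= !in_itv/= !andbT.
    by move=> [[-> ->] ->].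
  by move=> /and3P[-> -> ->].
have powE (y c : R) : y ^+ 2 < c ^+ 2 -> (c ^+ 2 - y ^+ 2) `^ (- 2^-1) = (Num.sqrt (c ^+ 2 - y ^+ 2))^-1.
  by move=> yc; rewrite powRN powR12_sqrt// subr_ge0 ltW.
have sqrtK (x : R) : 0 <= x -> x < t -> 0 < Num.sqrt (t ^+ 2 - x ^+ 2) /\ Num.sqrt (t ^+ 2 - x ^+ 2) ^+ 2 = t ^+ 2 - x ^+ 2.
  move=> x0 xt; have h : 0 < t ^+ 2 - x ^+ 2 by rewrite subr_gt0 ltr_pXn2r// nnegrE// ltW.
  by rewrite sqrtr_gt0 h sqr_sqrtr ?ltW.
have memD (x y : R) : 0 <= x -> x < t ->
    (y \in `[0%R, Num.sqrt (t ^+ 2 - x ^+ 2)[%classic) = (0 <= y) && (x ^+ 2 + y ^+ 2 < t ^+ 2).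
  move=> x0 xt; have [c0 c2] := sqrtK x x0 xt.
  apply/idP/idP; rewrite in_setE /= in_itv/= => /andP[y0 H]; rewrite y0/=.
    rewrite -ltrBrDl -c2 ltr_pXn2r// nnegrE// ltW//.
  by rewrite -(@ltr_pXn2r _ 2)// ?nnegrE ?ltW// c2 ltrBrDl.
have mem_itv (x : R) : (x \in `[0%R, t[%classic) = (0 <= x < t).
  by apply/idP/idP; rewrite in_setE /= in_itv.
have inner1 x : (\int[mu]_y (k (x, y))%:E)%E = ((fun x : R => (\cint_(0, pi / 2) (fun phi : R =>
    Phi (Num.sqrt (t ^+ 2 - x ^+ 2)) (Num.sqrt (t ^+ 2 - x ^+ 2) * sin phi)))%:E) \_ `[0%R, t[) x.
  rewrite patchE mem_itv; case: ifPn; last first.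
    move=> xt; rewrite integral0_eq// => y _; rewrite /k indicE DE.
    case: and3P => [[x0 y0 xyt]|_]; last by rewrite !mulr0.
    case/negP: xt; rewrite x0/=; rewrite -(@ltr_pXn2r _ 2)// ?nnegrE// ?ltW//.
    by apply: le_lt_trans xyt; rewrite lerDl sqr_ge0.
  move=> /andP[x0 xt]; have [c0 c2] := sqrtK x x0 xt.
  rewrite -(@substitution_sin (Num.sqrt (t ^+ 2 - x ^+ 2)) (fun y => Phi (Num.sqrt (t ^+ 2 - x ^+ 2)) y))//; last first.
    by apply: (cts2 cPhi); cts.
  rewrite [RHS]integral_mkcond; apply: eq_integral => y _.
  rewrite patchE memD// /k indicE DE x0/=; case: ifPn => [/andP[y0 xy]|]; last by rewrite !mulr0.
  have yc : y ^+ 2 < Num.sqrt (t ^+ 2 - x ^+ 2) ^+ 2 by rewrite c2 ltrBrDl.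
  by rewrite mulr1 -(powE _ _ yc) c2.
have inner2 y : (\int[mu]_x (k (x, y))%:E)%E = ((fun s : R => (\cint_(0, pi / 2) (fun phi : R =>
    Phi (Num.sqrt (t ^+ 2 - (t ^+ 2 - s ^+ 2) * sin phi ^+ 2)) s))%:E) \_ `[0%R, t[) y.
  rewrite patchE mem_itv; case: ifPn; last first.
    move=> yt; rewrite integral0_eq// => x _; rewrite /k indicE DE.
    case: and3P => [[x0 y0 xyt]|_]; last by rewrite !mulr0.
    case/negP: yt; rewrite y0/=; rewrite -(@ltr_pXn2r _ 2)// ?nnegrE// ?ltW//.
    by apply: le_lt_trans xyt; rewrite lerDr sqr_ge0.
  move=> /andP[y0 yt]; have [c0 c2] := sqrtK y y0 yt.
  transitivity ((\cint_(0, pi / 2) (fun phi : R =>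
     Phi (Num.sqrt (t ^+ 2 - (Num.sqrt (t ^+ 2 - y ^+ 2) * sin phi) ^+ 2)) y))%:E : \bar R); last first.
    by congr EFin; apply: eq_cint => phi _; rewrite exprMn c2.
  rewrite -(@substitution_sin (Num.sqrt (t ^+ 2 - y ^+ 2)) (fun x => Phi (Num.sqrt (t ^+ 2 - x ^+ 2)) y))//; last first.
    by apply: (cts2 cPhi); cts.
  rewrite [RHS]integral_mkcond; apply: eq_integral => x _.
  rewrite patchE memD// /k indicE DE y0/= [x ^+ 2 + y ^+ 2]addrC; case: ifPn => [/andP[x0 xy]|]; last by rewrite !mulr0.
  have xc : x ^+ 2 < Num.sqrt (t ^+ 2 - y ^+ 2) ^+ 2 by rewrite c2 ltrBrDl.
  by rewrite mulr1 addrAC -(powE _ _ xc) c2.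
have := @fubini_tonelli _ _ _ _ _ mu mu (EFin \o k) _ _.
move=> /(_ _ _)/wrap[||H].
- exact/measurable_EFinP.
- by move=> v; rewrite lee_fin.
have {H} : (\int[mu]_x \int[mu]_y (k (x, y))%:E = \int[mu]_y \int[mu]_x (k (x, y))%:E)%E := H.
under eq_integral do rewrite inner1.
under [in X in _ = X -> _]eq_integral do rewrite inner2.
rewrite -!integral_mkcond.
have c1 : continuous (fun z : R => \cint_(0, pi / 2) (fun phi : R =>
    Phi (Num.sqrt (t ^+ 2 - z ^+ 2)) (Num.sqrt (t ^+ 2 - z ^+ 2) * sin phi))).
  apply: (@continuous_cint R _ (fun z phi : R => Phi (Num.sqrt (t ^+ 2 - z ^+ 2)) (Num.sqrt (t ^+ 2 - z ^+ 2) * sin phi))).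
  by apply: (cts2 cPhi); cts.
have c2 : continuous (fun s : R => \cint_(0, pi / 2) (fun phi : R =>
    Phi (Num.sqrt (t ^+ 2 - (t ^+ 2 - s ^+ 2) * sin phi ^+ 2)) s)).
  apply: (@continuous_cint R _ (fun s phi : R => Phi (Num.sqrt (t ^+ 2 - (t ^+ 2 - s ^+ 2) * sin phi ^+ 2)) s)).
  by apply: (cts2 cPhi); cts.
rewrite !integral_itv_bndo_bndc; last 2 first.
- by apply/measurable_EFinP; apply: measurable_funTS; exact: continuous_measurable_fun.
- by apply/measurable_EFinP; apply: measurable_funTS; exact: continuous_measurable_fun.
by rewrite /Rintegral => ->.
Qed.

(** The positive and negative parts of Phi are still continuous. *)
Lemma abel_swap (Phi : R -> R -> R) (t : R) : cont2 Phi -> 0 < t ->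
  \cint_(0, t) (fun z : R => \cint_(0, pi / 2) (fun phi : R =>
    Phi (Num.sqrt (t ^+ 2 - z ^+ 2)) (Num.sqrt (t ^+ 2 - z ^+ 2) * sin phi))) =
  \cint_(0, t) (fun s : R => \cint_(0, pi / 2) (fun phi : R =>
    Phi (Num.sqrt (t ^+ 2 - (t ^+ 2 - s ^+ 2) * sin phi ^+ 2)) s)).
Proof.
move=> cPhi t0.
pose P1 x y := Num.max (Phi x y) 0; pose P2 x y := Num.max (- Phi x y) 0.
have cP1 : cont2 P1 by rewrite /cont2 /P1; rewrite /cont2 in cPhi; cts.
have cP2 : cont2 P2 by rewrite /cont2 /P2; rewrite /cont2 in cPhi; cts.
have PE x y : Phi x y = P1 x y - P2 x y.
  by rewrite /P1 /P2 /Num.max; case: ltP => h1; case: ltP => h2; lra.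
have P10 x y : 0 <= P1 x y by rewrite /P1 le_max lexx orbT.
have P20 x y : 0 <= P2 x y by rewrite /P2 le_max lexx orbT.
have h1 := abel_swap_ge0 cP1 P10 t0.
have h2 := abel_swap_ge0 cP2 P20 t0.
have split_int (u v : R -> R -> R) : cont2 u -> cont2 v ->
   \cint_(0, t) (fun z : R => \cint_(0, pi / 2) (fun phi : R => Phi (u z phi) (v z phi))) =
   \cint_(0, t) (fun z : R => \cint_(0, pi / 2) (fun phi : R => P1 (u z phi) (v z phi))) -
   \cint_(0, t) (fun z : R => \cint_(0, pi / 2) (fun phi : R => P2 (u z phi) (v z phi))).
  move=> cu cv.
  have c1 : cont2 (fun z phi : R => P1 (u z phi) (v z phi)) by apply: (cts2 cP1).
  have c2 : cont2 (fun z phi : R => P2 (u z phi) (v z phi)) by apply: (cts2 cP2).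
  rewrite -cintB; last 2 first.
  - exact: (@continuous_cint R _ (fun z phi : R => P1 (u z phi) (v z phi))).
  - exact: (@continuous_cint R _ (fun z phi : R => P2 (u z phi) (v z phi))).
  apply: eq_cint => z _; rewrite -cintB; last 2 first.
  - by apply: (cts2 c1); cts.
  - by apply: (cts2 c2); cts.
  by apply: eq_cint => phi _; exact: PE.
rewrite (split_int (fun z phi : R => Num.sqrt (t ^+ 2 - z ^+ 2)) (fun z phi : R => Num.sqrt (t ^+ 2 - z ^+ 2) * sin phi)); [|rewrite /cont2; cts..].
rewrite (split_int (fun s phi : R => Num.sqrt (t ^+ 2 - (t ^+ 2 - s ^+ 2) * sin phi ^+ 2)) (fun s phi : R => s)); [|rewrite /cont2; cts..].
exact: (congr2 (fun x y => x - y) h1 h2).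
Qed.

End abel.

(** * Uniqueness for an Abel-type equation *)
Section abel_uniqueness.
Context {R : realType}.

(** The radius r at which [abel_swap] evaluates the kernel: it describes the arc
    from r = t (phi = 0) to r = s (phi = pi / 2). *)
Definition arc_radius (t s phi : R) := Num.sqrt (t ^+ 2 - (t ^+ 2 - s ^+ 2) * sin phi ^+ 2).

Lemma arc_radius_sq t s phi : 0 <= t -> 0 <= s ->
  arc_radius t s phi ^+ 2 = t ^+ 2 * cos phi ^+ 2 + s ^+ 2 * sin phi ^+ 2.
Proof.
move=> t0 s0; rewrite /arc_radius sqr_sqrtr; first by rewrite cos2sin2; ring.
rewrite (_ : _ - _ = t ^+ 2 * cos phi ^+ 2 + s ^+ 2 * sin phi ^+ 2); last by rewrite cos2sin2; ring.
by rewrite addr_ge0// mulr_ge0// sqr_ge0.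
Qed.

Lemma arc_radius_ge0 t s phi : 0 <= arc_radius t s phi.
Proof. exact: sqrtr_ge0. Qed.

Lemma arc_radius_itv t s phi : 0 <= s -> s <= t -> s <= arc_radius t s phi <= t.
Proof.
move=> s0 st; have t0 : 0 <= t by apply: le_trans st.
have r0 := arc_radius_ge0 t s phi; have r2 := arc_radius_sq phi t0 s0; have h := cos2Dsin2 phi.
have st2 : s ^+ 2 <= t ^+ 2 by rewrite ler_pXn2r// nnegrE.
have [c0 d0] := (sqr_ge0 (cos phi), sqr_ge0 (sin phi)).
by apply/andP; split; rewrite -(@ler_pXn2r _ 2)// ?nnegrE// r2; nra.
Qed.

(** By [arc_radius_sq], arc_radius is the Euclidean norm of
    (t cos phi, s sin phi), and t moves that vector by at most its own change. *)
Lemma arc_radius_lip t t' s phi : 0 <= s -> 0 <= t -> t <= t' ->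
  `|arc_radius t' s phi - arc_radius t s phi| <= t' - t.
Proof.
move=> s0 t0 tt'; have t'0 : 0 <= t' by apply: le_trans tt'.
have r0 := arc_radius_ge0 t s phi; have r2 := arc_radius_sq phi t0 s0; have h := cos2Dsin2 phi.
have r'0 := arc_radius_ge0 t' s phi; have r'2 := arc_radius_sq phi t'0 s0.
have [c0 d0] := (sqr_ge0 (cos phi), sqr_ge0 (sin phi)).
move: (arc_radius t s phi) (arc_radius t' s phi) r0 r2 r'0 r'2 => r r' r0 r2 r'0 r'2.
move: (cos phi ^+ 2) (sin phi ^+ 2) h c0 d0 r2 r'2 => c d h c0 d0 r2 r'2.
have tt2 : t ^+ 2 <= t' ^+ 2 by rewrite ler_pXn2r// nnegrE.
have rr : r <= r' by rewrite -(@ler_pXn2r _ 2)// ?nnegrE// r2 r'2; nra.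
have tcr : t * c <= r.
  rewrite -(@ler_pXn2r _ 2)// ?nnegrE ?mulr_ge0// r2 exprMn.
  have : c ^+ 2 <= c by rewrite expr2; nra.
  have := sqr_ge0 s; have := sqr_ge0 t; nra.
have dr : 0 <= t' - t + r by lra.
rewrite ger0_norm ?subr_ge0// lerBlDr -(@ler_pXn2r _ 2)// ?nnegrE//.
rewrite r'2.
have -> : (t' - t + r) ^+ 2 = (t' - t) ^+ 2 + 2 * (t' - t) * r + r ^+ 2 by ring.
have -> : t' ^+ 2 * c = (t' - t) ^+ 2 * c + 2 * (t' - t) * (t * c) + t ^+ 2 * c by ring.
rewrite r2.
have d1 : 0 <= t' - t by rewrite subr_ge0.
have c1 : c <= 1 by lra.
have := sqr_ge0 (t' - t); nra.
Qed.

Variables (K : R -> R -> R) (u : R -> R) (s0 b C kappa : R).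
Hypotheses (s0_gt0 : 0 < s0) (s0b : s0 < b) (C_ge0 : 0 <= C) (kappa_gt0 : 0 < kappa).
Hypotheses (cK : cont2 K) (cu : continuous u).
Hypothesis K_lip : forall s r r' : R, s0 <= s -> s <= r -> r <= r' -> r' <= b ->
  `|K r' s - K r s| <= C * (r' - r).
Hypothesis K_diag : forall s : R, s0 <= s <= b -> kappa <= `|K s s|.
Hypothesis u0 : forall s : R, 0 <= s <= s0 -> u s = 0.
Hypothesis abel_eq : forall r : R, 0 <= r <= b ->
  \cint_(0, pi / 2) (fun phi => K r (r * sin phi) * u (r * sin phi)) = 0.

(** The kernel of the Volterra equation of the first kind that results from
    integrating the Abel equation. *)
Let L t s := \cint_(0, pi / 2) (fun phi => K (arc_radius t s phi) s).

Let pi2_ge0 : 0 <= pi / 2 :> R. Proof. by rewrite divr_ge0 ?pi_ge0. Qed.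

Let cont_arc (T : topologicalType) (f g h : T -> R) : continuous f -> continuous g -> continuous h ->
  continuous (fun v => arc_radius (f v) (g v) (h v)).
Proof. by move=> cf cg ch; rewrite /arc_radius; cts. Qed.

Let cL : cont2 L.
Proof.
apply: (@continuous_cint R _ (fun v phi => K (arc_radius v.1 v.2 phi) v.2)).
by apply: (cts2 cK); cts; apply: cont_arc; cts.
Qed.

Let cLs t : continuous (L t).
Proof. by apply: (cts2 cL); cts. Qed.

(** [abel_swap] for K(r, s) u(s): on its left-hand side every inner integral is
    one of the given equations, at r = sqrt (t^2 - z^2) <= t. *)
Let L_int t : s0 <= t <= b -> \cint_(s0, t) (fun s => L t s * u s) = 0.
Proof.
move=> /andP[st tb]; have t0 : 0 < t by apply: lt_le_trans st.
have cKu : cont2 (fun r s => K r s * u s).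
  by rewrite /cont2; cts; apply: (cts_comp cu); cts.
have cLu : continuous (fun s => L t s * u s) by apply: ctsM; [exact: cLs|exact: cu].
have := abel_swap cKu t0.
have -> : \cint_(0, t) (fun z : R => \cint_(0, pi / 2) (fun phi : R =>
    K (Num.sqrt (t ^+ 2 - z ^+ 2)) (Num.sqrt (t ^+ 2 - z ^+ 2) * sin phi) *
    u (Num.sqrt (t ^+ 2 - z ^+ 2) * sin phi))) = 0.
  rewrite -[RHS](cint0 0 t); apply: eq_cint => z /andP[z0 zt]; apply: abel_eq.
  rewrite sqrtr_ge0/=; apply: le_trans tb.
  by rewrite -[leRHS](ger0_norm (ltW t0)) -sqrtr_sqr ler_wsqrtr// lerBlDr lerDl sqr_ge0.
move=> /esym H.
have : \cint_(0, t) (fun s => L t s * u s) = 0.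
  rewrite -[RHS]H; apply: eq_cint => s _.
  rewrite /L mulrC -cintZl; last by apply: (cts2 cK); cts; apply: cont_arc; cts.
  by apply: eq_cint => phi _; rewrite mulrC.
rewrite (@cint_chasles _ _ 0 s0 t)//; last exact: ltW.
rewrite (_ : \cint_(0, s0) _ = 0) ?add0r//.
by rewrite -[RHS](cint0 0 s0); apply: eq_cint => s ss; rewrite u0// mulr0.
Qed.

Let L_lip s t t' : s0 <= s -> s <= t -> t <= t' -> t' <= b ->
  `|L t' s - L t s| <= (pi / 2) * C * (t' - t).
Proof.
move=> ss st tt' tb; have s_ge0 : 0 <= s by apply: le_trans ss; exact: ltW.
have cKs v : continuous (fun phi => K (arc_radius v s phi) s).
  by apply: (cts2 cK); cts; apply: cont_arc; cts.
rewrite /L -cintB//.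
apply: (le_trans (norm_cint_le (M := C * (t' - t)) pi2_ge0 _ _)).
- by have := cKs t; have := cKs t' => c1 c2; cts.
- move=> phi _.
  have t0 : 0 <= t by apply: le_trans st.
  have [h1 h2] := andP (arc_radius_itv phi s_ge0 st).
  have [h3 h4] := andP (arc_radius_itv phi s_ge0 (le_trans st tt')).
  have lip := arc_radius_lip phi s_ge0 t0 tt'.
  have [rr|rr] := leP (arc_radius t s phi) (arc_radius t' s phi).
    apply: (le_trans (K_lip ss h1 rr (le_trans h4 tb))).
    by rewrite ler_wpM2l//; apply: le_trans lip; exact: ler_norm.
  rewrite distrC; apply: (le_trans (K_lip ss h3 (ltW rr) _)).
    by apply: le_trans tb; apply: le_trans tt'.
  by rewrite ler_wpM2l//; apply: le_trans lip; rewrite distrC; exact: ler_norm.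
by rewrite subr0; lra.
Qed.

Let L_diag (s : R) : 0 <= s -> L s s = pi / 2 * K s s.
Proof.
move=> ss; rewrite /L (eq_cint (g := fun=> K s s)) ?cint_cst// ?subr0 1?mulrC//.
by move=> phi _; rewrite /arc_radius subrr mul0r subr0 sqrtr_sqr ger0_norm.
Qed.

(** Let M = |u (t1)| be the maximum of |u| on [s0, s0 + eta]. Subtracting the
    Volterra equations at t1 and at t2 > t1, dividing by t2 - t1 and letting t2
    tend to t1 gives |L (t1, t1) u (t1)| <= (pi / 2) C eta M, where C is the
    Lipschitz constant of K. As |L (t1, t1)| >= (pi / 2) kappa, this forces
    M = 0 as soon as C eta < kappa. *)
Lemma abel_uniqueness : exists2 eta : R, 0 < eta &
  forall s : R, s0 <= s <= s0 + eta -> u s = 0.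
Proof.
(* eta < b - s0 leaves room for t2 <= b; C + 1 avoids a division by zero. *)
pose eta := Num.min ((b - s0) / 2) (kappa / (2 * (C + 1))).
have C1 : 0 < C + 1 by rewrite ltr_wpDl.
have eta0 : 0 < eta.
  by rewrite lt_min; apply/andP; split; rewrite divr_gt0// ?mulr_gt0// subr_gt0.
have eta1 : s0 + eta < b.
  have : eta <= (b - s0) / 2 by rewrite ge_min lexx.
  lra.
have eta2 : C * eta < kappa.
  have h : eta <= kappa / (2 * (C + 1)) by rewrite ge_min lexx orbT.
  move: h; rewrite ler_pdivlMr ?mulr_gt0// => h.
  have p : 0 <= C * eta by rewrite mulr_ge0// ltW.
  by lra.
exists eta => //.
have seta : s0 <= s0 + eta by lra.
have cabsu : continuous (fun s => `|u s|) by cts.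
have [t1 t1I t1max] := EVT_max seta (continuous_subspaceT cabsu).
move: t1I; rewrite in_itv/= => /andP[st1 t1e].
set M := `|u t1| in t1max.
suff M0 : M <= 0.
  move=> s sI; apply/normr0_eq0/le_anti; rewrite normr_ge0 andbT.
  by apply: le_trans M0; apply: t1max; rewrite in_itv.
have t1b : t1 < b by apply: le_lt_trans eta1.
have t1_ge0 : 0 <= t1 by apply: le_trans st1; exact: ltW.
have key : `|u t1 * L t1 t1| <= M * (pi / 2 * C * eta).
  apply/ler_addgt0Pl => e e0.
  have cq : continuous (fun v : R * R => L v.1 v.2 * u v.2).
    by cts; apply: (cts_comp cu); cts.
  have /cvgrPdist_le/(_ _ e0) := cq (t1, t1).
  case=> -[U V] /= [/nbhs_ballP[d1 /= d10 d1U] /nbhs_ballP[d2 /= d20 d2V]] UV.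
  pose d := Num.min d1 d2.
  have d0 : 0 < d by rewrite lt_min d10.
  pose t2 : R := Num.min (t1 + d / 2) b.
  have t12 : t1 < t2 by rewrite lt_min t1b andbT; lra.
  have t2b : t2 <= b by rewrite ge_min lexx orbT.
  have t2d : t2 <= t1 + d / 2 by rewrite ge_min lexx.
  have dd1 : d <= d1 by rewrite ge_min lexx.
  have dd2 : d <= d2 by rewrite ge_min lexx orbT.
  have near (s : R) : t1 <= s <= t2 -> `|L t1 t1 * u t1 - L t2 s * u s| <= e.
    move=> /andP[s1 s2]; apply: (UV (t2, s)); split => /=.
      by apply: d1U; rewrite /ball/= distrC ger0_norm; lra.
    by apply: d2V; rewrite /ball/= distrC ger0_norm; lra.
  have cLu (t : R) : continuous (fun s => L t s * u s) by apply: ctsM; [exact: cLs|exact: cu].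
  (* The difference of the Volterra equations at t2 and t1. *)
  have I2 : \cint_(t1, t2) (fun s => L t2 s * u s) =
      - \cint_(s0, t1) (fun s => (L t2 s - L t1 s) * u s).
    have := @L_int t2 _; rewrite (@cint_chasles _ _ s0 t1 t2)//; last exact: ltW.
    rewrite t2b (le_trans st1 (ltW t12)) => /(_ isT) H2.
    have := @L_int t1 _; rewrite st1 (ltW t1b) => /(_ isT) H1.
    rewrite [in RHS](eq_cint (g := fun s => L t2 s * u s - L t1 s * u s)); last by move=> s _; rewrite mulrBl.
    rewrite cintB// H1 subr0; apply/eqP; rewrite -addr_eq0 addrC; exact/eqP.
  have B2 : `|\cint_(t1, t2) (fun s => L t2 s * u s)| <= M * (pi / 2 * C * eta) * (t2 - t1).
    rewrite I2 normrN.
    apply: (le_trans (norm_cint_le (M := pi / 2 * C * (t2 - t1) * M) st1 _ _)).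
    - by have h1 : continuous (L t1) by []; have h2 : continuous (L t2) by []; cts.
    - move=> s /andP[ss st]; rewrite normrM ler_pM//.
        by apply: L_lip => //; exact: ltW.
      by apply: t1max; rewrite in_itv/= ss (le_trans st).
    have M_ge0 : 0 <= M by rewrite normr_ge0.
    have p2 : 0 <= pi / 2 * C by rewrite mulr_ge0.
    have h : t1 - s0 <= eta by lra.
    have q0 : 0 <= M * (pi / 2 * C) * (t2 - t1) by apply: mulr_ge0; [exact: mulr_ge0|rewrite subr_ge0 ltW].
    have := ler_wpM2l q0 h; lra.
  have B1 : `|\cint_(t1, t2) (fun s => L t1 t1 * u t1 - L t2 s * u s)| <= e * (t2 - t1).
    apply: norm_cint_le => //; first exact: ltW.
    by apply: ctsD; [exact: cts_cst|apply: ctsN; exact: cLu].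
  rewrite -(@ler_pM2r _ (t2 - t1)) ?subr_gt0// mulrDl.
  have t12' : 0 <= t2 - t1 by rewrite subr_ge0 ltW.
  rewrite -{1}(ger0_norm t12') -normrM.
  have -> : u t1 * L t1 t1 * (t2 - t1) = \cint_(t1, t2) (fun s => L t1 t1 * u t1 - L t2 s * u s) +
      \cint_(t1, t2) (fun s => L t2 s * u s).
    rewrite cintB//; last by cts.
    by rewrite subrK cint_cst; [rewrite [u t1 * _]mulrC|exact: ltW].
  by apply: (le_trans (ler_normD _ _)); exact: lerD.
have p0 : 0 < pi / 2 :> R by rewrite divr_gt0 ?pi_gt0.
move: key; rewrite L_diag// (normrM (u t1)) (normrM (pi / 2)) (ger0_norm pi2_ge0) -/M.
have kd : kappa <= `|K t1 t1| by apply: K_diag; rewrite st1 ltW.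
move=> key; rewrite leNgt; apply/negP => M0; move: key; rewrite leNgt => /negP; apply.
rewrite (_ : M * (pi / 2 * C * eta) = M * (pi / 2 * (C * eta))); last by ring.
rewrite ltr_pM2l// ltr_pM2l//.
exact: lt_le_trans kd.
Qed.

End abel_uniqueness.

(** * Clamped variables and relative derivatives *)
Section clamped_variables.
Context {R : realType}.

(** Continuity within D is all that is known of p, its derivative and the
    weight; composed with a continuous map into D, it becomes plain continuity. *)
Lemma cts_within (T X Y : topologicalType) (D : set X) (F : X -> Y) (h : T -> X) :
  {within D, continuous F} -> continuous h -> (forall t, D (h t)) ->
  continuous (fun t => F (h t)).
Proof.
move=> /subspace_continuousP cF ch Dh t B /= nB.
have H : nbhs (h t) [set x | D x -> B (F x)] := cF (h t) (Dh t) B nB.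
have H2 : nbhs t [set t' | D (h t') -> B (F (h t'))] := ch t _ H.
suff : nbhs t [set t' | B (F (h t'))] by [].
by apply: filterS H2 => t' /=; apply; exact: Dh.
Qed.

Lemma ctsV (T : topologicalType) (f : T -> R) : continuous f -> (forall t, f t != 0) ->
  continuous (fun t => (f t)^-1).
Proof. by move=> cf f0 t; apply: continuousV => //; exact: cf. Qed.

(** Extends a function on [a, b] to a continuous one on the line, to which the
    theory of continuous integrands applies. *)
Definition clamp (a b x : R) := Num.max a (Num.min b x).

Lemma clamp_itv a b x : a <= b -> a <= clamp a b x <= b.
Proof. by move=> ab; rewrite /clamp le_max lexx ge_max ab ge_min lexx orTb. Qed.

Lemma clamp_id a b x : a <= x <= b -> clamp a b x = x.
Proof. by move=> /andP[ax xb]; rewrite /clamp (min_idPr xb) (max_idPr ax). Qed.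

Lemma cts_clamp (T : topologicalType) (a b : R) (f : T -> R) : continuous f ->
  continuous (fun t => clamp a b (f t)).
Proof. by move=> cf; rewrite /clamp; cts. Qed.

Lemma is_derive_within_interior (D : set R) (f : R -> R) (x l : R) :
  nbhs x D -> is_derive_within D f x l -> is_derive x 1 f l.
Proof.
move=> nD; rewrite /is_derive_within => H; apply/is_derive_cvgP.
apply: (cvg_trans _ H) => B [d /= d0 dB].
have [d' /= d'0 d'D] := nD.
exists (Num.min d d') => /=; first by rewrite lt_min d0.
move=> h /=; rewrite /ball /= sub0r normrN lt_min => /andP[hd hd'] h0.
have := dB (h + x); rewrite /ball/= opprD addrCA subrr addr0 normrN => /(_ hd).
rewrite addrK [h^-1 * _]mulrC; apply; split.
  by apply: d'D; rewrite /ball /= opprD addrCA subrr addr0 normrN.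
by move=> /= /eqP; rewrite -subr_eq0 addrK (negbTE h0).
Qed.

Lemma inf_closure (S : set R) : S !=set0 -> has_lbound S -> closure S (inf S).
Proof.
move=> S0 Sl B [d /= d0 dB].
have [z Sz zd] := inf_adherent d0 (conj S0 Sl).
exists z; split => //; apply: dB; rewrite /ball /= distrC ger0_norm.
  by rewrite ltrBlDl.
by rewrite subr_ge0; apply: ge_inf.
Qed.

Lemma inf_closed (S T : set R) : S !=set0 -> has_lbound S -> S `<=` T -> closed T -> T (inf S).
Proof.
move=> S0 Sl ST cT; apply: cT; apply: (closure_subset ST); exact: inf_closure.
Qed.

Lemma cint_reflect (H : R -> R) (c : R) : continuous H -> 0 <= c ->
  \cint_(c, 2 * c) H = \cint_(0, c) (fun x => H (2 * c - x)).
Proof.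
move=> cH c0.
have cH' : continuous (fun x => H (2 * c - x)) by apply: (cts_comp cH); cts.
have dF (x : R) : is_derive x 1 (fun x => 2 * c - x) (-1 : R).
  by apply: is_derive_eq; rewrite /GRing.scale/=; ring.
have F'E : derive1 (fun x => 2 * c - x) = fun=> -1.
  by apply/funext => x; rewrite derive1E; apply: derive_val.
have cF : continuous (fun x => 2 * c - x) by cts.
have := @integration_by_substitution_decreasing _ (fun x => 2 * c - x) H 0 c c0.
rewrite subr0 (_ : 2 * c - c = c); last by ring.
rewrite F'E => h; rewrite /Rintegral h.
- congr fine; apply: eq_integral => x _ /=.
  by rewrite fctE /= opprK mulr1.
- by move=> x y _ _ xy; lra.
- by move=> x _; exact: cst_continuous.
- by apply: is_cvg_cst.
- by apply: is_cvg_cst.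
- split => //.
  + by apply: cvg_at_right_filter; exact: cF.
  + by apply: cvg_at_left_filter; exact: cF.
- exact: continuous_subspaceT.
Qed.

End clamped_variables.

(** * Spheres, rotations and the radii met by a support *)

Section spheres.
Context {R : realType}.

Lemma norm_col3 (rho x y z : R) : 0 <= rho -> x ^+ 2 + y ^+ 2 + z ^+ 2 = 1 ->
  enorm (col3 (rho * x) (rho * y) (rho * z)) = rho.
Proof.
move=> rho0 xyz; rewrite /enorm !big_ord_recl big_ord0 /col3 !mxE /= addr0.
rewrite !exprMn -!mulrDr addrA xyz mulr1 sqrtr_sqr ger0_norm//.
Qed.

Lemma rot_sphere (a b t s : R) :
  rotx a b t s ^+ 2 + roty a b t s ^+ 2 + rotz a b t s ^+ 2 = 1.
Proof.
have C (x : R) : sin x ^+ 2 = 1 - cos x ^+ 2 by exact: sin2cos2.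
rewrite /rotx /roty /rotz; ring: (C a) (C b) (C t) (C s).
Qed.

Lemma polar_rot (f : 'cV[R]_3 -> R) (a b t s rho : R) :
  polar_form (rot_act (rotUV a b) f) rho t s =
  f (col3 (rho * rotx a b t s) (rho * roty a b t s) (rho * rotz a b t s)).
Proof.
rewrite /polar_form /rot_act /rotUV; congr f; apply/colP => i.
rewrite !mxE !big_ord_recl !big_ord0 !mxE !big_ord_recl !big_ord0 !mxE /=.
rewrite /rotx /roty /rotz.
by case: i => -[|[|[|]]] // i3 /=; ring.
Qed.

Lemma enorm_continuous : continuous (@enorm R).
Proof.
rewrite /enorm (_ : (fun _ => _) = fun x : 'cV[R]_3 => Num.sqrt (x ord0 0 ^+ 2 + x (inord 1) 0 ^+ 2 + x (inord 2) 0 ^+ 2)).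
  have cc i : continuous (fun x : 'cV[R]_3 => x i 0) by exact: coord_continuous.
  by have := cc ord0; have := cc (inord 1); have := cc (inord 2) => c2 c1 c0; cts.
apply/funext => x; congr Num.sqrt; rewrite !big_ord_recl big_ord0 addr0 addrA.
by congr (_ + x _ 0 ^+ 2 + x _ 0 ^+ 2); apply/val_inj; rewrite /= inordK.
Qed.

Definition radii (f : 'cV[R]_3 -> R) : set R := @enorm R @` closure [set x | f x != 0].

Lemma radii_closed Omega f : test_function Omega f -> closed (radii f).
Proof.
move=> [_ cf _]; apply: (@compact_closed R); first exact: Rhausdorff.
by apply: continuous_compact => //; apply: continuous_subspaceT; exact: enorm_continuous.
Qed.

Lemma radii_range e1 e2 e3 f rho :
  test_function (hollow_ball 0 e1 `|` hollow_ball e2 e3) f ->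
  radii f rho -> 0 < rho < e1 \/ e2 < rho < e3.
Proof. by move=> [_ _ sf] [x /sf [] h <-]; [left|right]. Qed.

Lemma radii_vanish f (rho x y z : R) : 0 <= rho -> x ^+ 2 + y ^+ 2 + z ^+ 2 = 1 ->
  ~ radii f rho -> f (col3 (rho * x) (rho * y) (rho * z)) = 0.
Proof.
move=> rho0 xyz nr; apply/eqP; apply: contra_notT nr => fx.
by exists (col3 (rho * x) (rho * y) (rho * z)); [exact: subset_closure|exact: norm_col3].
Qed.

End spheres.

(** * Lipschitz kernels on a triangle *)
Section lipschitz.
Context {R : realType}.
Variables s0 b : R.

(** Boundedness is included so that the class is closed under products. *)
Definition lip_tri (F : R -> R -> R) :=
  (exists2 M : R, 0 <= M & forall s r, s0 <= s -> s <= r -> r <= b -> `|F r s| <= M) /\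
  (exists2 C : R, 0 <= C & forall s r r', s0 <= s -> s <= r -> r <= r' -> r' <= b ->
     `|F r' s - F r s| <= C * (r' - r)).

Lemma cts_bounded (h : R -> R) (a c : R) : continuous h ->
  exists2 M : R, 0 <= M & forall x, a <= x <= c -> `|h x| <= M.
Proof.
move=> ch; have [ac|ca] := leP a c; last first.
  by exists 0 => // x /andP[ax xc]; have := le_trans ax xc; rewrite leNgt ca.
have cn : continuous (fun x => `|h x|) by cts.
have [y _ ymax] := EVT_max ac (continuous_subspaceT cn).
by exists `|h y| => // x xac; apply: ymax; rewrite in_itv.
Qed.

Lemma lip_snd (h : R -> R) : continuous h -> lip_tri (fun r s => h s).
Proof.
move=> ch; have [M M0 hM] := cts_bounded s0 b ch; split.
  by exists M => // s r ss sr rb; apply: hM; rewrite ss (le_trans sr).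
by exists 0 => // s r r' *; rewrite subrr normr0 mul0r.
Qed.

Lemma lip_fst : lip_tri (fun r s => r).
Proof.
have cid : continuous (fun x : R => x) by cts.
have [M M0 hM] := cts_bounded s0 b cid; split.
  by exists M => // s r ss sr rb; apply: hM; rewrite rb (le_trans ss).
by exists 1 => // s r r' ss sr rr' _; rewrite mul1r ger0_norm// subr_ge0.
Qed.

Lemma lipD F G : lip_tri F -> lip_tri G -> lip_tri (fun r s => F r s + G r s).
Proof.
move=> [[M M0 FM] [C C0 FC]] [[N N0 GN] [D D0 GD]]; split.
  exists (M + N) => [|s r ss sr rb]; first exact: addr_ge0.
  by apply: (le_trans (ler_normD _ _)); rewrite lerD ?FM ?GN.
exists (C + D) => [|s r r' ss sr rr' rb]; first exact: addr_ge0.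
rewrite (_ : _ - _ = (F r' s - F r s) + (G r' s - G r s)); last by ring.
by apply: (le_trans (ler_normD _ _)); rewrite mulrDl lerD ?FC ?GD.
Qed.

Lemma lipM F G : lip_tri F -> lip_tri G -> lip_tri (fun r s => F r s * G r s).
Proof.
move=> [[M M0 FM] [C C0 FC]] [[N N0 GN] [D D0 GD]]; split.
  exists (M * N) => [|s r ss sr rb]; first exact: mulr_ge0.
  by rewrite normrM ler_pM ?FM ?GN.
exists (C * N + M * D) => [|s r r' ss sr rr' rb]; first by rewrite addr_ge0// mulr_ge0.
rewrite (_ : _ - _ = (F r' s - F r s) * G r' s + F r s * (G r' s - G r s)); last by ring.
apply: (le_trans (ler_normD _ _)); rewrite !normrM mulrDl.
have rb' : r <= b := le_trans rr' rb.
have sr' : s <= r' := le_trans sr rr'.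
have h1 := FC _ _ _ ss sr rr' rb; have h2 := GN _ _ ss sr' rb.
have h3 := FM _ _ ss sr rb'; have h4 := GD _ _ _ ss sr rr' rb.
have d : 0 <= r' - r by rewrite subr_ge0.
rewrite lerD//.
  by rewrite mulrAC ler_pM.
by rewrite -mulrA ler_pM.
Qed.

Lemma lip_cst (c : R) : lip_tri (fun _ _ => c).
Proof. by apply: (lip_snd (h := fun=> c)); cts. Qed.

Lemma lipX F n : lip_tri F -> lip_tri (fun r s => F r s ^+ n).
Proof.
move=> lF; elim: n => [|n IHn]; first exact: lip_cst.
rewrite (_ : (fun _ _ => _) = (fun r s => F r s * F r s ^+ n)); first exact: lipM.
by apply/funext => r; apply/funext => s; rewrite exprS.
Qed.

Lemma lip_sum n (P : pred nat) (F : nat -> R -> R -> R) : (forall i, lip_tri (F i)) ->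
  lip_tri (fun r s => \sum_(i < n | P i) F i r s).
Proof.
move=> lF; elim: n => [|n IHn].
  rewrite (_ : (fun _ _ => _) = (fun _ _ => 0)); first exact: lip_cst.
  by apply/funext => r; apply/funext => s; rewrite big_ord0.
rewrite (_ : (fun _ _ => _) = (fun r s => \sum_(i < n | P i) F i r s + (if P n then F n r s else 0))).
  by apply: lipD => //; case: (P n) => //; exact: lip_cst.
by apply/funext => r; apply/funext => s; rewrite big_mkcond big_ord_recr/= -big_mkcond.
Qed.

Lemma lip_sqrt F (c : R) : 0 < c ->
  (forall s r, s0 <= s -> s <= r -> r <= b -> c <= F r s) ->
  lip_tri F -> lip_tri (fun r s => Num.sqrt (F r s)).
Proof.
move=> c0 Fc [[M M0 FM] [C C0 FC]]; split.
  exists (Num.sqrt M) => [|s r ss sr rb]; first exact: sqrtr_ge0.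
  rewrite ger0_norm ?sqrtr_ge0// ler_wsqrtr//.
  by apply: le_trans (FM _ _ ss sr rb); exact: ler_norm.
have sc : 0 < Num.sqrt c by rewrite sqrtr_gt0.
exists (C / Num.sqrt c) => [|s r r' ss sr rr' rb]; first by rewrite divr_ge0// ltW.
have sr' : s <= r' := le_trans sr rr'.
have F1 := Fc _ _ ss sr (le_trans rr' rb); have F2 := Fc _ _ ss sr' rb.
have h := FC _ _ _ ss sr rr' rb.
have q1 : Num.sqrt c <= Num.sqrt (F r' s) by rewrite ler_wsqrtr.
have q2 := sqrtr_ge0 (F r s).
have e : F r' s - F r s = (Num.sqrt (F r' s) - Num.sqrt (F r s)) * (Num.sqrt (F r' s) + Num.sqrt (F r s)).
  rewrite -subr_sqr !sqr_sqrtr//; apply: le_trans; [exact: ltW c0|exact: F1|exact: ltW c0|exact: F2].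
rewrite mulrAC ler_pdivlMr//; apply: le_trans h.
rewrite e normrM ler_wpM2l// ger0_norm; first by rewrite (le_trans q1)// lerDl.
by rewrite addr_ge0// sqrtr_ge0.
Qed.

Lemma lip_deriv F dF : cont2 dF -> cont2 F ->
  (forall s x, s0 <= s -> s < x -> x < b -> is_derive x 1 (F^~ s : R -> R) (dF x s)) -> lip_tri F.
Proof.
move=> cdF cF dFE.
have bnd G : cont2 G -> exists2 M : R, 0 <= M & forall s r, s0 <= s -> s <= r -> r <= b -> `|G r s| <= M.
  move=> cG.
  have cc : compact (`[s0, b]%classic `*` `[s0, b]%classic : set (R * R)).
    by apply: compact_setX; exact: segment_compact.
  have cn : continuous (fun v : R * R => `|G v.1 v.2|) by rewrite /cont2 in cG; cts.
  have := continuous_compact (continuous_subspaceT cn) cc.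
  move=> /compact_bounded[M0 [_ HM]].
  have [N [N0 NM]] : exists N : R, 0 <= N /\ M0 < N.
    exists (Num.max 0 M0 + 1); rewrite addr_ge0 ?le_max ?lexx//; split => //.
    by rewrite ltr_pwDr// le_max lexx orbT.
  exists N => // s r ss sr rb; rewrite -[leLHS]normr_id; apply: (HM N NM).
  exists (r, s) => //; split; rewrite /= in_itv/=; apply/andP; split => //.
    exact: le_trans sr.
  exact: le_trans rb.
split; first exact: bnd.
have [C C0 dC] := bnd _ cdF; exists C => // s r r' ss sr rr' rb.
move: rr'; rewrite le_eqVlt => /predU1P[->|rr']; first by rewrite !subrr normr0 mulr0.
have cFs : continuous (F^~ s) by apply: (cts2 cF); cts.
have [x xr ->] : exists2 x, x \in `]r, r'[ & F r' s - F r s = dF x s * (r' - r).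
  apply: (MVT rr' (f := F^~ s) (df := fun x => dF x s)); last exact: continuous_subspaceT.
  move=> x; rewrite in_itv/= => /andP[rx xr]; apply: dFE => //.
    exact: le_lt_trans rx.
  exact: lt_le_trans rb.
move: xr; rewrite in_itv/= => /andP[rx xr].
rewrite normrM [`|r' - r|]gtr0_norm ?subr_gt0//.
rewrite ler_pM2r ?subr_gt0//; apply: dC => //.
  by apply: ltW; exact: le_lt_trans rx.
by apply: ltW; exact: lt_le_trans rb.
Qed.

End lipschitz.

(** * The zonal factor in even degree *)
Section even_zonal.
Context {R : realType}.

(** For even l only even powers of cos phi occur in P_l, and r^l P_l (cos phi)
    is a polynomial in (r cos phi)^2 = r^2 - s^2 and s^2, where s = r sin phi.
    In these variables it is smooth up to s = r, unlike cos phi. *)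
Definition zonal2 (l : nat) (x y : R) : R :=
  \sum_(k < l.+1 | ~~ odd k)
    ('C(l, k) * 'C(k, k./2))%:R * x ^+ (l - k)./2 * (- y / 4) ^+ k./2.

Lemma zonal_even (l : nat) (r x y : R) : ~~ odd l ->
  r ^+ l * zonal l x y = zonal2 l (r ^+ 2 * x ^+ 2) (r ^+ 2 * y).
Proof.
move=> el; rewrite /zonal /zonal2 mulr_sumr; apply: eq_bigr => k ek.
have kl : (k <= l)%N by rewrite -ltnS.
have elk : ~~ odd (l - k) by rewrite oddB// (negbTE el) (negbTE ek).
have -> : r ^+ l = (r ^+ 2) ^+ (l - k)./2 * (r ^+ 2) ^+ k./2.
  by rewrite -exprD -exprM mul2n doubleD !even_halfK// subnK.
have -> : x ^+ (l - k) = (x ^+ 2) ^+ (l - k)./2 by rewrite -exprM mul2n even_halfK.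
have -> : - (r ^+ 2 * y) / 4 = r ^+ 2 * (- y / 4) by ring.
rewrite !exprMn; ring.
Qed.

(** A single term survives, (- y / 4)^(l / 2) times a binomial coefficient; it
    expresses P_l (0) <> 0, which fails for odd l. *)
Lemma zonal2_diag l (y : R) : ~~ odd l -> 0 < y -> zonal2 l 0 y != 0.
Proof.
move=> el y0; rewrite /zonal2 (bigD1 ord_max) //= big1 ?addr0.
  rewrite subnn expr0 mulr1 mulf_neq0//.
    by rewrite pnatr_eq0 -lt0n muln_gt0 !bin_gt0 leqnn -{2}(even_halfK el) -addnn leq_addr.
  by rewrite expf_neq0// mulf_neq0// oppr_eq0 gt_eqF.
move=> k /andP[ek kl].
have kl' : (k < l)%N.
  by rewrite ltn_neqAle -[(k <= l)%N]ltnS ltn_ord andbT; apply: contraNneq kl => kl; apply/eqP/val_inj.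
have elk : ~~ odd (l - k) by rewrite oddB ?(ltnW kl')// (negbTE el) (negbTE ek).
have : (0 < (l - k)./2)%N by rewrite -double_gt0 even_halfK// subn_gt0.
by case: (_./2) => // n _; rewrite expr0n mulr0 mul0r.
Qed.

Lemma zonal_reflect l (x y : R) : ~~ odd l -> zonal l (- x) y = zonal l x y.
Proof.
move=> el; apply: eq_bigr => k ek; congr (_ * _ * _).
have kl : (k <= l)%N by rewrite -ltnS.
have elk : ~~ odd (l - k) by rewrite oddB// (negbTE el) (negbTE ek).
by rewrite exprNn -signr_odd (negbTE elk) expr0 mul1r.
Qed.

Lemma cts_sum (T : topologicalType) (n : nat) (P : pred nat) (F : nat -> T -> R) :
  (forall i, continuous (F i)) -> continuous (fun t => \sum_(k < n | P k) F k t).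
Proof.
move=> cF; elim: n => [|n IHn].
  rewrite (_ : (fun _ => _) = (fun _ => 0)); first exact: cts_cst.
  by apply/funext => t; rewrite big_ord0.
rewrite (_ : (fun _ => _) = (fun t => \sum_(i < n | P i) F i t + (if P n then F n t else 0))).
  by apply: ctsD => //; case: (P n) => //; exact: cts_cst.
by apply/funext => t; rewrite big_mkcond big_ord_recr/= -big_mkcond.
Qed.

Lemma cts_zonal (T : topologicalType) l (f g : T -> R) : continuous f -> continuous g ->
  continuous (fun t => zonal l (f t) (g t)).
Proof.
move=> cf cg.
apply: (@cts_sum T _ (fun k => ~~ odd k) (fun k t => ('C(l, k) * 'C(k, k./2))%:R * f t ^+ (l - k) * (- g t / 4) ^+ k./2)) => k.
by cts.
Qed.

Lemma cts_zonal2 (T : topologicalType) l (f g : T -> R) : continuous f -> continuous g ->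
  continuous (fun t => zonal2 l (f t) (g t)).
Proof.
move=> cf cg.
apply: (@cts_sum T _ (fun k => ~~ odd k) (fun k t => ('C(l, k) * 'C(k, k./2))%:R * f t ^+ (l - k)./2 * (- g t / 4) ^+ k./2)) => k.
by cts.
Qed.

Lemma lip_zonal2 (s0 b : R) l F G : lip_tri s0 b F -> lip_tri s0 b G ->
  lip_tri s0 b (fun r s => zonal2 l (F r s) (G r s)).
Proof.
move=> lF lG; apply: (@lip_sum _ s0 b _ (fun k => ~~ odd k) (fun k r s => ('C(l, k) * 'C(k, k./2))%:R * F r s ^+ (l - k)./2 * (- G r s / 4) ^+ k./2)) => k.
apply: lipM; first by apply: lipM; [exact: lip_cst|exact: lipX].
apply: lipX; apply: lipM; last exact: lip_cst.
rewrite (_ : (fun _ _ => _) = (fun r s => (-1) * G r s)); first by apply: lipM => //; exact: lip_cst.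
by apply/funext => r; apply/funext => s; rewrite mulN1r.
Qed.

End even_zonal.

(** * The transform tested against an isotropic power *)
Section spindle.
Context {R : realType}.

Lemma C1_3_scale (F : R -> R -> R -> R) (c : R) : C1_3 F -> C1_3 (fun x y z => F (c * x) (c * y) (c * z)).
Proof.
move=> [F1 [F2 [F3 [cF cF1 cF2 cF3 dF]]]].
exists (fun x y z => c * F1 (c * x) (c * y) (c * z)), (fun x y z => c * F2 (c * x) (c * y) (c * z)),
  (fun x y z => c * F3 (c * x) (c * y) (c * z)).
split.
- by apply: (cts3 cF); cts.
- by rewrite /cont3; cts; apply: (cts3 cF1); cts.
- by rewrite /cont3; cts; apply: (cts3 cF2); cts.
- by rewrite /cont3; cts; apply: (cts3 cF3); cts.
move=> x y z t x' y' z' dx dy dz.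
have dc (v : R -> R) (v' : R) : is_derive t 1 v v' -> is_derive t 1 (fun t => c * v t) (c * v').
  by move=> dv; apply: is_derive_eq; rewrite /GRing.scale/=; ring.
have := dF _ _ _ _ _ _ _ (dc _ _ dx) (dc _ _ dy) (dc _ _ dz).
by move=> dFt; apply: is_derive_eq; ring.
Qed.

Lemma asin_pos (x : R) : 0 <= x < 1 -> 0 <= asin x < pi / 2.
Proof.
move=> /andP[x0 x1]; have x1' : -1 <= x < 1 by rewrite x1 andbT; lra.
have x1'' : -1 <= x <= 1 by rewrite (ltW x1) andbT; lra.
rewrite asin_ltpi2// andbT leNgt; apply/negP => a0.
have p0 := pi_gt0 R; have ag := asin_geNpi2 x1''.
have : sin (asin x) < sin 0.
  by rewrite ltr_sin// !in_itv/= ?ag ?(ltW (asin_ltpi2 x1'))//; apply/andP; split; lra.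
by rewrite asinK ?in_itv//= sin0; lra.
Qed.

Variables (p dp : R -> R) (e1 e2 e3 : R) (w : R -> R -> R).
Let g := fun x => p (asin x).
Let A := admissible_radii g e1 e2 e3.
Hypothesis cp : {within [set` `[0, pi / 2]], continuous p}.
Hypothesis cdp : {within [set` `[0, pi / 2]], continuous dp}.
Hypothesis dpE : forall x, [set` `[0, pi / 2]] x -> is_derive_within [set` `[0, pi / 2]] p x (dp x).
Hypothesis p_neq0 : forall phi, 0 <= phi <= pi / 2 -> p phi <> 0.
Hypotheses (e1_gt0 : 0 < e1) (p0 : e1 < p 0 < e2).
Hypothesis w_branches : weight_both_branches (weight_domain A) w.

(** p does not vanish and p 0 > e1 > 0. *)
Lemma profile_gt0 s : 0 <= s < 1 -> 0 < g s.
Proof.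
move=> s01; have [a0 a1] := andP (asin_pos s01); rewrite /g.
rewrite ltNge; apply/negP => pa.
have cpa : {within `[0, asin s], continuous p}.
  apply: continuous_subspaceW cp => x /=; rewrite !in_itv/= => /andP[-> xa].
  by apply: le_trans xa _; exact: ltW.
have p00 : 0 <= p 0 by apply: ltW; case/andP: p0 => + _; exact: lt_trans.
have := @IVT _ p 0 (asin s) 0 a0 cpa.
rewrite ge_min pa orbT le_max p00 /= => /(_ isT)[c].
rewrite in_itv/= => /andP[c0 ca]; apply: p_neq0.
by rewrite c0; apply: le_trans ca _; exact: ltW.
Qed.

Variable b1 : R.
Hypothesis b1_itv : 0 <= b1 < 1.

(** g is C1 on [0, 1) only, because of the arcsine; it is used on [0, b1] and
    continued by constants outside. *)
Definition profile_clamp s := p (asin (clamp 0 b1 s)).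
Definition dprofile_clamp s := dp (asin (clamp 0 b1 s)) / Num.sqrt (1 - clamp 0 b1 s ^+ 2).
Notation gh := profile_clamp.
Notation dgh := dprofile_clamp.

Let clamp01 s : 0 <= clamp 0 b1 s < 1.
Proof.
have [b0 b1'] := andP b1_itv; have /andP[-> cb] := clamp_itv s b0.
exact: le_lt_trans b1'.
Qed.

Let casin : continuous (fun s => asin (clamp 0 b1 s)).
Proof.
have cc : continuous (fun s : R => clamp 0 b1 s) by apply: cts_clamp; exact: cts_id.
move=> s; apply: (@continuous_comp _ _ _ (fun s => clamp 0 b1 s) asin); first exact: cc.
by apply: continuous_asin; have := clamp01 s; lra.
Qed.

Let asin_itv s : [set` `[0, pi / 2]] (asin (clamp 0 b1 s)).
Proof. by have /andP[h1 h2] := asin_pos (clamp01 s); rewrite /= in_itv/= h1 ltW. Qed.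

Lemma cts_profile : continuous gh.
Proof. exact: (cts_within cp casin asin_itv). Qed.

Lemma cts_dprofile : continuous dgh.
Proof.
apply: ctsM; first exact: (cts_within cdp casin asin_itv).
have cc : continuous (fun s : R => clamp 0 b1 s) by apply: cts_clamp; exact: cts_id.
apply: ctsV; first by cts.
move=> s; rewrite gt_eqF// sqrtr_gt0 subr_gt0.
by have [h1 h2] := andP (clamp01 s); rewrite expr_lt1.
Qed.

Lemma profile_clampE s : 0 <= s <= b1 -> gh s = g s.
Proof. by move=> sb; rewrite /gh /profile_clamp clamp_id. Qed.

Lemma is_derive_profile (s : R) : 0 < s < b1 -> is_derive s 1 g (dgh s).
Proof.
move=> /andP[s0 sb]; have [b0 b1'] := andP b1_itv.
have s1 : 0 <= s < 1 by rewrite ltW//= (lt_trans sb).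
have s11 : -1 < s < 1 by lra.
have [a0 a1] := andP (asin_pos s1).
have a0' : 0 < asin s.
  rewrite lt_neqAle a0 andbT; apply/eqP => /(congr1 sin); rewrite sin0 asinK ?in_itv/=; last lra.
  by move=> h; rewrite -h ltxx in s0.
rewrite /dgh /dprofile_clamp clamp_id; last by rewrite !ltW.
have d1 := is_derive1_asin s11.
have d2 : is_derive (asin s) 1 p (dp (asin s)).
  apply: (@is_derive_within_interior _ [set` `[0, pi / 2]]); last by apply: dpE; rewrite /= in_itv/= a0 ltW.
  apply: (@filterS _ _ _ `]0, (pi / 2)[%classic); first exact: subset_itv_oo_cc.
  by apply: open_nbhs_nbhs; split; [exact: interval_open|rewrite /= in_itv/= a0'].
exact: (@is_derive1_comp _ p asin s _ _ d2 d1).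
Qed.

Variables (m : R).
Hypothesis m_min : is_min A m.

(** 0 is not in A, as g 0 = p 0 lies strictly between e1 and e2. *)
Lemma min_gt0 : 0 < m.
Proof.
have [[/andP[m0 m1] Am] _] := m_min; rewrite lt_neqAle m0 andbT; apply/eqP => mE.
move: Am; rewrite -mE /g (_ : asin 0 = 0).
  by case/andP: p0 => h1 h2 [] /andP[h3 h4]; lra.
by rewrite -[X in asin X](@sin0 R) sinK// in_itv/=; have := pi_gt0 R; lra.
Qed.

(** The factor in front of f in the transform, made continuous on the whole
    range of phi by clamping r sin phi to [m, r], where W is controlled. *)
Definition spindle_weight r phi :=
  weight_radial w r (clamp m r (r * sin phi)) * gh (r * sin phi) * sin phi *
  Num.sqrt (gh (r * sin phi) ^+ 2 + (dgh (r * sin phi) * (r * cos phi)) ^+ 2).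

Variable f : 'cV[R]_3 -> R.
Hypothesis ft : test_function (hollow_ball 0 e1 `|` hollow_ball e2 e3) f.

Lemma radii_admissible s : 0 <= s <= b1 -> radii f (gh s) -> A s.
Proof.
move=> sb /(radii_range ft); rewrite profile_clampE// => gs.
have [b0 b1'] := andP b1_itv; have [s0 sb'] := andP sb.
split; first by rewrite s0 (le_lt_trans sb').
by case: gs => /andP[h1 h2]; [left|right]; rewrite !ltW.
Qed.

(** Where r sin phi < m = min A, the weight is arbitrary, but r sin phi is then
    not in A, so that its radius is not met by the support and f vanishes.
    Elsewhere the clamped weight agrees with w on both branches of the arcsine,
    and g is differentiable at r sin phi. *)
Lemma spindle_integrandE r a b : A r -> r < b1 ->
  spindle w p f r a b = \cint_(0, 2 * pi) (fun t => \cint_(0, pi) (fun phi =>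
    spindle_weight r phi * f (col3 (gh (r * sin phi) * rotx a b t phi)
      (gh (r * sin phi) * roty a b t phi) (gh (r * sin phi) * rotz a b t phi)))).
Proof.
move=> Ar rb; have [/andP[r0 r1] _] := Ar; have m0 := min_gt0.
have mr : m <= r by have [_] := m_min; apply.
have r_gt0 : 0 < r by apply: lt_le_trans mr.
rewrite /spindle; apply: eq_cint => t _; apply: eq_cint => phi phipi.
rewrite polar_rot.
have sphi0 : 0 <= sin phi := sin_ge0_pi phipi.
have sphi1 : sin phi <= 1 := sin_le1 phi.
have s0 : 0 <= r * sin phi by rewrite mulr_ge0.
have sr : r * sin phi <= r by rewrite ger_pMr.
have sb : 0 <= r * sin phi <= b1 by rewrite s0 (le_trans sr)// ltW.
have ghE : sym_curve p r phi = gh (r * sin phi) by rewrite profile_clampE.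
have [sm|ms] := ltP (r * sin phi) m.
  rewrite ghE [f _](_ : _ = 0) ?mulr0//.
  apply: radii_vanish; [|exact: rot_sphere|].
    by rewrite profile_clampE// ltW// profile_gt0// s0 (le_lt_trans sr).
  move=> /(radii_admissible sb) As; have [_] := m_min => /(_ _ As).
  by rewrite leNgt sm.
rewrite /spindle_weight clamp_id ?ms//.
have -> : w r phi = weight_radial w r (r * sin phi).
  by apply: w_branches => //; split => //=; exists m => //; rewrite ms sr.
have -> : derive1 (sym_curve p r) phi = dgh (r * sin phi) * (r * cos phi).
  rewrite derive1E.
  have dg : is_derive (r * sin phi) 1 g (dgh (r * sin phi)).
    by apply: is_derive_profile; rewrite (lt_le_trans m0 ms) (le_lt_trans sr).
  have ds : is_derive phi 1 (fun x : R => r * sin x) (r * cos phi).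
    by apply: is_derive_eq; rewrite /GRing.scale/=; ring.
  have := @is_derive1_comp _ g (fun x => r * sin x) phi _ _ dg ds.
  by move=> dc; exact: derive_val.
by rewrite ghE.
Qed.

Hypothesis cW : {within weight_domain A, continuous (fun v : R * R => weight_radial w v.1 v.2)}.

Lemma weight_clamp_domain r s : A r -> weight_domain A (r, clamp m r s).
Proof.
move=> Ar; have mr : m <= r by have [_] := m_min; apply.
by split => //=; exists m => //; exact: clamp_itv.
Qed.

Lemma cts_spindle_weight r : A r -> continuous (spindle_weight r).
Proof.
move=> Ar.
have cc : continuous (fun phi : R => (r, clamp m r (r * sin phi))).
  by cts; apply: cts_clamp; cts.
have cw : continuous (fun phi => weight_radial w r (clamp m r (r * sin phi))).
  exact: (cts_within cW cc (fun phi => weight_clamp_domain _ Ar)).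
have cs : continuous (fun phi : R => r * sin phi) by cts.
have cg := cts_comp cts_profile cs; have cd := cts_comp cts_dprofile cs.
by rewrite /spindle_weight; cts.
Qed.

Variables (part : R[i] -> R) (z : R[i] * R[i] * R[i]) (l : nat).
Hypothesis partE : part = @complex.Re R \/ part = @complex.Im R.
Hypothesis iz : isotropic z.
Let E := isotropic_part part z l.

Definition sphere_moment (f : 'cV[R]_3 -> R) rho :=
  sphere_int (fun x y t => isotropic_part part z l x y t * f (col3 (rho * x) (rho * y) (rho * t))).

Let cE : cont3 E.
Proof.
apply: C1_3_cont; rewrite /E /isotropic_part.
by case: partE => ->; have [] := C1_3_zform z l.
Qed.

Lemma cts_sphere_moment (k : 'cV[R]_3 -> R) : continuous k -> continuous (sphere_moment k).
Proof.
move=> /cont3_col3 ck.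
pose G (rho a b : R) := sin b * (E (sin b * cos a) (sin b * sin a) (cos b) *
  k (col3 (rho * (sin b * cos a)) (rho * (sin b * sin a)) (rho * cos b))).
have cG : cont3 G.
  by rewrite /cont3 /G; cts; [apply: (cts3 cE)|apply: (cts3 ck)]; cts.
apply: (@continuous_cint R _ (fun rho a => \cint_(0, pi) (G rho a))).
apply: (@continuous_cint R _ (fun v b => G v.1 v.2 b)).
by apply: (cts3 cG); cts.
Qed.

(** Once the order of integration is changed, the integral over the angles at
    fixed phi is the one that [funk_hecke] computes. *)
Lemma spindle_transform r : A r -> r < b1 ->
  \cint_(0, 2 * pi) (fun a => \cint_(0, pi) (fun b => sin b *
    (E (sin b * cos a) (sin b * sin a) (cos b) * spindle w p f r a b))) =
  \cint_(0, pi) (fun phi => spindle_weight r phi *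
    (2 * pi * zonal l (cos phi) (sin phi ^+ 2) * sphere_moment f (gh (r * sin phi)))).
Proof.
move=> Ar rb.
have cf : continuous f by case: ft => /(_ 0%N).
have c1f : C1_3 (fun x y t => f (col3 x y t)) by apply: Ck1_C1_3; case: ft => /(_ 1%N).
have cf3 : cont3 (fun x y t => f (col3 x y t)) by exact: cont3_col3.
have cN : continuous (spindle_weight r) by exact: cts_spindle_weight.
have cs : continuous (fun phi : R => r * sin phi) by cts.
have cgr := cts_comp cts_profile cs.
pose Y (phi a b t : R) := sin b * (E (sin b * cos a) (sin b * sin a) (cos b) *
  f (col3 (gh (r * sin phi) * rotx a b t phi) (gh (r * sin phi) * roty a b t phi)
          (gh (r * sin phi) * rotz a b t phi))).
have cgT (T : topologicalType) (h : T -> R) : continuous h -> continuous (fun v => gh (r * sin (h v))).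
  by move=> ch; exact: (cts_comp cgr ch).
have crot (T : topologicalType) (ga al be te ph : T -> R) : continuous ga -> continuous al -> continuous be ->
    continuous te -> continuous ph -> continuous (fun v =>
      f (col3 (ga v * rotx (al v) (be v) (te v) (ph v)) (ga v * roty (al v) (be v) (te v) (ph v))
          (ga v * rotz (al v) (be v) (te v) (ph v)))).
  by move=> c1 c2 c3 c4 c5; apply: (cts3 cf3); rewrite /rotx /roty /rotz; cts.
have cY : cont4 Y.
  rewrite /cont4 /Y; cts; first by apply: (cts3 cE); cts.
  by apply: crot; cts; apply: cgT; cts.
have cYt : cont3 (fun phi a b => \cint_(0, 2 * pi) (Y phi a b)).
  apply: (@continuous_cint R _ (fun v t => Y v.1.1 v.1.2 v.2 t)).
  by apply: (cts4 cY); cts.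
pose X (phi a b : R) := spindle_weight r phi * \cint_(0, 2 * pi) (Y phi a b).
have cX : cont3 X.
  by rewrite /cont3 /X; apply: ctsM; [apply: (cts_comp cN); cts|exact: cYt].
transitivity (\cint_(0, 2 * pi) (fun a => \cint_(0, pi) (fun b => \cint_(0, pi) (fun phi => X phi a b)))).
  apply: eq_cint => a _; apply: eq_cint => b _.
  rewrite spindle_integrandE// cint_fubini; last first.
    cts; first by apply: (cts_comp cN); cts.
    by apply: crot; cts; apply: cgT; cts.
  have ci : continuous (fun phi => \cint_(0, 2 * pi) (fun t => spindle_weight r phi *
      f (col3 (gh (r * sin phi) * rotx a b t phi) (gh (r * sin phi) * roty a b t phi)
          (gh (r * sin phi) * rotz a b t phi)))).
    apply: (@continuous_cint R _ (fun phi t => spindle_weight r phi *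
      f (col3 (gh (r * sin phi) * rotx a b t phi) (gh (r * sin phi) * roty a b t phi)
          (gh (r * sin phi) * rotz a b t phi)))).
    cts; first by apply: (cts_comp cN); cts.
    by apply: crot; cts; apply: cgT; cts.
  rewrite mulrA -cintZl//; apply: eq_cint => phi _.
  rewrite /X -cintZl; last by cts; apply: crot; cts.
  rewrite -cintZl; last by apply: (cts4 cY); cts.
  by apply: eq_cint => t _; rewrite /Y; ring.
rewrite -cint_rot3//; apply: eq_cint => phi /andP[phi0 phipi].
transitivity (spindle_weight r phi * \cint_(0, 2 * pi) (fun a => \cint_(0, pi) (fun b =>
   \cint_(0, 2 * pi) (Y phi a b)))).
  rewrite -cintZl; last first.
    apply: (@continuous_cint R _ (fun a b => \cint_(0, 2 * pi) (Y phi a b))).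
    by apply: (cts3 cYt); cts.
  apply: eq_cint => a _; rewrite -cintZl//.
  by apply: (cts3 cYt); cts.
congr (_ * _).
exact: (funk_hecke l partE iz (C1_3_scale (gh (r * sin phi)) c1f) phi0).
Qed.

End spindle.

(** * Uniqueness of the moments *)
Section uniqueness.
Context {R : realType}.

Lemma is_derive_within_continuous (D : set R) (f df : R -> R) :
  (forall x, D x -> is_derive_within D f x (df x)) -> {within D, continuous f}.
Proof.
move=> dfD; apply/subspace_continuousP => x Dx.
apply/cvgrPdist_le => e e0.
have /cvgrPdist_le/(_ _ ltr01)[d /= d0 dB] := dfD x Dx.
pose c := `|df x| + 1; have c0 : 0 < c by rewrite /c ltr_wpDl.
exists (Num.min d (e / c)) => /=; first by rewrite lt_min d0 divr_gt0.
move=> y; rewrite /ball /= lt_min => /andP[xyd xye] Dy.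
have [->|yx] := eqVneq y x; first by rewrite subrr normr0 ltW.
have yx0 : y - x != 0 by rewrite subr_eq0.
have := dB y xyd (conj Dy _) => /(_ _)/wrap[|h]; first by move=> /= yxE; rewrite yxE eqxx in yx.
have q : `|(f y - f x) / (y - x)| <= c.
  rewrite -[X in `|X|](subrK (df x)) /c addrC; apply: (le_trans (ler_normD _ _)).
  by rewrite addrC [leRHS]addrC lerD2r distrC.
have -> : f x - f y = - ((f y - f x) / (y - x) * (y - x)) by rewrite mulfVK// opprB.
rewrite normrN normrM; apply: (le_trans (ler_wpM2r (normr_ge0 _) q)).
by move: xye; rewrite distrC ltr_pdivlMr// mulrC => /ltW.
Qed.

Lemma vanish_closed_right (u : R -> R) (s0 : R) : continuous u -> 0 < s0 ->
  (forall t, 0 <= t < s0 -> u t = 0) -> forall t, 0 <= t <= s0 -> u t = 0.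
Proof.
move=> cu s0_gt0 u0 t /andP[t0]; rewrite le_eqVlt => /predU1P[->|ts]; last first.
  by apply: u0; rewrite t0.
apply/eqP; apply: contraT => us0; have us0' : 0 < `|u s0| by rewrite normr_gt0.
have /cvgrPdist_lt/(_ _ us0')[d /= d0 dB] := cu s0.
pose t' := Num.max (s0 / 2) (s0 - d / 2).
have ts : t' < s0 by rewrite gt_max; apply/andP; split; lra.
have t'0 : 0 <= t' by rewrite le_max; apply/orP; left; lra.
have td : s0 - d / 2 <= t' by rewrite le_max lexx orbT.
have := dB t'; rewrite /ball/= ger0_norm ?subr_ge0 ?(ltW ts)// => /(_ _)/wrap[|]; first by lra.
by rewrite (u0 t') ?t'0// subr0 ltxx.
Qed.

(** The step is applied at the infimum of the points where u does not vanish. *)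
Lemma vanish_by_continuation (u : R -> R) (x1 : R) :
  (forall s0, 0 <= s0 <= x1 -> closure [set t | 0 <= t <= x1 /\ u t != 0] s0 ->
    (forall t, 0 <= t < s0 -> u t = 0) ->
    exists2 eta, 0 < eta & forall t, s0 <= t <= s0 + eta -> u t = 0) ->
  forall t, 0 <= t <= x1 -> u t = 0.
Proof.
move=> step t tI; apply/eqP; apply: contraT => ut.
set Z := [set t | 0 <= t <= x1 /\ u t != 0] in step.
have Zt : Z t by [].
have Z0 : Z !=set0 by exists t.
have Zlb : has_lbound Z by exists 0 => x [/andP[]].
have s0I : 0 <= inf Z <= x1.
  rewrite lb_le_inf//=; last by move=> x [/andP[]].
  by have /andP[_] := tI; apply: le_trans; exact: ge_inf.
have u0 x : 0 <= x < inf Z -> u x = 0.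
  move=> /andP[x0 xZ]; apply/eqP; apply: contraT => ux.
  have Zx : Z x.
    by split => //; have /andP[_ ?] := s0I; rewrite x0 (le_trans (ltW xZ)).
  by have := ge_inf Zlb Zx; rewrite leNgt xZ.
have [eta eta0 uEta] := step _ s0I (inf_closure Z0 Zlb) u0.
have [x Zx xlt] := inf_adherent eta0 (conj Z0 Zlb).
have [_] := Zx; rewrite uEta ?eqxx//.
by rewrite (ltW xlt) andbT; exact: ge_inf.
Qed.

Variables (p dp : R -> R) (e1 e2 e3 : R) (w dW : R -> R -> R).
Let g := fun x => p (asin x).
Let A := admissible_radii g e1 e2 e3.
Let W := weight_radial w.
Let Omega := hollow_ball 0 e1 `|` hollow_ball e2 e3.
Hypothesis cdp : {within [set` `[0, pi / 2]], continuous dp}.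
Hypothesis dpE : forall x, [set` `[0, pi / 2]] x -> is_derive_within [set` `[0, pi / 2]] p x (dp x).
Hypothesis p_neq0 : forall phi, 0 <= phi <= pi / 2 -> p phi <> 0.
Hypotheses (e1_gt0 : 0 < e1) (p0 : e1 < p 0 < e2).
Hypothesis w_branches : weight_both_branches (weight_domain A) w.
Hypothesis cW : {within weight_domain A, continuous (fun v : R * R => W v.1 v.2)}.
Hypothesis cdW : {within weight_domain A, continuous (fun v : R * R => dW v.1 v.2)}.
Hypothesis dWE : forall r s, weight_domain A (r, s) ->
  is_derive_within [set r' | weight_domain A (r', s)] (W^~ s) r (dW r s).
Hypothesis W_diag : forall s, A s -> W s s <> 0.
Variables f1 f2 : 'cV[R]_3 -> R.
Hypotheses (f1t : test_function Omega f1) (f2t : test_function Omega f2).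
Hypothesis spindle_eq : forall r a b,
  0 <= r <= 1 -> 0 <= a <= 2 * pi -> 0 <= b <= pi ->
  spindle w p f1 r a b = spindle w p f2 r a b.
Variables (part : R[i] -> R) (z : R[i] * R[i] * R[i]) (l : nat).
Hypothesis partE : part = @complex.Re R \/ part = @complex.Im R.
Hypothesis iz : isotropic z.
Hypothesis l_even : ~~ odd l.

Let cp := is_derive_within_continuous dpE.
Notation moment := (sphere_moment part z l).

Lemma moment_vanish f rho : 0 <= rho -> ~ radii f rho -> moment f rho = 0.
Proof.
move=> rho0 nr; rewrite /sphere_moment /sphere_int -[RHS](cint0 0 (2 * pi)).
apply: eq_cint => a _; rewrite -[RHS](cint0 0 pi); apply: eq_cint => b _.
rewrite radii_vanish ?mulr0//.
have C (x : R) : sin x ^+ 2 = 1 - cos x ^+ 2 by exact: sin2cos2.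
ring: (C a) (C b).
Qed.

(** Local uniqueness to the right of s0. The points s0 and b are such that the
    weight is controlled on the triangle s0 <= s <= r <= b. *)
Section local.
Variables (b1 m s0 b : R).
Hypothesis b1_itv : 0 <= b1 < 1.
Hypothesis m_min : is_min A m.
Hypotheses (ms0 : m <= s0) (s0b : s0 < b) (bb1 : b < b1).
Hypothesis sA : forall s, s0 <= s <= b -> A s.
Notation gh := (profile_clamp p b1).
Notation dgh := (dprofile_clamp dp b1).
Let u s := moment f1 (gh s) - moment f2 (gh s).
Hypothesis u0 : forall s, 0 <= s <= s0 -> u s = 0.

Let m_gt0 : 0 < m := min_gt0 p0 m_min.
Let s0_gt0 : 0 < s0. Proof. exact: lt_le_trans ms0. Qed.
Let cgh : continuous gh := cts_profile cp b1_itv.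
Let cdgh : continuous dgh := cts_dprofile cdp b1_itv.

Let cu : continuous u.
Proof.
have cf1 : continuous f1 by case: f1t => /(_ 0%N).
have cf2 : continuous f2 by case: f2t => /(_ 0%N).
have c1 := cts_comp (cts_sphere_moment (z := z) (l := l) partE cf1) cgh.
have c2 := cts_comp (cts_sphere_moment (z := z) (l := l) partE cf2) cgh.
exact: (ctsD c1 (ctsN c2)).
Qed.

(** The weight extended continuously from the triangle to the plane, for a kernel
    that is continuous everywhere. *)
Let sbar s := clamp s0 b s.
Let rbar r s := clamp (sbar s) b r.
Let Wbar r s := W (rbar r s) (sbar s).
Let dWbar r s := dW (rbar r s) (sbar s).

Let sbar_itv s : s0 <= sbar s <= b. Proof. exact: clamp_itv (ltW s0b). Qed.
Let rbar_itv r s : sbar s <= rbar r s <= b.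
Proof. by apply: clamp_itv; case/andP: (sbar_itv s). Qed.

Let bar_domain (v : R * R) : weight_domain A (rbar v.1 v.2, sbar v.2).
Proof.
have [h1 h2] := andP (sbar_itv v.2); have [h3 h4] := andP (rbar_itv v.1 v.2).
split => /=; first by apply: sA; rewrite (le_trans h1 h3) h4.
by exists m => //; rewrite (le_trans ms0 h1) h3.
Qed.

Let cts_bar : continuous (fun v : R * R => (rbar v.1 v.2, sbar v.2)).
Proof.
have cs : continuous (fun v : R * R => sbar v.2) by apply: cts_clamp; cts.
by rewrite /rbar {1}/clamp; cts.
Qed.

Let cWbar : cont2 Wbar. Proof. exact: (cts_within cW cts_bar bar_domain). Qed.
Let cdWbar : cont2 dWbar. Proof. exact: (cts_within cdW cts_bar bar_domain). Qed.

Let WbarE r s : s0 <= s -> s <= r -> r <= b -> Wbar r s = W r s.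
Proof.
move=> ss sr rb; rewrite /Wbar /rbar /sbar.
by rewrite (clamp_id (x := s)) ?ss ?(le_trans sr)// clamp_id// sr.
Qed.

Let Wbar_lip : lip_tri s0 b Wbar.
Proof.
apply: (lip_deriv cdWbar cWbar) => s x ss sx xb.
have sb : s <= b by exact: ltW (lt_trans sx xb).
have nI : nbhs x (`]s, b[%classic : set R).
  by apply: open_nbhs_nbhs; split; [exact: interval_open|rewrite /= in_itv/= sx].
have D (y : R) : s < y -> y < b -> weight_domain A (y, s).
  move=> sy yb; split => /=; first by apply: sA; rewrite (le_trans ss (ltW sy)) ltW.
  by exists m => //; rewrite (le_trans ms0 ss) ltW.
have -> : dWbar x s = dW x s.
  rewrite /dWbar /rbar /sbar (clamp_id (x := s)) ?ss ?sb//.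
  by rewrite clamp_id// !ltW.
have h : is_derive x 1 (W^~ s) (dW x s).
  apply: (is_derive_within_interior _ (dWE (D x sx xb))).
  by apply: filterS nI => y /=; rewrite in_itv/= => /andP[]; exact: D.
move/is_derive_cvgP in h; apply/is_derive_cvgP.
apply: cvg_trans h; apply: near_eq_cvg.
have sh : (h + x) @[h --> (0 : R)^'] --> x.
  rewrite -[X in _ --> X]add0r; apply: cvgD; last exact: cvg_cst.
  exact: nbhs_dnbhs.
have I0 : \forall h \near (0 : R)^', (`]s, b[%classic : set R) (h + x) by exact: sh _ nI.
apply: (filterS _ I0) => h /=; rewrite in_itv/= => /andP[h1 h2].
by rewrite !WbarE// ltW.
Qed.

(** The kernel after multiplication of the equation by r^(l + 1) / (2 pi): one
    factor r turns sin phi into s, the others make [zonal2] appear. *)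
Let K r s := gh s * s * Wbar r s * Num.sqrt (gh s ^+ 2 + dgh s ^+ 2 * (r ^+ 2 - s ^+ 2)) *
  zonal2 l (r ^+ 2 - s ^+ 2) (s ^+ 2).

Let gh_gt0 s : s0 <= s -> s <= b -> 0 < gh s.
Proof.
move=> ss sb; have [b0 b1'] := andP b1_itv.
have s_ge0 : 0 <= s by apply: le_trans ss; exact: ltW.
have sb1 : s <= b1 by apply: le_trans sb _; exact: ltW.
rewrite profile_clampE ?s_ge0//; apply: (profile_gt0 cp p_neq0 e1_gt0 p0).
by rewrite s_ge0 (le_lt_trans sb1).
Qed.

Let cK : cont2 K.
Proof.
have c1 : continuous (fun v : R * R => gh v.2) by apply: (cts_comp cgh); cts.
have c2 : continuous (fun v : R * R => dgh v.2) by apply: (cts_comp cdgh); cts.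
have c3 : continuous (fun v : R * R => Wbar v.1 v.2) := cWbar.
have c4 : continuous (fun v : R * R => zonal2 l (v.1 ^+ 2 - v.2 ^+ 2) (v.2 ^+ 2)).
  by apply: cts_zonal2; cts.
by rewrite /cont2 /K; cts.
Qed.

(** Under the square root, gh s ^+ 2 bounds the argument away from 0. *)
Let K_lip : lip_tri s0 b K.
Proof.
have l1 : lip_tri s0 b (fun r s => r ^+ 2 - s ^+ 2).
  apply: lipD; first by apply: lipX; exact: lip_fst.
  by apply: (lip_snd s0 b (h := fun s => - s ^+ 2)); cts.
apply: lipM; last by apply: lip_zonal2 => //; apply: (lip_snd s0 b (h := fun s => s ^+ 2)); cts.
apply: lipM; first by apply: lipM => //; apply: (lip_snd s0 b (h := fun s => gh s * s)); cts.
have [c cI cmin] := EVT_min (ltW s0b) (continuous_subspaceT cgh).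
move: cI; rewrite in_itv/= => /andP[sc cb]; have gc := gh_gt0 sc cb.
apply: (lip_sqrt (c := gh c ^+ 2)); first by rewrite exprn_gt0.
  move=> s r ss sr rb.
  have gg : gh c <= gh s by apply: cmin; rewrite in_itv/= ss (le_trans sr).
  have gs := gh_gt0 ss (le_trans sr rb).
  have s_ge0 : 0 <= s by apply: le_trans ss; exact: ltW.
  apply: (@le_trans _ _ (gh s ^+ 2)); first by rewrite ler_pXn2r// nnegrE ltW.
  rewrite lerDl mulr_ge0 ?sqr_ge0// subr_ge0 ler_pXn2r// nnegrE//.
  exact: le_trans sr.
apply: lipD; first by apply: (lip_snd s0 b (h := fun s => gh s ^+ 2)); cts.
by apply: lipM => //; apply: (lip_snd s0 b (h := fun s => dgh s ^+ 2)); cts.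
Qed.

Let K_diag_neq0 s : s0 <= s -> s <= b -> K s s != 0.
Proof.
move=> ss sb; have s_gt0 : 0 < s by exact: lt_le_trans ss.
have gs := gh_gt0 ss sb.
rewrite /K subrr mulr0 addr0 sqrtr_sqr gtr0_norm// WbarE//.
have Wss : W s s != 0 by apply/eqP; apply: W_diag; apply: sA; rewrite ss.
have z2 : zonal2 l (0 : R) (s ^+ 2) != 0 by apply: zonal2_diag => //; rewrite exprn_gt0.
by do !apply: mulf_neq0 => //; rewrite gt_eqF.
Qed.

Let abel_eq r : 0 <= r <= b -> \cint_(0, pi / 2) (fun phi => K r (r * sin phi) * u (r * sin phi)) = 0.
Proof.
move=> /andP[r0 rb].
have pi0 := pi_gt0 R.
have sin_itv (phi : R) : 0 <= phi <= pi / 2 -> 0 <= r * sin phi <= r.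
  move=> /andP[h1 h2]; have sphi0 : 0 <= sin phi by apply: sin_ge0_pi; apply/andP; split; lra.
  by rewrite mulr_ge0//= ler_piMr//; exact: sin_le1.
have [rs0|s0r] := leP r s0.
  rewrite -[RHS](cint0 0 (pi / 2)); apply: eq_cint => phi /sin_itv/andP[h1 h2].
  by rewrite u0 ?mulr0// h1 (le_trans h2).
have Ar : A r by apply: sA; rewrite ltW.
have rb1 : r < b1 := le_lt_trans rb bb1.
pose H phi := spindle_weight p dp w b1 m r phi *
  (2 * pi * zonal l (cos phi) (sin phi ^+ 2) * u (r * sin phi)).
have cw := cts_spindle_weight cp cdp b1_itv m_min cW Ar.
have cs : continuous (fun phi : R => r * sin phi) by cts.
have cz : continuous (fun phi : R => zonal l (cos phi) (sin phi ^+ 2)) by apply: cts_zonal; cts.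
have cH : continuous H.
  by rewrite /H; have cus := cts_comp cu cs; cts.
have int_pi : \cint_(0, pi) H = 0.
  have t1 := spindle_transform cp cdp dpE p_neq0 e1_gt0 p0 w_branches b1_itv m_min f1t cW l partE iz Ar rb1.
  have t2 := spindle_transform cp cdp dpE p_neq0 e1_gt0 p0 w_branches b1_itv m_min f2t cW l partE iz Ar rb1.
  have [/andP[_ r1] _] := Ar.
  have cf1 : continuous f1 by case: f1t => /(_ 0%N).
  have cf2 : continuous f2 by case: f2t => /(_ 0%N).
  have c1 := cts_comp (cts_sphere_moment (z := z) (l := l) partE cf1) (cts_comp cgh cs).
  have c2 := cts_comp (cts_sphere_moment (z := z) (l := l) partE cf2) (cts_comp cgh cs).
  have cwz (v : R -> R) : continuous v -> continuous (fun phi => spindle_weight p dp w b1 m r phi *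
      (2 * pi * zonal l (cos phi) (sin phi ^+ 2) * v phi)).
    by move=> cv; cts.
  have HE phi : H phi = spindle_weight p dp w b1 m r phi *
      (2 * pi * zonal l (cos phi) (sin phi ^+ 2) * moment f1 (gh (r * sin phi))) -
      spindle_weight p dp w b1 m r phi *
      (2 * pi * zonal l (cos phi) (sin phi ^+ 2) * moment f2 (gh (r * sin phi))).
    by rewrite /H /u !mulrBr.
  rewrite (eq_cint (fun phi _ => HE phi)) (cintB _ _ (cwz _ c1) (cwz _ c2)).
  apply/eqP; rewrite subr_eq0; apply/eqP.
  apply: etrans (esym t1) _; apply: etrans _ t2.
  apply: eq_cint => a aI; apply: eq_cint => c cI.
  by rewrite (@spindle_eq r a c)// r0 ltW.
(* For even l the integrand is symmetric about phi = pi / 2. *)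
have H_half : \cint_(0, pi / 2) H = 0.
  have pE : 2 * (pi / 2) = pi :> R by rewrite mulrC divfK.
  have refl : \cint_(pi / 2, pi) H = \cint_(0, pi / 2) H.
    have pi2 : 0 <= pi / 2 :> R by rewrite divr_ge0// ltW.
    have := cint_reflect cH pi2; rewrite pE => ->.
    apply: eq_cint => phi _; rewrite /H /spindle_weight.
    have sE : sin (pi - phi) = sin phi by rewrite sinB sinpi cospi; ring.
    have cE : cos (pi - phi) = - cos phi by rewrite cosB sinpi cospi; ring.
    by rewrite sE cE zonal_reflect// !mulrN sqrrN.
  have := int_pi; rewrite (@cint_chasles _ H 0 (pi / 2) pi)//; [|lra..].
  by rewrite refl => h; lra.
transitivity (r ^+ l.+1 / (2 * pi) * \cint_(0, pi / 2) H); last by rewrite H_half mulr0.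
rewrite -cintZl//; apply: eq_cint => phi phiI; have /andP[h1 h2] := sin_itv _ phiI.
rewrite /H; set s := r * sin phi in h1 h2 *.
have [ss|ss] := leP s s0; first by rewrite u0 ?h1// !mulr0.
have zE : r ^+ l * zonal l (cos phi) (sin phi ^+ 2) = zonal2 l (r ^+ 2 - s ^+ 2) (s ^+ 2).
  by rewrite zonal_even// cos2sin2 /s exprMn; congr zonal2; ring.
rewrite /K /spindle_weight -/s WbarE//; last exact: ltW.
have -> : (dgh s * (r * cos phi)) ^+ 2 = dgh s ^+ 2 * (r ^+ 2 - s ^+ 2).
  by have C := cos2sin2 phi; rewrite /s; ring: C.
rewrite clamp_id; last by rewrite h2 (le_trans ms0)// ltW.
rewrite -zE (exprS r l) {2}/s -/W.
have tp : 2 * pi != 0 :> R by rewrite mulf_neq0// gt_eqF.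
move: (2 * pi) tp => t t0; set q := Num.sqrt _; field.
by [].
Qed.

Lemma local_uniqueness : exists2 eta : R, 0 < eta & forall s, s0 <= s <= s0 + eta -> u s = 0.
Proof.
have [_ [C C0 HC]] := K_lip.
have cKd : continuous (fun s => `|K s s|).
  by apply: cts_norm; apply: (cts2 cK); cts.
have [c cI cmin] := EVT_min (ltW s0b) (continuous_subspaceT cKd).
move: cI; rewrite in_itv/= => /andP[sc cb].
apply: (@abel_uniqueness R K u s0 b C `|K c c|) => //.
by rewrite normr_gt0; exact: K_diag_neq0.
Qed.

End local.

(** The clamped profile agrees with g on [0, x1], and the difference of the
    moments vanishes there by continuation from 0: at a limit point s0 of the
    points where it does not, g s0 belongs to the compact set of radii of the
    supports, so that g maps a neighbourhood of s0 into the open set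
    ]0, e1[ `|` ]e2, e3[ and that neighbourhood lies in A. *)
Lemma moment_unique x1 : 0 <= x1 < 1 -> moment f1 (g x1) = moment f2 (g x1).
Proof.
move=> /andP[x10 x11].
have [b1 xb1 b11] : exists2 b1, x1 < b1 & b1 < 1 by exists ((1 + x1) / 2); lra.
have b1_itv : 0 <= b1 < 1 by rewrite b11 andbT (le_trans x10)// ltW.
pose gh := profile_clamp p b1.
have cgh : continuous gh := cts_profile cp b1_itv.
have ghE t : 0 <= t <= x1 -> gh t = g t.
  by move=> /andP[t0 tx]; rewrite /gh profile_clampE// t0 (le_trans tx)// ltW.
have gh_gt0 t : 0 <= t <= x1 -> 0 < gh t.
  move=> tI; rewrite ghE//; apply: (profile_gt0 cp p_neq0 e1_gt0 p0).
  by have [t0 tx] := andP tI; rewrite t0 (le_lt_trans tx).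
suff /(_ x1) : forall t, 0 <= t <= x1 -> moment f1 (gh t) - moment f2 (gh t) = 0.
  have ghx1 : gh x1 = g x1 by apply: ghE; rewrite x10 lexx.
  by rewrite -ghx1 x10 lexx => /(_ isT)/eqP; rewrite subr_eq0 => /eqP.
apply: vanish_by_continuation => s0 /andP[s0_ge0 s0x1] Zs0 u0.
pose N := radii f1 `|` radii f2.
have cN : closed N by apply: closedU; [exact: (radii_closed f1t)|exact: (radii_closed f2t)].
have N_range rho : N rho -> 0 < rho < e1 \/ e2 < rho < e3.
  by case; [exact: (radii_range f1t)|exact: (radii_range f2t)].
(* A' is the part of A below x1, which is closed; its infimum is min A. *)
pose A' := [set t | 0 <= t <= x1 /\ (0 <= gh t <= e1 \/ e2 <= gh t <= e3)].
have A'E : A' = `[0, x1]%classic `&` gh @^-1` (`[0, e1]%classic `|` `[e2, e3]%classic).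
  by apply/seteqP; split => t /=; rewrite !in_itv.
have cA' : closed A'.
  rewrite A'E; apply: closedI; first exact: interval_closed.
  apply: closed_comp; first by move=> t _; exact: cgh.
  by apply: closedU; exact: interval_closed.
have [Ns0 A's0] : N (gh s0) /\ A' s0.
  have cNA : closed (gh @^-1` N `&` A').
    by apply: closedI => //; apply: closed_comp => // t _; exact: cgh.
  apply: cNA; apply: closureS Zs0 => t [tI ut].
  have Nt : N (gh t).
    apply: contrapT => nN; move/eqP: ut; apply.
    have g0 := ltW (gh_gt0 _ tI).
    by rewrite !moment_vanish ?subrr// => h; apply: nN; [right|left].
  split=> //; split=> //.
  by case: (N_range _ Nt) => /andP[h1 h2]; [left|right]; rewrite !ltW.
have A'lb : has_lbound A' by exists 0 => t [/andP[]].
have A'0 : A' !=set0 by exists s0.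
pose m := inf A'.
have A'm : A' m by apply: (@inf_closed _ A' A').
have A'A t : A' t -> A t.
  move=> [tI gt]; split; last by rewrite -(ghE _ tI).
  by have [h1 h2] := andP tI; rewrite h1 (le_lt_trans h2).
have m_min : is_min A m.
  split; first exact: A'A.
  move=> t [/andP[t0 t1] gt]; have [tx|xt] := leP t x1.
    by apply: ge_inf => //; split; [rewrite t0|rewrite ghE// t0].
  by apply: ltW; apply: le_lt_trans xt; case: A'm => /andP[].
have ms0 : m <= s0 by exact: ge_inf.
have m_gt0 : 0 < m := min_gt0 p0 m_min.
have s0_gt0 : 0 < s0 := lt_le_trans m_gt0 ms0.
have : nbhs (gh s0) (`]0, e1[%classic `|` `]e2, e3[%classic : set R).
  apply: open_nbhs_nbhs; split; first by apply: openU; exact: interval_open.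
  by case: (N_range _ Ns0) => h; [left|right]; rewrite /= in_itv.
move=> /(cgh s0)[d /= d0 dB].
have s0b1 : s0 < b1 := le_lt_trans s0x1 xb1.
have [b s0b [bd bb1]] : exists2 b, s0 < b & b <= s0 + d / 2 /\ b < b1.
  have [h|h] := leP (s0 + d / 2) ((s0 + b1) / 2); [exists (s0 + d / 2)|exists ((s0 + b1) / 2)]; lra.
have sA t : s0 <= t <= b -> A t.
  move=> /andP[st tb].
  have t0 : 0 <= t by exact: le_trans st.
  have tb1 : t <= b1 by rewrite (le_trans tb)// ltW.
  have := dB t; rewrite /ball/= distrC ger0_norm ?subr_ge0// => /(_ _)/wrap[|]; first by lra.
  rewrite /gh profile_clampE ?t0// => gt.
  split; first by rewrite t0 (le_lt_trans tb1).
  by case: gt => /=; rewrite in_itv/= => /andP[h1 h2]; [left|right]; rewrite !ltW.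
apply: (local_uniqueness b1_itv m_min ms0 s0b bb1 sA).
apply: vanish_closed_right => //.
have cf1 : continuous f1 by case: f1t => /(_ 0%N).
have cf2 : continuous f2 by case: f2t => /(_ 0%N).
have c1 := cts_comp (cts_sphere_moment (z := z) (l := l) partE cf1) cgh.
have c2 := cts_comp (cts_sphere_moment (z := z) (l := l) partE cf2) cgh.
exact: (ctsD c1 (ctsN c2)).
Qed.

End uniqueness.

Theorem theorem2 (R : realType) (p g : R -> R) (e1 e2 e3 : R) (A : set R)
    (w W : R -> R -> R) (Omega : set 'cV[R]_3)
    (p_C1 : C1_on [set` `[0, pi / 2]] p)
    (p_neq0 : forall phi, 0 <= phi <= pi / 2 -> p phi <> 0)
    (gE : g = fun x => p (asin x))
    (e1_gt0 : 0 < e1) (e12 : e1 < e2) (e23 : e2 < e3)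
    (p0 : e1 < p 0 < e2)
    (AE : A = admissible_radii g e1 e2 e3)
    (w_int : forall r, 0 <= r <= 1 ->
       integrable lebesgue_measure [set` `[0, pi]] (fun phi => (w r phi)%:E))
    (WE : W = weight_radial w)
    (w_branches : weight_both_branches (weight_domain A) w)
    (W_C1 : weight_C1 (weight_domain A) W)
    (W_diag : forall rho, A rho -> W rho rho <> 0)
    (OmegaE : Omega = hollow_ball 0 e1 `|` hollow_ball e2 e3)
    (f1 f2 : 'cV[R]_3 -> R)
    (f1_test : test_function Omega f1) (f2_test : test_function Omega f2)
    (spindle_eq : forall r alpha beta,
       0 <= r <= 1 -> 0 <= alpha <= 2 * pi -> 0 <= beta <= pi ->
       spindle w p f1 r alpha beta = spindle w p f2 r alpha beta) :
  forall (l : nat) (m : int) (rho : R),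
    ~~ odd l -> (`|m| <= l)%N -> (g @` [set` `[0, 1[]) rho ->
    harmonic_coef f1 l m rho = harmonic_coef f2 l m rho.
Proof.
move=> l m _ l_even ml [s s01 <-]; subst g A W Omega.
have [dp cdp dpE] := p_C1; have [cW [dW cdW dWE]] := W_C1.
apply: harmonic_coef_eq ml; [by case: f1_test => /(_ 0%N)|by case: f2_test => /(_ 0%N)|].
move=> z part iz partE.
have s01' : 0 <= s < 1 by move: s01; rewrite /= in_itv.
exact: (moment_unique cdp dpE p_neq0 e1_gt0 p0 w_branches cW cdW dWE W_diag
  f1_test f2_test spindle_eq partE iz l_even s01').
Qed.
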